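(* Let $K\subset\mathbb R^n$ be a full-dimensional compact convex body with barycenter $0$, $\operatorname{int}(K)\cap\mathbb Z^n=\{0\}$ and $\operatorname{vol}(K)=(n+1)^n/n!$, let $\varphi$ be a BB13 potential of $K$, let $v\in\mathbb R^n\setminus E$, and let $\psi_t$ be a subsequential toric limit ray for $v$, taken along a fixed subsequence of $k$'s. Assume that $\psi_t(x)=\varphi(x-tc)+nt$ for a vector $c\in\mathbb R^n$ and all $x\in\mathbb R^n$, $t\ge0$. Then $c\ne0$. Put \[ \ell(y)=n-\langle c,y\rangle\qquad(y\in K). \] Then $0\le\ell\le n+1$ on $K$, and for every $s\in[0,n+1]$ the cap $C_s=\{y\in K:\ell(y)\le s\}$ satisfies \[ \operatorname{vol}(C_s)=\frac{s^n}{n!}. \] Moreover $C_0$ consists of a single point $p$, one has \[ C_s=p+\frac{s}{n+1}(K-p)\qquad(0\le s\le n+1), \] and, with $B=\{y\in K:\ell(y)=n+1\}$, the body $K$ is the pyramid $K=\operatorname{conv}(\{p\}\cup B)$ with apex $p$ and base $B$; finally $h_K(c)=n$ and $h_K(-c)=1$.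
   Context: The barycenter of $K$ is $\frac1{\operatorname{vol}(K)}\int_K y\,dy$; $h_K(x)=\max_{y\in K}\langle y,x\rangle$ is the support function. Torus: $X=(\mathbb C^* )^n$ with coordinates $z_i=\exp(x_i/2+i\theta_i)$, $x\in\mathbb R^n$, $\theta\in(\mathbb R/2\pi\mathbb Z)^n$; $d\nu=dx\,d\theta$, with $d\theta$ Haar measure of total mass one. Torus-invariant functions on $X$ are identified with functions of $x\in\mathbb R^n$. BB13 potential of $K$: a smooth strictly convex $\varphi:\mathbb R^n\to\mathbb R$ such that $\nabla\varphi$ is a diffeomorphism from $\mathbb R^n$ onto $\operatorname{int}(K)$, $\det(D^2\varphi)=e^{-\varphi}$, and $\varphi-h_K$ is bounded. For $k\ge1$: $S_k=\mathbb Z^n\cap\operatorname{int}(kK)$, $N_k=(n+1)k$; $H_k$ is the Hilbert space of holomorphic $f$ on $X$ with $\int_X|f|^2e^{-k\varphi}d\nu<\infty$ (weighted $L^2$ inner product). The Laurent monomials $z^m$, $m\in S_k$, form an orthogonal basis of $H_k$; $s_{k,m}=z^m/\|z^m\|_{H_k}$. For $p\in X$, $j\ge1$: $F_{k,p}^j=\{s\in H_k:\operatorname{ord}_p(s)\ge j\}$ (vanishing order at $p$, $\operatorname{ord}_p(0)=+\infty$); $P_{k,p}^j$ is the orthogonal projection of $H_k$ onto $F_{k,p}^j$. The subscript $1$ denotes the point $(1,\dots,1)$. The exceptional set $E$: for a nonzero subspace $F\subseteq H_k$ of dimension $r$, write a nonzero $\xi\in\bigwedge^rF$ as $\xi=\sum_{\#I=r}c_I\bigwedge_{m\in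 I}s_{k,m}$ and let $P(F)=\operatorname{conv}\{\sum_{m\in I}m:c_I\ne0\}$ (independent of $\xi$). $E$ is the countable union, over all $k\ge1$ and all $1\le j\le N_k$ with $F_{k,1}^j\ne0$, of the linear hyperplanes perpendicular to the nonzero differences of vertices of $P(F_{k,1}^j)$. Weights and rays: for $v\in\mathbb R^n\setminus E$ and $p_R=(e^{-Rv_1},\dots,e^{-Rv_n})$, the operators $\sum_{j=1}^{N_k}P_{k,p_R}^j$ converge in operator norm as $R\to\infty$ to an operator that is diagonal in the basis $(s_{k,m})_{m\in S_k}$, whose eigenvalue on $s_{k,m}$ is an integer $q_{k,m}\in[0,N_k]$. The associated toric monomial ray is $u_{k,t}(z)=\frac1k\log\sum_{m\in S_k}|s_{k,m}(z)|^2e^{tq_{k,m}}$, $t\ge0$. Subsequential toric limit ray for $v$: a torus-invariant ray $\psi_t$, $t\ge0$, that is the locally uniform limit on $X\times[0,\infty)$ of $u_{k,t}$ along some sequence of positive integers $k\to\infty$, with $\psi_0=\varphi$, $0\le\psi_t-\varphi\le(n+1)t$, $(x,t)\mapsto\psi_t(x)$ convex on $\mathbb R^n\times[0,\infty)$, and $-\log\bigl(\frac1{\operatorname{vol}(K)}\int_Xe^{-\psi_t}d\nu\bigr)=nt$ for all $t\ge0$. *)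

(* Defs.v *)
From HB Require Import structures.
From mathcomp Require Import all_boot all_order all_algebra finmap.
From mathcomp Require Import all_classical all_reals all_analysis.
From mathcomp Require Import complex.

Set Implicit Arguments.
Unset Strict Implicit.
Unset Printing Implicit Defensive.

Import Order.TTheory GRing.Theory Num.Theory.
Import numFieldNormedType.Exports.

Local Open Scope classical_set_scope.
Local Open Scope ring_scope.

(* Lebesgue measure on R^n, as the n-fold product of [lebesgue_measure] *)
Section lebesgue_tuple.
Variable R : realType.
Local Notation T := (measurableTypeR R).

Definition pcons n (p : T * n.-tuple T) : n.+1.-tuple T := [tuple of p.1 :: p.2].

Lemma measurable_pcons n : measurable_fun setT (@pcons n).
Proof. exact: (measurable_cons measurable_fst measurable_snd). Qed.

Section step.
Variables (n : nat) (mu : {sigma_finite_measure set (n.-tuple T) -> \bar R}).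

Definition leb_step : set (n.+1.-tuple T) -> \bar R :=
  pushforward (lebesgue_measure \x mu)%E (@pcons n).

Let leb_step0 : leb_step set0 = 0%E.
Proof. by rewrite /leb_step /pushforward preimage_set0 measure0. Qed.

Let leb_step_ge0 A : (0 <= leb_step A)%E.
Proof. by rewrite /leb_step /pushforward; exact: integral_ge0. Qed.

Let leb_step_sigma_additive : semi_sigma_additive leb_step.
Proof.
have mcons A : measurable A -> measurable (@pcons n @^-1` A).
  by move=> mA; rewrite -[X in measurable X]setTI; exact: measurable_pcons.
move=> F mF tF mUF; rewrite /leb_step /pushforward preimage_bigcup.
apply: measure_semi_sigma_additive.
- by move=> i; exact: mcons.
- apply/trivIsetP => /= i j _ _ ij; rewrite -preimage_setI.
  by move/trivIsetP : tF => /(_ _ _ _ _ ij) ->//; rewrite preimage_set0.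
- by rewrite -preimage_bigcup; exact: mcons.
Qed.

HB.instance Definition _ := isMeasure.Build _ _ _ leb_step
  leb_step0 leb_step_ge0 leb_step_sigma_additive.

Let leb_step_sigma_finite : sigma_finite setT leb_step.
Proof.
have /sigma_finiteP[F [FT ndF Ffin]] := @sigma_finiteT _ _ _ (@lebesgue_measure R).
have /sigma_finiteP[G [GT ndG Gfin]] := @sigma_finiteT _ _ _ mu.
pose H i : set (n.+1.-tuple T) :=
  [set y | F i (thead y) /\ G i [tuple of behead y]].
have HE i : @pcons n @^-1` (H i) = F i `*` G i.
  have bK (x : T) (y : n.-tuple T) :
      [tuple of behead [tuple of x :: y]] = y :> n.-tuple T by exact/val_inj.
  by apply/funext => -[x y]; rewrite /H /preimage /setX /pcons /= theadE bK.
exists H => [|i].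
  apply/seteqP; split=> // y _.
  have : (\bigcup_i F i) (thead y) by rewrite -FT.
  have : (\bigcup_i G i) [tuple of behead y] by rewrite -GT.
  move=> [j _ Gj] [i _ Fi]; exists (maxn i j) => //; split.
  - exact: (subsetPset _ _ (ndF _ _ (leq_maxl i j))).
  - exact: (subsetPset _ _ (ndG _ _ (leq_maxr i j))).
have [mF Fi] := Ffin i; have [mG Gi] := Gfin i; split.
- have -> : H i = (fun y : n.+1.-tuple T => tnth y ord0) @^-1` F i `&`
      (fun y : n.+1.-tuple T => [tuple of behead y] : n.-tuple T) @^-1` G i.
    by [].
  apply: measurableI; rewrite -[X in measurable X]setTI.
  + exact: measurable_tnth.
  + exact: measurable_behead.
- rewrite /leb_step /pushforward HE product_measure1E//.
  by rewrite lte_mul_pinfty// ge0_fin_numE.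
Qed.

HB.instance Definition _ := Measure_isSigmaFinite.Build _ _ _ leb_step
  leb_step_sigma_finite.

Definition leb_succ : {sigma_finite_measure set (n.+1.-tuple T) -> \bar R} := leb_step.
End step.

Fixpoint leb n : {sigma_finite_measure set (n.-tuple T) -> \bar R} :=
  match n with
  | 0 => \d_[tuple]
  | m.+1 => leb_succ (leb m)
  end.
End lebesgue_tuple.

(* topology and norm of R[i] as a one-dimensional normed space over itself *)
HB.instance Definition _ (R : realType) := NormedModule.copy R[i] R[i]^o.

Section calculus.
Variables (K : numFieldType) (n : nat).
Implicit Types f : 'rV[K]_n -> K.

(* [partials [:: i_1; ..; i_r] f] is d_(i_1) ... d_(i_r) f; for K = R[i] the
   derivatives are complex derivatives *)
Definition partials (s : seq 'I_n) f : 'rV[K]_n -> K :=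
  foldr (fun i (g : 'rV[K]_n -> K) => 'D_(delta_mx 0 i) g) f s.

Definition smooth_on (U : set 'rV[K]_n) f :=
  forall s x, U x -> {for x, continuous (partials s f)} /\
    forall i, derivable (partials s f) x (delta_mx 0 i).

(* for K = R[i] and U open, complex differentiability at every point of U *)
Definition holomorphic_on (U : set 'rV[K]_n) f :=
  forall z, U z -> differentiable f z.

End calculus.

(* order of vanishing of f at p: the least order of a partial derivative that
   is nonzero at p (+oo if there is none) *)
Definition vord (R : realType) (n : nat) (p : 'rV[R[i]]_n)
    (f : 'rV[R[i]]_n -> R[i]) : \bar R :=
  ereal_inf [set (size s)%:R%:E | s in [set s | partials s f p != 0]].

Definition locally_uniform_cvg (R : realType) (T : topologicalType) (D : set T)
    (f_ : nat -> T -> R) (f : T -> R) :=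
  forall p, D p -> exists2 U, nbhs p U & {uniform U `&` D, f_ @ \oo --> f}.

Section convex_geometry.
Variables (R : realType) (n : nat).
Local Notation V := 'rV[R]_n.
Implicit Types (A K : set V) (f : V -> R).

Definition dot (x y : V) : R := \sum_i x 0 i * y 0 i.

Definition support_fun (K : set V) (x : V) : R := sup [set dot y x | y in K].

Definition vec (y : n.-tuple (measurableTypeR R)) : V := \row_i tnth y i.

Definition vol A : \bar R := leb R n (vec @^-1` A).

Definition barycenter (K : set V) : V :=
  \row_i ((fine (vol K))^-1 * \int[leb R n]_(y in vec @^-1` K) tnth y i).

Definition convex_body (K : set V) :=
  [/\ compact K, convex_set K & K° !=set0].

Definition conv_hull A : set V :=
  \bigcap_(B in [set B : set V | convex_set B /\ A `<=` B]) B.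

Definition vertex (P : set V) (x : V) :=
  P x /\ forall (y z : V) (t : R), P y -> P z -> 0 < t < 1 ->
    x = t *: y + (1 - t) *: z -> y = x /\ z = x.

Definition strictly_convex f :=
  forall (x y : V) (t : R), x != y -> 0 < t < 1 ->
    f (t *: x + (1 - t) *: y) < t * f x + (1 - t) * f y.

Definition grad f (x : V) : V := \row_i 'D_(delta_mx 0 i) f x.

Definition hessian f (x : V) : 'M[R]_n := \matrix_(i, j) partials [:: i; j] f x.

Definition smooth_map_on (U : set V) (g : V -> V) :=
  forall i, smooth_on U (fun x => g x 0 i).

Definition diffeomorphism_onto (g : V -> V) (U : set V) :=
  [/\ smooth_map_on setT g, forall x, U (g x) &
    exists h, [/\ smooth_map_on U h, cancel g h & {in U, cancel h g}]].

Definition BB13_potential (K : set V) f :=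
  [/\ smooth_on setT f, strictly_convex f,
      diffeomorphism_onto (grad f) K°,
      forall x, \det (hessian f x) = expR (- f x) &
      exists M : R, forall x, `|f x - support_fun K x| <= M].

End convex_geometry.

Section torus.
Variables (R : realType) (n : nat).
Local Notation V := 'rV[R]_n.
Local Notation C := R[i].
Local Notation Cn := 'rV[C]_n.
Local Notation T := (measurableTypeR R).

Definition torus : set Cn := [set z | forall i, z 0 i != 0].

Definition cabs2 (z : C) : R := complex.Re z ^+ 2 + complex.Im z ^+ 2.

(* z_i = exp (x_i / 2 + i theta_i) *)
Definition torus_pt (x theta : V) : Cn := \row_i
  Complex (expR (x 0 i / 2) * cos (theta 0 i))
          (expR (x 0 i / 2) * sin (theta 0 i)).

(* the coordinate x of a point of the torus: |z_i|^2 = exp x_i *)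
Definition log_coord (z : Cn) : V := \row_i ln (cabs2 (z 0 i)).

Definition angles : set (n.-tuple T) :=
  [set theta | forall i, 0 <= tnth theta i <= 2 * pi].

(* integral over the torus against nu = dx dtheta, dtheta of total mass one *)
Definition int_torus (g : Cn -> \bar R) : \bar R :=
  (((2 * pi) ^- n)%:E *
   \int[leb R n \x leb R n]_(p in setT `*` angles)
     g (torus_pt (vec p.1) (vec p.2)))%E.

(* Functions on the torus are represented by functions on C^n that vanish off
   the torus, so that equality of functions on the torus is [=]. *)
Section weighted_L2.
Variables (phi : V -> R) (k : nat).
Implicit Types (f g : Cn -> C) (F : set (Cn -> C)) (m : 'rV[int]_n).

Definition weight (z : Cn) : R := expR (- (k%:R * phi (log_coord z))).

Definition L2sq f : \bar R :=
  int_torus (fun z => (cabs2 (f z) * weight z)%:E).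

Definition hilb : set (Cn -> C) :=
  [set f | [/\ forall z, ~ torus z -> f z = 0, holomorphic_on torus f &
               (L2sq f < +oo)%E]].

Definition hnorm f : R := Num.sqrt (fine (L2sq f)).

Definition inner f g : C :=
  let h (z : Cn) := f z * (g z)^*%C in
  Complex (fine (int_torus (fun z => (complex.Re (h z) * weight z)%:E)))
          (fine (int_torus (fun z => (complex.Im (h z) * weight z)%:E))).

Definition laurent m : Cn -> C :=
  patch (fun=> 0) torus (fun z => \prod_i z 0 i ^ m 0 i).

Definition sect m : Cn -> C := fun z => laurent m z / (hnorm (laurent m))%:C%C.

Definition vanishing (p : Cn) (j : nat) : set (Cn -> C) :=
  [set f | hilb f /\ (j%:R%:E <= vord p f)%E].

Definition orth_proj F f : Cn -> C :=
  xget (fun=> 0)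
    [set g | F g /\ forall h, F h -> inner (fun z => f z - g z) h = 0].

Definition opnorm (A : (Cn -> C) -> (Cn -> C)) : \bar R :=
  ereal_sup [set (hnorm (A f))%:E | f in [set f | hilb f /\ hnorm f <= 1]].

Definition is_basis F (r : nat) (b : 'I_r -> Cn -> C) :=
  (forall i, F (b i)) /\
  forall f, F f -> exists! a : 'rV[C]_r, f = fun z => \sum_i a 0 i * b i z.

(* coefficient of b_1 /\ .. /\ b_r on the wedge of the s_(k,m), m in I, the
   elements of I being taken in the order of their enumeration *)
Definition wedge_coef (r : nat) (b : 'I_r -> Cn -> C) (I : {fset 'rV[int]_n}) :
    C :=
  \det (\matrix_(i < r, j < r) inner (b i) (sect (nth 0 (enum_fset I) j))).

End weighted_L2.

Definition real_pt (m : 'rV[int]_n) : V := map_mx intr m.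

Definition lattice_pts (K : set V) (k : nat) : set 'rV[int]_n :=
  [set m | (( *:%R k%:R) @` K)° (real_pt m)].

Definition one_pt : Cn := const_mx 1.

Definition ray_pt (v : V) (r : R) : Cn := \row_i (expR (- (r * v 0 i)))%:C%C.

Section weights.
Variables (K : set V) (phi : V -> R).

Definition wedge_polytope (k : nat) (F : set (Cn -> C)) : set V :=
  conv_hull [set y | exists r (b : 'I_r -> Cn -> C) (I : {fset 'rV[int]_n}),
    [/\ is_basis F b, [set` I] `<=` lattice_pts K k, #|` I|%fset = r,
        wedge_coef phi k b I != 0 & y = \sum_(m <- enum_fset I) real_pt m]].

Definition exceptional : set V :=
  [set v | exists k j, [/\ (1 <= k)%N, (1 <= j <= n.+1 * k)%N,
    exists2 f, vanishing phi k one_pt j f & f <> (fun=> 0) &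
    let P := wedge_polytope k (vanishing phi k one_pt j) in
    exists a b, [/\ vertex P a, vertex P b, a != b & dot v (a - b) = 0]]].

Definition sum_proj (k : nat) (p : Cn) (f : Cn -> C) : Cn -> C :=
  fun z => \sum_(1 <= j < (n.+1 * k).+1)
    orth_proj phi k (vanishing phi k p j) f z.

Definition diag_op (k : nat) (q : 'rV[int]_n -> nat) (f : Cn -> C) : Cn -> C :=
  fun z => \sum_(m \in lattice_pts K k)
    (q m)%:R * inner phi k f (sect phi k m) * sect phi k m z.

(* [q k m] is the eigenvalue on s_(k,m) of the operator-norm limit of the sums
   of projections at p_R as R tends to infinity *)
Definition toric_weights (v : V) (q : nat -> 'rV[int]_n -> nat) :=
  forall k, (1 <= k)%N ->
    (forall m, lattice_pts K k m -> (q k m <= n.+1 * k)%N) /\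
    opnorm phi k (fun f z => sum_proj k (ray_pt v r) f z - diag_op k (q k) f z)
      @[r --> +oo%R] --> 0%E.

Definition monomial_ray (q : nat -> 'rV[int]_n -> nat) (k : nat) (t : R)
    (z : Cn) : R :=
  k%:R^-1 * ln (\sum_(m \in lattice_pts K k)
                  cabs2 (sect phi k m z) * expR (t * (q k m)%:R)).

Definition toric_limit_ray (v : V) (k_ : nat -> nat) (psi : R -> V -> R) :=
  exists2 q, toric_weights v q &
  [/\ [/\ forall i, (1 <= k_ i)%N, k_ @ \oo --> \oo &
      locally_uniform_cvg
        [set p : Cn * R | torus p.1 /\ 0 <= p.2]
        (fun i p => monomial_ray q (k_ i) p.2 p.1)
        (fun p => psi p.2 (log_coord p.1))],
      psi 0 = phi,
      forall t x, 0 <= t -> 0 <= psi t x - phi x <= n.+1%:R * t,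
      convex_function [set p : V * R | 0 <= p.2] (fun p => psi p.2 p.1) &
      forall t, 0 <= t ->
        (- lne ((fine (vol K))^-1%:E *
               int_torus (fun z => (expR (- psi t (log_coord z)))%:E)))%E
        = (n%:R * t)%:E].

End weights.
End torus.

Section cap.
Variables (R : realType) (n : nat).
Local Notation V := 'rV[R]_n.

Definition ell (c y : V) : R := n%:R - dot c y.

Definition cap (K : set V) (c : V) (s : R) : set V :=
  [set y | K y /\ ell c y <= s].

End cap.

(* Main.v *)
Require Import Defs.
From mathcomp Require Import all_boot all_order all_algebra.
From mathcomp Require Import all_classical all_reals all_analysis.
From mathcomp Require Import measurable_realfun complex ring lra zify.

(** Why the theorem is true.

    Evaluate the limit ray at time [1]. Since [psi_1 (x) = phi (x - c) + n] lies
    between [phi] and [phi + n + 1], comparing gradients turns these two bounds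
    into [0 <= ell <= n + 1] on [K] ([ell_bounds]).

    The weights [q] are small at few lattice points. Sections vanishing to
    order [J + 1] at a point of the torus are cut out by one linear condition
    for each multi-index of size at most [J], that is by ['C(n + J, n)]
    conditions. If [q <= J] held at more lattice points than that, a unit
    combination [f] of the corresponding monomial sections would vanish to
    order [J + 1] at [p_R]; the sum of the projections would have quadratic
    form at least [J + 1] at [f], and the diagonal operator at most [J], so
    that their difference would have norm at least [1] for every [R]
    ([weight_count]).

    Convergence of the ray forces weights to be small in turn. Let [y] be an
    interior point of [K], let [x] be the point with [grad phi x = y], and let
    [m] be the integer part of [k y]. The norm of [z^m] is an integral that the
    Laplace method bounds by [exp (k (<y, x> - phi x) + O(1))]
    ([growth_cell_le]). As the term of [m] is at most the whole sum, the limit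
    [phi x + n] of [u_(k,1)] at [x + c] gives [q / k <= ell y + o(1)]
    ([eventually_small_weight]). Counting the cubes of side [1 / k] that such
    [m] label, [vol {ell < s} <= lim 'C(n + k s, n) / k ^ n = s ^ n / n!]
    ([sublevel_volume]).

    The rest is convex geometry. The barycenter of [K] is the origin, so the
    integral of [n + 1 - ell] over [K] equals [vol K]. By layers, this integral
    is that of [vol {ell <= s}] over [s] in [[0, n + 1]], which is at most the
    integral of [s ^ n / n!], and that is again [vol K]. Losing an initial
    interval of [s] is thus impossible, and [ell] vanishes at some [p] in [K]
    ([exists_apex]). By convexity the copy [p + s / (n + 1) (K - p)] of [K] lies
    in [{ell <= s}]; its volume is [s ^ n / n!], the upper bound for the cap.
    A convex cap and a compact subset of the same volume coincide
    ([cap_shrink]), and the pyramid structure can be read off from these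
    equalities. *)

Set Implicit Arguments.
Unset Strict Implicit.
Unset Printing Implicit Defensive.

Import Order.TTheory GRing.Theory Num.Theory.
Import numFieldNormedType.Exports.

Local Open Scope classical_set_scope.
Local Open Scope ring_scope.

(** * Lebesgue measure on tuples: cells, continuity, homotheties *)

Lemma rV_nbhsP (R : realType) n (x : 'rV[R]_n) (U : set 'rV[R]_n) :
  nbhs x U <-> exists2 e : R, 0 < e &
    forall y : 'rV[R]_n, (forall i, `|x 0 i - y 0 i| < e) -> U y.
Proof.
split.
  move=> /nbhs_ballP[e /= e0 eU]; exists e => // y xy; apply: eU; split=> // i j.
  by rewrite ord1 /ball /=; exact: xy.
move=> [e e0 eU]; apply/nbhs_ballP; exists e => //= y; rewrite /ball /= => -[_ xy].
by apply: eU => i; exact: xy.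
Qed.

(** Each [g k] cuts the space into countably many measurable cells. A set that
    contains the whole cell of each of its points, for some [k], is a countable
    union of cells. With cubes of side [1 / k] as cells this gives the
    measurability of open sets and of continuous functions. *)
Lemma open_cells_measurable d (X : measurableType d) (I : countType)
    (g : nat -> X -> I) (W : set X) :
  (forall k i, measurable (g k @^-1` [set i])) ->
  (forall x, W x -> exists k, forall x', g k x' = g k x -> W x') ->
  measurable W.
Proof.
move=> mg gW.
pose F k i : set X := if `[< g k @^-1` [set i] `<=` W >] then g k @^-1` [set i]
  else set0.
have -> : W = \bigcup_k \bigcup_i F k i.
  apply/seteqP; split=> [x /gW[k kW]|x [k _ [i _]]].
    by exists k => //; exists (g k x) => //; rewrite /F; case: asboolP.
  by rewrite /F; case: asboolP => // iW; exact: iW.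
apply: bigcupT_measurable => k; apply: countable_bigcupT_measurable => //.
by move=> i; rewrite /F; case: ifP.
Qed.

Lemma open_cells_measurable_fun d (X : measurableType d) (R : realType)
    (I : countType) (g : nat -> X -> I) (f : X -> R) :
  (forall k i, measurable (g k @^-1` [set i])) ->
  (forall x e, 0 < e -> exists k, forall x', g k x' = g k x ->
     `|f x - f x'| < e) ->
  measurable_fun setT f.
Proof.
move=> mg gf; apply: (measurability _ (RGenOInfty.measurableE R)) => _ [_ [a ->] <-].
rewrite setTI; apply: (open_cells_measurable mg) => x /=.
rewrite in_itv/= andbT => ax.
have [k kx] := gf x (f x - a) ltac:(by rewrite subr_gt0).
exists k => x' /kx; rewrite /= in_itv/= andbT ltr_norml; lra.
Qed.

(** The pushforward as a bundled measure, the form in which the uniqueness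
    theorems for measures apply to it. *)
Definition image_measure d d' (X : measurableType d) (Y : measurableType d')
    (R : realType) (mu : {measure set X -> \bar R}) (f : X -> Y)
    (mf : measurable_fun setT f) : {measure set Y -> \bar R} :=
  measure_function_pushforward__canonical__measure_function_Measure mu mf.

Section cells.
Variables (R : realType).
Local Notation T := (measurableTypeR R).

Lemma floor_fiberE k (m : int) : (0 < k)%N ->
  (fun x : T => Num.floor (k%:R * x : R)) @^-1` [set m] =
  `[m%:~R / k%:R, (m + 1)%:~R / k%:R[%classic.
Proof.
move=> k0; have k0' : 0 < k%:R :> R by rewrite ltr0n.
apply/seteqP; split=> x /=; rewrite in_itv/= ler_pdivrMr// ltr_pdivlMr// mulrC.
  by move=> <-; exact: floor_itv.
exact: floor_def.
Qed.

Lemma measurable_floor_fiber k (m : int) :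
  measurable ((fun x : T => Num.floor (k%:R * x : R)) @^-1` [set m]).
Proof.
have [->|k0] := posnP k; last by rewrite floor_fiberE.
under [X in measurable X]eq_set do rewrite mul0r.
have [e|e] := pselect (Num.floor (0 : R) = m).
  by rewrite (_ : [set _ | _] = setT)//; apply/seteqP; split.
by rewrite (_ : [set _ | _] = set0)//; apply/seteqP; split.
Qed.

Lemma lebesgue_floor_fiber k (m : int) : (0 < k)%N ->
  lebesgue_measure ((fun x : T => Num.floor (k%:R * x : R)) @^-1` [set m]) =
  (k%:R^-1)%:E :> \bar R.
Proof.
move=> k0; have k0' : 0 < k%:R :> R by rewrite ltr0n.
rewrite floor_fiberE// lebesgue_measure_itv/= lte_fin ltr_pM2r ?invr_gt0//.
by rewrite ltr_int ltrDl/= -EFinD -mulrBl intrD addrAC subrr add0r mul1r.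
Qed.

(** The integer point [m] labels the half-open cube of side [1 / k] with corner
    [m / k]; it will stand for the lattice point of [kK] near [k y]. *)
Definition cell n (k : nat) (y : n.-tuple T) : 'rV[int]_n :=
  \row_i Num.floor (k%:R * tnth y i).

Lemma cell_close n k (y y' : n.-tuple T) i : (0 < k)%N ->
  cell k y' = cell k y -> `|vec y 0 i - vec y' 0 i| < k%:R^-1.
Proof.
move=> k0 /rowP/(_ i); rewrite !mxE => e.
have := floor_itv (k%:R * tnth y i : R).
have := floor_itv (k%:R * tnth y' i : R); rewrite e intrD.
set a := _%:~R; move=> /andP[h1 h2] /andP[h3 h4].
have k0' : 0 < k%:R :> R by rewrite ltr0n.
rewrite -(ltr_pM2l k0') divff ?gt_eqF// -[k%:R in X in X < _]ger0_norm ?ltW//.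
by rewrite -normrM mulrBr ltr_norml; lra.
Qed.

Lemma cell_measurable n k i : measurable (@cell n k @^-1` [set i]).
Proof.
have -> : @cell n k @^-1` [set i] =
    \bigcap_(j in [set: 'I_n]) (fun y : n.-tuple T => tnth y j) @^-1`
      ((fun x : T => Num.floor (k%:R * x : R)) @^-1` [set i 0 j]).
  apply/seteqP; split=> [y /= <- j _|y /= yi]; first by rewrite /= mxE.
  by apply/rowP => j; rewrite mxE; exact: (yi j).
apply: fin_bigcap_measurable => // j _.
rewrite -[X in measurable X]setTI; apply: measurable_tnth => //.
exact: measurable_floor_fiber.
Qed.

Lemma cell_leb n k i : (0 < k)%N ->
  leb R n (@cell n k @^-1` [set i]) = (k%:R ^- n)%:E.
Proof.
move=> k0; elim: n i => [|n ih] i.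
  rewrite /leb /= diracE mem_set ?expr0 ?invr1//=.
  by apply/rowP => -[].
rewrite /= /leb_step /pushforward.
have -> : @pcons R n @^-1` (@cell n.+1 k @^-1` [set i]) =
    ((fun x : T => Num.floor (k%:R * x : R)) @^-1` [set i 0 ord0]) `*`
    (@cell n k @^-1` [set \row_j i 0 (lift ord0 j)]).
  apply/seteqP; split=> [[x y] /= e|[x y] /= [e1 e2]].
    split; first by rewrite -e mxE.
    by apply/rowP => j; rewrite -e !mxE tnthS.
  apply/rowP => j; rewrite !mxE.
  case: (unliftP ord0 j) => [j' ->|->//].
  by have /rowP/(_ j') := e2; rewrite !mxE tnthS.
rewrite product_measure1E ?ih//; [|exact: measurable_floor_fiber|exact: cell_measurable].
rewrite -[RHS]/(_%:E) exprS invfM EFinM; congr (_ * _)%E.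
exact: lebesgue_floor_fiber.
Qed.

Definition affine n (a : 'rV[R]_n) (r : R) (y : n.-tuple T) : n.-tuple T :=
  [tuple a 0 i + r * (tnth y i : R) | i < n].

Lemma vec_affine n (a : 'rV[R]_n) r y : vec (affine a r y) = a + r *: vec y.
Proof. by apply/rowP => i; rewrite !mxE tnth_mktuple. Qed.

Lemma measurable_affine1 (a r : R) :
  measurable_fun setT (fun x : T => a + r * (x : R) : T).
Proof. by apply: measurable_funD => //; exact: measurable_funM. Qed.

Lemma measurable_affine n (a : 'rV[R]_n) r : measurable_fun setT (affine a r).
Proof.
apply/measurable_fun_tnthP => i.
rewrite (_ : _ \o _ = (fun x : T => a 0 i + r * (x : R) : T) \o
    (fun y : n.-tuple T => tnth y i)); last first.
  by apply/funext => y; rewrite /= tnth_mktuple.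
apply: measurableT_comp; [exact: measurable_affine1|exact: measurable_tnth].
Qed.

(** The pushforward of Lebesgue measure by [x |-> a + r x], scaled by [r], agrees
    with Lebesgue measure on intervals. *)
Lemma lebesgue_affine (a r : R) (A : set T) : 0 < r -> measurable A ->
  lebesgue_measure ((fun x : T => a + r * (x : R) : T) @^-1` A) =
  ((r^-1)%:E * lebesgue_measure A)%E.
Proof.
move=> r0 mA; pose m' := mscale (NngNum (ltW r0))
  (image_measure lebesgue_measure (measurable_affine1 a r)).
have -> : lebesgue_measure A = m' A.
  apply: lebesgue_measure_unique => // _ [[x y] xy <-].
  rewrite /m' /mscale /= /pushforward.
  have e : (fun z : T => a + r * (z : R)) @^-1` `]x, y] =
      `](x - a) / r, (y - a) / r]%classic.
    apply/seteqP; split=> z /=; rewrite !in_itv/= ltr_pdivrMr// ler_pdivlMr//;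
      by rewrite ltrBlDl lerBrDl (mulrC z).
  transitivity (r%:E * lebesgue_measure
      (`]((x - a) / r)%R, ((y - a) / r)%R]%classic : set R))%E; last first.
    by congr (_ * lebesgue_measure _)%E; exact/esym.
  rewrite !lebesgue_measure_itv/= !lte_fin ltr_pM2r ?invr_gt0//.
  rewrite ltrD2r; case: ifPn => _; last by rewrite mule0.
  rewrite -!EFinD -EFinM; congr (_%:E); field; exact: lt0r_neq0.
rewrite /m' /mscale /= /pushforward muleA -EFinM mulVf ?mul1e//.
exact: lt0r_neq0.
Qed.

(** Coordinate by coordinate: the scaled pushforward of the product measure has
    the right value on rectangles. *)
Lemma leb_affine n (a : 'rV[R]_n) r A : 0 < r -> measurable A ->
  leb R n (affine a r @^-1` A) = ((r ^- n)%:E * leb R n A)%E.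
Proof.
move=> r0 mA; elim: n a A mA => [|n ih] a A mA.
  rewrite expr0 invr1 mul1e; congr (leb R 0 _).
  rewrite (_ : affine a r = id)//.
  by apply/funext => y; apply/eq_from_tnth => -[].
pose aff2 (p : T * n.-tuple T) : T * n.-tuple T :=
  (a 0 ord0 + r * (p.1 : R), affine (\row_i a 0 (lift ord0 i)) r p.2).
have maff2 : measurable_fun setT aff2.
  apply: measurable_fun_pair.
    exact: (measurableT_comp (measurable_affine1 _ _) measurable_fst).
  exact: (measurableT_comp (measurable_affine _ _) measurable_snd).
have rn : 0 <= r ^+ n.+1 by exact/exprn_ge0/ltW.
pose m' := mscale (NngNum rn)
  (image_measure (lebesgue_measure \x leb R n)%E maff2).
rewrite /= /leb_step /pushforward.
rewrite [in RHS](@product_measure_unique _ _ _ _ _ _ _ m').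
- rewrite /m' /mscale /= /pushforward muleA -EFinM mulVf; last first.
    exact/expf_neq0/lt0r_neq0.
  rewrite mul1e; congr (product_measure1 _ _ _).
  apply/seteqP; split=> -[x y]; rewrite /= /pcons /=;
    (rewrite (_ : affine a r _ = [tuple of a 0 ord0 + r * (x : R) ::
       affine (\row_i a 0 (lift ord0 i)) r y]) //; apply/eq_from_tnth => i;
     rewrite tnth_mktuple; case: (unliftP ord0 i) => [j|] ->;
     rewrite ?tnthS ?tnth_mktuple ?mxE//).
- move=> A1 A2 mA1 mA2; rewrite /m' /mscale /= /pushforward.
  transitivity ((r ^+ n.+1)%:E * (lebesgue_measure \x leb R n)
     (((fun x : T => a ord0 ord0 + r * (x : R) : T)%R @^-1` A1) `*`
     (affine (\row_i a ord0 (lift ord0 i)) r @^-1` A2)))%E; first by [].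
  rewrite product_measure1E; last 2 first.
  + by rewrite -[X in measurable X]setTI; exact: measurable_affine1.
  + by rewrite -[X in measurable X]setTI; exact: measurable_affine.
  transitivity ((r ^+ n.+1)%:E * ((r^-1)%:E * lebesgue_measure A1 *
     ((r ^- n)%:E * leb R n A2)))%E.
    congr (_ * (_ * _))%E; [exact: lebesgue_affine|exact: ih].
  rewrite muleACA -EFinM !muleA -EFinM.
  rewrite (_ : r ^+ n.+1 * (r^-1 * r ^- n) = 1) ?mul1e//.
  by rewrite -invfM -exprS mulfV// expf_neq0// lt0r_neq0.
- by rewrite -[X in measurable X]setTI; exact: measurable_pcons.
Qed.

Lemma small_cell (e : R) : 0 < e -> exists2 k, (0 < k)%N & (k%:R^-1 < e :> R).
Proof.
move=> e0; have [N _ /(_ N (leqnn _)) Ne] := near_infty_natSinv_lt (PosNum e0).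
by exists N.+1.
Qed.

Lemma cell_subset n (U : set 'rV[R]_n) (y : n.-tuple T) : open U -> U (vec y) ->
  exists2 k, (0 < k)%N & cell k @^-1` [set cell k y] `<=` @vec R n @^-1` U.
Proof.
move=> oU Uy; have /rV_nbhsP[e e0 eU] : nbhs (vec y) U by exact: open_nbhs_nbhs.
have [k k0 ke] := small_cell e0; exists k => // y' /= yy'; apply: eU => i.
exact: lt_trans (cell_close i k0 yy') ke.
Qed.

Lemma open_vec_measurable n (U : set 'rV[R]_n) : open U ->
  measurable (@vec R n @^-1` U).
Proof.
move=> oU; apply: (@open_cells_measurable _ _ _ (fun k y => @cell n k y)).
  by move=> k i; exact: cell_measurable.
by move=> y /(cell_subset oU)[k _ kU]; exists k.
Qed.

Lemma closed_vec_measurable n (F : set 'rV[R]_n) : closed F ->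
  measurable (@vec R n @^-1` F).
Proof.
move=> cF; rewrite -[F]setCK preimage_setC; apply: measurableC.
by have := @open_vec_measurable n (~` F) (closed_openC cF).
Qed.

Lemma open_vol_gt0 n (U : set 'rV[R]_n) x : open U -> U x -> (0 < vol U)%E.
Proof.
move=> oU; have <- : vec [tuple x 0 i | i < n] = x.
  by apply/rowP => i; rewrite mxE tnth_mktuple.
move=> /(cell_subset oU)[k k0 kU]; apply: (@lt_le_trans _ _ (k%:R ^- n)%:E).
  by rewrite lte_fin invr_gt0 exprn_gt0// ltr0n.
rewrite -(cell_leb (cell k [tuple x 0 i | i < n]) k0); apply: le_measure => //.
  by rewrite inE; exact: cell_measurable.
by rewrite inE; exact: open_vec_measurable.
Qed.

Lemma vec2_measurable_fun n (f : 'rV[R]_n * 'rV[R]_n -> R) : continuous f ->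
  measurable_fun setT (fun p : n.-tuple T * n.-tuple T => f (vec p.1, vec p.2)).
Proof.
move=> cf.
pose g k (p : n.-tuple T * n.-tuple T) := (cell k p.1, cell k p.2).
apply: (@open_cells_measurable_fun _ _ _ _ g) => [k [i j]|[x y] e e0].
  rewrite (_ : _ @^-1` _ = cell k @^-1` [set i] `*` cell k @^-1` [set j]).
    by apply: measurableX; exact: cell_measurable.
  by apply/seteqP; split=> [[x y] [<- <-]|[x y] [<- <-]].
have := cf (vec x, vec y); move/cvgrPdist_lt => /(_ _ e0).
move=> [[A B] [/= /rV_nbhsP[a a0 aA] /rV_nbhsP[b b0 bB]] AB].
have ab0 : 0 < Num.min a b by rewrite lt_min a0.
have [k k0] := small_cell ab0; rewrite lt_min => /andP[ka kb].
exists k => -[x' y'] [/= xx' yy']; apply: AB; split => /=.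
  by apply: aA => i; exact: lt_trans (cell_close i k0 xx') ka.
by apply: bB => i; exact: lt_trans (cell_close i k0 yy') kb.
Qed.

Lemma vec_measurable_fun n (f : 'rV[R]_n -> R) : continuous f ->
  measurable_fun setT (fun y : n.-tuple T => f (vec y)).
Proof.
move=> cf; apply: (@open_cells_measurable_fun _ _ _ _ (@cell n)) => [k i|x e e0].
  exact: cell_measurable.
have := cf (vec x); move/cvgrPdist_lt => /(_ _ e0) /rV_nbhsP[a a0 aA].
have [k k0 ka] := small_cell a0; exists k => x' xx'.
by apply: aA => i; exact: lt_trans (cell_close i k0 xx') ka.
Qed.

Lemma vol_homothety n (p : 'rV[R]_n) (r : R) (A : set 'rV[R]_n) : 0 < r ->
  measurable (@vec R n @^-1` A) ->
  vol [set p + r *: (y - p) | y in A] = ((r ^+ n)%:E * vol A)%E.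
Proof.
move=> r0 mA; rewrite /vol.
have -> : @vec R n @^-1` [set p + r *: (y - p) | y in A] =
    affine (p - r^-1 *: p) r^-1 @^-1` (@vec R n @^-1` A).
  apply/seteqP; split=> y /=; rewrite vec_affine.
    move=> [z Az <-]; rewrite scalerDr scalerA mulVf ?lt0r_neq0// scale1r.
    by rewrite addrA subrK addrC subrK.
  move=> Az; exists (p - r^-1 *: p + r^-1 *: vec y) => //.
  rewrite addrAC [p - _]addrC addrK scalerDr scalerN !scalerA.
  by rewrite mulfV ?lt0r_neq0// !scale1r addrA subrr add0r.
by rewrite leb_affine// ?invr_gt0// exprVn invrK.
Qed.

End cells.

(** * Two integrals on R^n *)

Section integrals.
Variable R : realType.
Local Notation T := (measurableTypeR R).

Lemma is_derive_sin_affine (b c x : R) : c != 0 ->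
  is_derive x 1 (fun x => c^-1 * sin (b + c * x)) (cos (b + c * x)).
Proof.
move=> c0; have d1 : is_derive x 1 (cst b + c *: (id : R -> R)) c.
  have := is_deriveD (is_derive_cst b x (1 : R)) (is_deriveZ c (is_derive_id x (1 : R))).
  by rewrite add0r [_ *: _]mulr1.
have d2 := is_derive1_comp (is_derive_sin ((cst b + c *: (id : R -> R)) x)) d1.
have d3 : is_derive x 1 (c^-1 *: (sin \o (cst b + c *: (id : R -> R))))
    (cos (b + c * x)).
  apply: is_derive_eq.
  by rewrite /GRing.scale /=; field.
exact: d3.
Qed.

Local Open Scope ereal_scope.

Lemma EFin_lty (x : \bar R) (r : R) : x = r%:E -> x < +oo.
Proof. by move=> ->; rewrite ltry. Qed.

(** On either half line [d] times the integrand is the density of the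
    exponential distribution. *)
Lemma integral_expN_abs_lty (d : R) : (0 < d)%R ->
  \int[@lebesgue_measure R]_x (expR (- (d * `|x|)))%:E < +oo.
Proof.
move=> d0.
pose f (r : R) : \bar R := (d * expR (- (d * r)))%:E.
have mlin : measurable_fun [set: R] (fun r : R => - (d * r))%R.
  by apply: measurable_funN; exact: measurable_funM.
have mexp : measurable_fun [set: R] (fun x : R => (expR (- (d * `|x|)))%:E).
  apply/measurable_EFinP; apply: (@measurableT_comp _ _ _ _ _ _ expR) => //.
  by apply: measurable_funN; apply: measurable_funM => //; exact: measurableT_comp.
have mf : measurable_fun [set: R] f.
  apply/measurable_EFinP; apply: measurable_funM => //.
  exact: (@measurableT_comp _ _ _ _ _ _ expR).
have f0 r : 0 <= f r by rewrite lee_fin mulr_ge0 ?expR_ge0// ltW.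
have I1 : \int[@lebesgue_measure R]_(r in `[0%R, +oo[) f r = 1.
  rewrite integral_mkcond -[RHS](@integral_exponential_pdf R d)//.
  apply: eq_integral => x _; rewrite /exponential_pdf !patchE.
  by case: ifP => // _; rewrite mulNr.
have I2 : \int[@lebesgue_measure R]_(r in `]-oo, 0%R]) f (- r)%R = 1.
  by rewrite -ge0_integration_by_substitution0.
suff : d%:E * \int[@lebesgue_measure R]_x (expR (- (d * `|x|)))%:E < +oo.
  case: (\int[lebesgue_measure]_x _) => [r||]//; first by move=> _; rewrite ltry.
  by rewrite gt0_muley ?lte_fin.
rewrite -ge0_integralZl//; last by rewrite lee_fin ltW.
apply: (@le_lt_trans _ _ (1 + 1)); last by rewrite -EFinD ltry.
rewrite -{1}I1 -I2 [X in X + _]integral_mkcond [X in _ + X]integral_mkcond.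
rewrite -ge0_integralD//; last 4 first.
- by move=> x _; apply: erestrict_ge0.
- by apply/(measurable_restrictT _ _).1 => //; exact: measurable_funS mf.
- by move=> x _; apply: erestrict_ge0 => y _; exact: f0.
- apply/(measurable_restrictT _ _).1 => //; apply: measurableT_comp mf _ => //.
apply: ge0_le_integral => //.
- by move=> x _; rewrite -EFinM lee_fin mulr_ge0 ?expR_ge0// ltW.
- exact: measurable_funeM.
- apply: emeasurable_funD; apply/(measurable_restrictT _ _).1 => //.
  + exact: measurable_funS mf.
  + by apply: measurableT_comp mf _ => //.
- move=> x _; rewrite !patchE !mem_setE !in_itv/= andbT.
  have [x0|x0] := leP 0%R x.
    by rewrite ger0_norm//; case: ifP => _; rewrite ?adde0 ?leeDl.
  by rewrite ltr0_norm// (ltW x0) add0e.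
Qed.

Definition l1norm n (y : 'rV[R]_n) : R := (\sum_i `|y 0%R i|)%R.

Lemma ge0_integral_leb_succ n (f : n.+1.-tuple T -> \bar R) :
  measurable_fun setT f -> (forall y, 0 <= f y) ->
  \int[leb R n.+1]_y f y =
  \int[@lebesgue_measure R]_x \int[leb R n]_y f (pcons (x, y)).
Proof.
move=> mf f0; transitivity (\int[lebesgue_measure \x leb R n]_p f (pcons p)).
  exact: (ge0_integral_pushforward (@measurable_pcons R n)).
rewrite fubini_tonelli1//; first exact: measurableT_comp mf (@measurable_pcons R n).
Qed.

Lemma integral_leb_succ n (f : n.+1.-tuple T -> \bar R) :
  measurable_fun setT f -> (leb R n.+1).-integrable setT f ->
  \int[leb R n.+1]_y f y =
  \int[@lebesgue_measure R]_x \int[leb R n]_y f (pcons (x, y)).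
Proof.
move=> mf fi.
have fi' : (lebesgue_measure \x leb R n).-integrable setT (f \o @pcons R n).
  apply/integrableP; split; first exact: measurableT_comp mf (@measurable_pcons R n).
  have /integrableP[_] := fi.
  rewrite ge0_integral_leb_succ//; last exact: measurableT_comp.
  rewrite fubini_tonelli1//.
  apply: measurableT_comp => //.
  exact: measurableT_comp mf (@measurable_pcons R n).
transitivity (\int[lebesgue_measure \x leb R n]_p f (pcons p)).
  exact: (integral_pushforward (@measurable_pcons R n)).
by rewrite -integral12_prod_meas1.
Qed.

Lemma l1norm_pcons n (x : T) (y : n.-tuple T) :
  l1norm (vec (pcons (x, y))) = (`|x : R| + l1norm (vec y))%R.
Proof.
rewrite /l1norm big_ord_recl mxE; congr (_ + _)%R.
by apply: eq_bigr => i _; rewrite !mxE tnthS.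
Qed.

Lemma l1norm_continuous n : continuous (@l1norm n).
Proof.
apply: continuous_big => [x|i _ y]; first exact: add_continuous.
by apply: continuous_comp; [exact: coord_continuous|exact: norm_continuous].
Qed.

Lemma measurable_expN_l1norm n (d : R) :
  measurable_fun setT (fun y : n.-tuple T => (expR (- (d * l1norm (vec y))))%:E).
Proof.
apply/measurable_EFinP.
apply: (@vec_measurable_fun R n (fun y => expR (- (d * l1norm y)))) => y.
apply: continuous_comp; last exact: continuous_expR.
apply: continuousN; apply: (@continuousM _ _ (cst d) (@l1norm n)).
  exact: cst_continuous.
exact: l1norm_continuous.
Qed.

Lemma integral_expN_l1norm_lty n (d : R) : (0 < d)%R ->
  \int[leb R n]_y (expR (- (d * l1norm (vec y))))%:E < +oo.
Proof.
move=> d0; elim: n => [|n ih].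
  rewrite integral_dirac//; last exact: measurable_expN_l1norm.
  by rewrite diracE mem_set// mul1e ltry.
rewrite (@ge0_integral_leb_succ n (fun y => (expR (- (d * l1norm (vec y))))%:E)); last 2 first.
- exact: measurable_expN_l1norm.
- by move=> y; rewrite lee_fin expR_ge0.
set I := \int[leb R n]_y _ in ih.
have I0 : 0 <= I by apply: integral_ge0 => y _; rewrite lee_fin expR_ge0.
rewrite (eq_integral (fun x : T => I * (expR (- (d * `|x : R|)))%:E)); last first.
  move=> x _; rewrite muleC -ge0_integralZl ?lee_fin ?expR_ge0//; last first.
    exact: measurable_expN_l1norm.
  by apply: eq_integral => y _; rewrite l1norm_pcons mulrDr opprD expRD EFinM.
rewrite ge0_integralZl//.
- by rewrite lte_mul_pinfty// ?ge0_fin_numE// integral_expN_abs_lty.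
- apply/measurable_EFinP; apply: (@measurableT_comp _ _ _ _ _ _ expR) => //.
  by apply: measurable_funN; apply: measurable_funM => //; exact: measurableT_comp.
Qed.

Lemma pcons_angles n :
  @pcons R n @^-1` @angles R n.+1 = `[0%R, (2 * pi)%R]%classic `*` @angles R n.
Proof.
apply/seteqP; split=> [[x y] /= h|[x y] [/= h1 h2] i].
  split=> [|i]; first by have := h ord0; rewrite in_itv.
  by have := h (lift ord0 i); rewrite tnthS.
case: (unliftP ord0 i) => [j ->|->]; first by rewrite tnthS; exact: h2.
by move: h1; rewrite in_itv.
Qed.

Lemma measurable_angles n : measurable (@angles R n).
Proof.
have -> : @angles R n = \bigcap_(i in [set: 'I_n])
    (fun y : n.-tuple T => tnth y i) @^-1` `[0%R, (2 * pi)%R]%classic.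
  apply/seteqP; split=> [y h i _|y h i]; first by rewrite /= in_itv; exact: h.
  by have := h i I; rewrite /= in_itv.
apply: fin_bigcap_measurable => // i _.
by rewrite -[X in measurable X]setTI; apply: measurable_tnth.
Qed.

Lemma lebesgue_period :
  lebesgue_measure `[0%R, (2 * pi)%R]%classic = (2 * pi)%:E :> \bar R.
Proof.
have pi0 : (0 < 2 * pi :> R)%R by rewrite mulr_gt0// pi_gt0.
by rewrite lebesgue_measure_itv/= lte_fin pi0 sube0.
Qed.

Lemma leb_angles n : leb R n (@angles R n) = ((2 * pi) ^+ n)%:E.
Proof.
elim: n => [|n ih].
  by rewrite /leb /= diracE mem_set// => -[].
rewrite /= /leb_step /pushforward pcons_angles product_measure1E//; last first.
  exact: measurable_angles.
rewrite exprS EFinM; congr (_ * _); last exact: ih.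
exact: lebesgue_period.
Qed.

Lemma periodicz_sin (x : R) (a : int) : sin (x + pi *+ 2 *~ a) = sin x.
Proof.
have sn (m : nat) y : sin (y + pi *+ 2 *+ m) = sin y :> R.
  exact: (periodicn (@sinD2pi R)).
case: a => m; first exact: sn.
by rewrite NegzE mulrNz -(sn m.+1) subrK.
Qed.

Lemma integral_cos_period (a : int) (b : R) : a != 0%R ->
  \int[@lebesgue_measure R]_(x in `[0%R, (2 * pi)%R])
    (cos (b + a%:~R * x))%:E = 0.
Proof.
move=> a0; have a0' : (a%:~R != 0 :> R)%R by rewrite intr_eq0.
have pi0 : (0 < 2 * pi :> R)%R by rewrite mulr_gt0// pi_gt0.
pose F x : R := (a%:~R^-1 * sin (b + a%:~R * x))%R.
have dF x := is_derive_sin_affine b x a0'.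
have cF x : {for x, continuous F}.
  by apply/differentiable_continuous/derivable1_diffP; case: (dF x).
rewrite (@continuous_FTC2 _ _ F)//.
- rewrite /F mulr0 addr0 (_ : (a%:~R * (2 * pi) = pi *+ 2 *~ a)%R).
    by rewrite periodicz_sin subee.
  by rewrite mulrzl mulr_natl.
- apply: continuous_subspaceT => x; apply: continuous_comp; last exact: continuous_cos.
  apply: cvgD; first exact: cvg_cst.
  by apply: cvgM; [exact: cvg_cst|exact: cvg_id].
- split; first by move=> x _; case: (dF x).
  + by apply: cvg_at_right_filter; exact: cF.
  + by apply: cvg_at_left_filter; exact: cF.
- by move=> x _; rewrite derive1E; have := dF x => -[].
Qed.

Definition phase n (b : R) (a : 'rV[int]_n) (y : n.-tuple T) : R :=
  (b + dot (real_pt R a) (vec y))%R.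

Lemma phase_pcons n (b : R) (a : 'rV[int]_n.+1) (x : T) (y : n.-tuple T) :
  phase b a (pcons (x, y)) =
  phase (b + (a 0%R ord0)%:~R * (x : R))%R (\row_j a 0%R (lift ord0 j)) y.
Proof.
rewrite /phase /dot big_ord_recl !mxE addrA; congr (_ + _)%R.
by apply: eq_bigr => i _; rewrite !mxE tnthS.
Qed.

Lemma dot_continuous n (a : 'rV[R]_n) : continuous (dot a).
Proof.
apply: continuous_big => [x|i _ z]; first exact: add_continuous.
apply: (@continuousM _ _ (cst (a 0%R i)) (fun z : 'rV[R]_n => z 0%R i)).
  exact: cst_continuous.
exact: coord_continuous.
Qed.

Lemma measurable_cos_phase n b (a : 'rV[int]_n) :
  measurable_fun setT (fun y => cos (phase b a y)).
Proof.
apply: (@vec_measurable_fun R n (fun y => cos (b + dot (real_pt R a) y))) => y.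
apply: continuous_comp; last exact: continuous_cos.
apply: (@continuousD _ _ _ (cst b) (dot (real_pt R a))).
  exact: cst_continuous.
exact: dot_continuous.
Qed.

(** Orthogonality of characters on the torus. The phase shift [b] is carried
    along because in the induction it absorbs the angle that is integrated
    last. *)
Lemma integral_cos_phase n (b : R) (a : 'rV[int]_n) :
  \int[leb R n]_(y in @angles R n) (cos (phase b a y))%:E =
  if a == 0%R then ((2 * pi) ^+ n * cos b)%:E else 0.
Proof.
elim: n b a => [|n ih] b a.
  rewrite integral_dirac//.
  - rewrite diracE mem_set ?mul1e; last by move=> [].
    rewrite (_ : a = 0%R) ?eqxx; last by apply/rowP => -[].
    by rewrite expr0 mul1r /phase /dot big_ord0 addr0.
  - exact: measurable_angles.
  - apply/measurable_EFinP; apply: measurable_funS (measurable_cos_phase b a) => //.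
rewrite integral_mkcond integral_leb_succ.
- pose D : set T := `[0%R, (2 * pi)%R]%classic : set R.
  have mD : measurable D by exact: measurable_itv.
  rewrite (eq_integral ((fun x : T => if (\row_j a 0%R (lift ord0 j) : 'rV_n) == 0%R
     then ((2 * pi) ^+ n * cos (b + (a 0%R ord0)%:~R * (x : R)))%:E else 0) \_ D)); last first.
    move=> x _; have E y : ((fun y => (cos (phase b a y))%:E) \_ (@angles R n.+1))
        (pcons (x, y)) = if x \in D then ((fun y => (cos (phase (b +
        (a 0%R ord0)%:~R * (x : R))%R (\row_j a 0%R (lift ord0 j)) y))%:E) \_ (@angles R n)) y else 0.
      rewrite !patchE -phase_pcons.
      have -> : (pcons (x, y) \in @angles R n.+1) = (x \in D) && (y \in @angles R n).
        apply/idP/andP; rewrite !inE.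
          by have /seteqP[h _] := pcons_angles n => /(h (x, y)).
        by have /seteqP[_ h] := pcons_angles n => /(h (x, y)).
      by case: (x \in D).
    rewrite (eq_integral _ _ (fun y _ => E y)) patchE; case: (x \in D); last first.
      exact: integral0_eq.
    by rewrite -integral_mkcond ih.
  rewrite -integral_mkcond.
  case: (boolP ((\row_j a 0%R (lift ord0 j) : 'rV_n) == 0%R)) => a'0; last first.
    rewrite integral0_eq// ifF//; apply/negbTE; apply: contra a'0 => /eqP ->.
    by apply/eqP/rowP => j; rewrite !mxE.
  rewrite /= (eq_integral (fun x : T => ((2 * pi) ^+ n)%:E * (cos (b +
     (a 0%R ord0)%:~R * (x : R)))%:E)); last by move=> x _; rewrite EFinM.
  rewrite integralZl//; last first.
    apply: measurable_bounded_integrable => //.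
    - exact: EFin_lty lebesgue_period.
    - apply: measurable_funTS; apply: (measurableT_comp (f := cos)); last first.
        exact: measurable_affine1.
      apply: continuous_measurable_fun; exact: continuous_cos.
    - exists 1%R; split => // M M1 y _ /=.
      by rewrite (le_trans _ (ltW M1))// ler_norml cos_le1 cos_geN1.
  have [a00|a00] := eqVneq (a 0%R ord0) 0%R; last first.
    rewrite integral_cos_period// mule0 ifF//; apply/negbTE.
    by apply: contra a00 => /eqP ->; rewrite mxE.
  rewrite ifT; last first.
    apply/eqP/rowP => i; rewrite !mxE.
    case: (unliftP ord0 i) => [j ->|->//].
    by have /eqP/rowP/(_ j) := a'0; rewrite !mxE.
  rewrite (eq_integral (cst (cos b)%:E)); last first.
    by move=> x _; rewrite a00 mul0r addr0.
  rewrite integral_cst//; transitivity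
    (((2 * pi) ^+ n)%:E * ((cos b)%:E * (2 * pi)%:E)).
    by congr (_ * (_ * _)); exact: lebesgue_period.
  by rewrite -!EFinM exprS; congr (_%:E); ring.
- apply/(measurable_restrictT _ _).1; first exact: measurable_angles.
  by apply/measurable_EFinP; apply: measurable_funS (measurable_cos_phase b a).
- apply/(integrable_restrict _ _ _ _).1 => //; first exact: measurable_angles.
  rewrite setTI; apply: measurable_bounded_integrable.
  + exact: measurable_angles.
  + exact: EFin_lty (leb_angles n.+1).
  + exact: measurable_funS (measurable_cos_phase b a).
  + exists 1%R; split => // M M1 y _ /=.
    by rewrite (le_trans _ (ltW M1))// ler_norml cos_le1 cos_geN1.
Qed.

End integrals.

(** * Laurent polynomials and their jets *)

(** Laurent monomials are patched by [0] off the torus; differentiability is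
    local and passes to the patched function at points of the torus. *)
Lemma near_eq_differentiable (K : numFieldType) (V W : normedModType K)
    (f g : V -> W) x :
  (\near x, f x = g x) -> differentiable f x -> differentiable g x.
Proof.
move=> fg df; have [cdf fE] := (diff_locallyP _ _).1 df.
have gE : g \o shift x = cst (g x) + 'd f x +o_ 0 id.
  apply/eqaddoP => _/posnumP[e].
  have /eqaddoP/(_ e%:num)/(_ [gt0 of e%:num]) := fE.
  apply: filter_app.
  have := fg; rewrite (near_shift 0) /= => fg0.
  near=> h.
  have -> : (g \o shift x - (cst (g x) + 'd f x)) h =
            (f \o shift x - (cst (f x) + 'd f x)) h => //.
  rewrite -![(_ - _ : _ -> _) _]/(_ - _) /= /cst/=.
  rewrite !fctE /= (nbhs_singleton fg); congr (_ - _).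
  by near: h; apply: filterS fg0 => h /=; rewrite subr0 addrC => ->.
have ge := diff_unique cdf gE.
by apply/diff_locallyP; rewrite ge.
Unshelve. all: by end_near. Qed.

Section along.
Variables (K : numFieldType) (n : nat).
Local Notation V := 'rV[K]_n.

Lemma is_derive_along_cst (g : V -> K) z v :
  (forall h : K, g (h *: v + z) = g z) -> is_derive z v g 0.
Proof.
move=> gz; have E : (fun h : K => h^-1 *: ((g \o shift z) (h *: v) - g z)) = cst 0.
  by apply/funext => h /=; rewrite gz subrr scaler0.
split; first by rewrite /derivable E; exact: is_cvg_cst.
by rewrite /derive E; exact: lim_cst.
Qed.

Lemma is_derive_coord (z v : V) j : is_derive z v (fun x : V => x 0 j) (v 0 j).
Proof.
have E : {near 0^', cst (v 0 j) =1
    (fun h : K => h^-1 *: (((fun x : V => x 0 j) \o shift z) (h *: v) - z 0 j))}.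
  near=> h; rewrite /= !mxE addrK /= [_ *: _]mulrA mulVf ?mul1r//.
  by near: h; exact: nbhs_dnbhs_neq.
have C : (fun h : K => h^-1 *: (((fun x : V => x 0 j) \o shift z) (h *: v) - z 0 j))
  @ 0^' --> v 0 j.
  exact: cvg_trans (near_eq_cvg E) (cvg_cst _).
split; first by apply/cvg_ex; exists (v 0 j).
exact: cvg_lim C.
Unshelve. all: by end_near. Qed.

Lemma is_derive_coordXz (z : V) (i : 'I_n) (a : int) : z 0 i != 0 ->
  is_derive z (delta_mx 0 i) (fun x : V => x 0 i ^ a) (a%:~R * z 0 i ^ (a - 1)).
Proof.
move=> zi; have D := is_derive_coord z (delta_mx 0 i) i.
rewrite mxE !eqxx /= in D.
case: a => a.
  have -> : (fun x : V => x 0 i ^ Posz a) = (fun x : V => x 0 i) ^+ a.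
    by apply/funext => x; rewrite exprfctE.
  apply: is_derive_eq; rewrite [_ *: _]mulr1.
  case: a => [|a]; first by rewrite mulr0z mulr0n !mul0r.
  by have -> : Posz a.+1 - 1 = Posz a by rewrite -addn1 PoszD addrK.
have E : (fun x : V => x 0 i ^ Negz a) = (fun x => (((fun x : V => x 0 i) ^+ a.+1) x)^-1).
  by apply/funext => x; rewrite exprfctE NegzE exprnN.
have zn0 : ((fun x : V => x 0 i) ^+ a.+1) z != 0 by rewrite exprfctE expf_neq0.
have df : derivable ((fun x : V => x 0 i) ^+ a.+1) z (delta_mx 0 i).
  exact: derivableX.
rewrite E; split; first exact: derivableV.
rewrite deriveV// derive_val /= [_ *: 1]mulr1 [_ *: _]mulrC exprfctE.
rewrite NegzE mulrNz mulNr mulrN -mulrA; congr (- (_ * _)).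
have -> : - (a.+1 : int) - 1 = - (a.+2 : int) by rewrite -opprD -PoszD addn1.
by rewrite -exprnN !exprS; field; rewrite zi expf_neq0.
Qed.

Lemma coordXz_differentiable (z : V) (i : 'I_n) (a : int) : z 0 i != 0 ->
  differentiable (fun x : V => x 0 i ^ a) z.
Proof.
move=> zi; have D := @differentiable_coord K 1 n z 0 i.
case: a => a.
  case: a => [|a].
    by rewrite (_ : (fun _ => _) = cst 1).
  have -> : (fun x : V => x 0 i ^ Posz a.+1) = (fun x : V => x 0 i) ^+ a.+1.
    by apply/funext => x; rewrite exprfctE.
  exact: differentiableX.
have -> : (fun x : V => x 0 i ^ Negz a) = (fun x => (((fun x : V => x 0 i) ^+ a.+1) x)^-1).
  by apply/funext => x; rewrite exprfctE NegzE exprnN.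
apply: differentiableV; first exact: differentiableX.
by rewrite exprfctE expf_neq0.
Qed.

Definition monomial (m : 'rV[int]_n) (z : V) : K := \prod_i z 0 i ^ m 0 i.

Lemma monomial_differentiable (m : 'rV[int]_n) (z : V) :
  (forall i, z 0 i != 0) -> differentiable (monomial m) z.
Proof.
move=> z0.
have -> : monomial m = \prod_i (fun x : V => x 0 i ^ m 0 i).
  by apply/funext => x; rewrite /monomial fct_prodE.
elim/big_ind : _ => // [f g|i _]; first exact: differentiableM.
exact: coordXz_differentiable.
Qed.

Lemma monomialB (m a : 'rV[int]_n) (z : V) : (forall i, z 0 i != 0) ->
  monomial (m - a) z = monomial m z / monomial a z.
Proof.
move=> z0; rewrite /monomial -prodf_div; apply: eq_bigr => i _.
by rewrite !mxE expfzDr// invr_expz.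
Qed.

Lemma is_derive_monomial (m : 'rV[int]_n) (z : V) i :
  (forall i, z 0 i != 0) ->
  is_derive z (delta_mx 0 i) (monomial m)
    ((m 0 i)%:~R * monomial (m - delta_mx 0 i) z).
Proof.
move=> z0; pose rest (x : V) := \prod_(j | j != i) x 0 j ^ m 0 j.
have -> : monomial m = (fun x : V => x 0 i ^ m 0 i) * rest.
  by apply/funext => x; rewrite /monomial (bigD1 i).
have D1 := is_derive_coordXz (m 0 i) (z0 i).
have D2 : is_derive z (delta_mx 0 i) rest 0.
  apply: is_derive_along_cst => h; apply: eq_bigr => j ji.
  by rewrite !mxE (negPf ji) andbF mulr0 add0r.
apply: is_derive_eq; rewrite scaler0 add0r [_ *: _]mulrCA; congr (_ * _).
rewrite /monomial (bigD1 i)//= !mxE !eqxx mulrC; congr (_ * _).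
by apply: eq_bigr => j ji; rewrite !mxE (negPf ji) andbF subr0.
Qed.

Lemma near_torus (z : V) : (forall i, z 0 i != 0) ->
  \forall x \near z, forall i : 'I_n, (x : V) 0 i != 0.
Proof.
move=> z0; apply: (@filter_forall _ _ (fun i (x : V) => x 0 i != 0) (nbhs z) _) => i.
apply: (cvgr_neq0 (f := fun x : V => x 0 i) (z 0 i)) => //.
exact: coord_continuous.
Qed.

(** The coefficient in the partial derivative of [z^m] along [s]. It depends
    only on the numbers of occurrences of the indices in [s], see [jet_coefE]. *)
Fixpoint jet_coef (m : 'rV[int]_n) (s : seq 'I_n) : K :=
  if s is i :: s' then jet_coef m s' * (m 0 i - (count_mem i s')%:Z)%:~R else 1.

Definition occ (s : seq 'I_n) : 'rV[int]_n := \row_i (count_mem i s)%:Z.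

Lemma partials_monomials w (e : 'I_w -> 'rV[int]_n) (b : 'I_w -> K)
    (f : V -> K) :
  (forall z : V, (forall i, z 0 i != 0) -> f z = \sum_j b j * monomial (e j) z) ->
  forall s (z : V), (forall i, z 0 i != 0) ->
  partials s f z = \sum_j b j * jet_coef (e j) s * monomial (e j - occ s) z.
Proof.
move=> fE; elim=> [|i s ih] z z0.
  rewrite /= fE//; apply: eq_bigr => j _; rewrite mulr1.
  by congr (_ * monomial _ _); apply/rowP => l; rewrite !mxE subr0.
rewrite /= (near_eq_derive (g := \sum_j
    (fun x => b j * jet_coef (e j) s *: monomial (e j - occ s) x))).
- rewrite derive_sum; last first.
    by move=> j; apply: derivableZ; have [] := is_derive_monomial (e j - occ s) i z0.
  apply: eq_bigr => j _; rewrite deriveZ; last first.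
    by have [] := is_derive_monomial (e j - occ s) i z0.
  have D := is_derive_monomial (e j - occ s) i z0; rewrite derive_val.
  rewrite [_ *: _]mulrA -!mulrA !mxE; congr (_ * (_ * (_ * monomial _ _))).
  apply/rowP => l; rewrite !mxE -addrA -opprD; congr (_ - _).
  by rewrite eqxx /= PoszD addrC eq_sym; case: (i == l).
- near=> x; rewrite fct_sumE ih//.
  by near: x; apply: near_torus.
Unshelve. all: by end_near. Qed.

End along.

(** * The weighted L^2 space on the torus *)

Section L2.
Variables (R : realType) (n : nat).
Local Notation V := 'rV[R]_n.
Local Notation C := R[i].
Local Notation Cn := 'rV[C]_n.
Local Notation T := (measurableTypeR R).
Local Notation Om := (n.-tuple T * n.-tuple T)%type.

Definition tpt (p : Om) : Cn := torus_pt (vec p.1) (vec p.2).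

Definition polar : set Om := setT `*` @angles R n.

Local Notation mu := (leb R n \x leb R n)%E.

Lemma measurable_polar : measurable polar.
Proof. by apply: measurableX => //; exact: measurable_angles. Qed.
#[local] Hint Resolve measurable_polar : core.

Lemma cabs2_ge0 (z : C) : 0 <= cabs2 z.
Proof. by rewrite addr_ge0// sqr_ge0. Qed.

Lemma cabs2_polar (r t : R) : cabs2 (Complex (r * cos t) (r * sin t)) = r ^+ 2.
Proof. by rewrite /cabs2 /= !exprMn -mulrDr cos2Dsin2 mulr1. Qed.

Lemma log_coord_torus_pt (x th : V) : log_coord (torus_pt x th) = x.
Proof.
apply/rowP => i; rewrite !mxE cabs2_polar expr2 -expRD -splitr.
by rewrite expRK.
Qed.

Variables (phi : V -> R) (k : nat).
Hypothesis cphi : continuous phi.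

Definition wt (p : Om) : R := expR (- (k%:R * phi (vec p.1))).

Lemma weight_tpt p : weight phi k (tpt p) = wt p.
Proof. by rewrite /weight log_coord_torus_pt. Qed.

Lemma measurable_wt : measurable_fun setT wt.
Proof.
apply: (@vec2_measurable_fun R n (fun p => expR (- (k%:R * phi p.1)))) => -[x y].
apply: continuous_comp; last exact: continuous_expR.
apply: continuousN; apply: (@continuousM _ _ (cst k%:R) (fun p : V * V => phi p.1)).
  exact: cst_continuous.
by apply: continuous_comp; [exact: cvg_fst|exact: cphi].
Qed.

(** Square integrability in polar coordinates, with measurability of the real
    and imaginary parts built in, so that these functions form a vector space on
    which [inner] is sesquilinear. *)
Definition sqint (f : Cn -> C) :=
  [/\ measurable_fun setT (fun p => complex.Re (f (tpt p))),
      measurable_fun setT (fun p => complex.Im (f (tpt p))) &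
      (\int[mu]_(p in polar) (cabs2 (f (tpt p)) * wt p)%:E < +oo)%E].

Definition rint (u : Om -> R) : R :=
  fine (((2 * pi) ^- n)%:E * \int[mu]_(p in polar) (u p)%:E)%E.

Local Notation intble u := (mu.-integrable polar (EFin \o u)).

Lemma pi2n_gt0 : 0 < ((2 * pi) ^- n : R).
Proof. by rewrite invr_gt0 exprn_gt0// mulr_gt0// pi_gt0. Qed.

Lemma rint_lin (a : R) (u v : Om -> R) : intble u -> intble v ->
  rint (fun p => a * u p + v p) = a * rint u + rint v.
Proof.
move=> iu iv; rewrite /rint.
have Iu := integrable_fin_num measurable_polar iu.
have Iv := integrable_fin_num measurable_polar iv.
have -> : (\int[mu]_(p in polar) (a * u p + v p)%:E =
    a%:E * \int[mu]_(p in polar) (u p)%:E + \int[mu]_(p in polar) (v p)%:E)%E.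
  under eq_integral do rewrite EFinD EFinM.
  rewrite integralD//; last exact: (integrableZl measurable_polar a iu).
  by rewrite integralZl.
move: Iu Iv; rewrite /comp.
case: (\int[mu]_(p in polar) (u p)%:E)%E => [x||]//.
case: (\int[mu]_(p in polar) (v p)%:E)%E => [y||]// _ _.
by rewrite -!EFinM /= mulrDr mulrCA.
Qed.

Lemma int_torusE (G : Cn -> R) :
  fine (int_torus (fun z => (G z)%:E)) = rint (fun p => G (tpt p)).
Proof. by []. Qed.

Lemma innerE f g : inner phi k f g =
  Complex (rint (fun p => complex.Re (f (tpt p) * (g (tpt p))^*%C) * wt p))
          (rint (fun p => complex.Im (f (tpt p) * (g (tpt p))^*%C) * wt p)).
Proof.
have <- : weight phi k \o (fun p => tpt p) = wt by apply/funext => p; exact: weight_tpt.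
by rewrite /inner !int_torusE.
Qed.

(** The products that occur in [inner] are dominated by a sum of squares. *)
Lemma sqint_dom (u : Om -> R) f g : sqint f -> sqint g ->
  measurable_fun setT u ->
  (forall p, `|u p| <= cabs2 (f (tpt p)) + cabs2 (g (tpt p))) ->
  intble (fun p => u p * wt p).
Proof.
move=> [fr fi f2] [gr gi g2] mU ub.
have m2 h : sqint h -> measurable_fun setT (fun p => (cabs2 (h (tpt p)) * wt p)%:E).
  move=> [hr hi _]; apply/measurable_EFinP; apply: measurable_funM; last exact: measurable_wt.
  by apply: measurable_funD; apply: measurable_funX.
have mf : measurable_fun setT (fun p => (cabs2 (f (tpt p)) * wt p)%:E) by exact: m2.
have mg : measurable_fun setT (fun p => (cabs2 (g (tpt p)) * wt p)%:E) by exact: m2.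
apply/integrableP; split.
  apply: measurable_funTS; apply/measurable_EFinP.
  by apply: measurable_funM => //; exact: measurable_wt.
apply: (@le_lt_trans _ _ (\int[mu]_(p in polar) ((cabs2 (f (tpt p)) * wt p)%:E +
   (cabs2 (g (tpt p)) * wt p)%:E))%E).
  apply: ge0_le_integral => //.
  - apply: measurable_funTS; apply: measurableT_comp => //; apply/measurable_EFinP.
    by apply: measurable_funM => //; exact: measurable_wt.
  - by apply: measurable_funTS; exact: emeasurable_funD.
  - move=> p _; rewrite -EFinD lee_fin normrM -mulrDl.
    by rewrite (ger0_norm (expR_ge0 _)) ler_wpM2r// expR_ge0.
rewrite ge0_integralD//.
- exact: lte_add_pinfty.
- by move=> p _; rewrite lee_fin mulr_ge0 ?cabs2_ge0 ?expR_ge0.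
- exact: measurable_funTS.
- by move=> p _; rewrite lee_fin mulr_ge0 ?cabs2_ge0 ?expR_ge0.
- exact: measurable_funTS.
Qed.

Lemma intble_lin (a : R) (u v : Om -> R) : intble u -> intble v ->
  intble (fun p => a * u p + v p).
Proof.
move=> iu iv; have -> : EFin \o (fun p => a * u p + v p) =
    (fun p => (a%:E * (u p)%:E))%E \+ (EFin \o v) by [].
by apply: integrableD => //; exact: (integrableZl measurable_polar a iu).
Qed.

Let re2 (z w : C) : complex.Re (z * w^*%C) =
  complex.Re z * complex.Re w + complex.Im z * complex.Im w.
Proof. by case: z w => [a b] [c d] /=; ring. Qed.

Let im2 (z w : C) : complex.Im (z * w^*%C) =
  complex.Im z * complex.Re w - complex.Re z * complex.Im w.
Proof. by case: z w => [a b] [c d] /=; ring. Qed.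

Let dot2_le (a b c d : R) : `|a * c + b * d| <= (a ^+ 2 + b ^+ 2) + (c ^+ 2 + d ^+ 2).
Proof.
have := sqr_ge0 (a - c); have := sqr_ge0 (a + c).
have := sqr_ge0 (b - d); have := sqr_ge0 (b + d).
by have := sqr_ge0 a; have := sqr_ge0 b; have := sqr_ge0 c; have := sqr_ge0 d;
  rewrite ler_norml; move=> *; apply/andP; split; nra.
Qed.

Lemma intble_re f g : sqint f -> sqint g ->
  intble (fun p => complex.Re (f (tpt p) * (g (tpt p))^*%C) * wt p).
Proof.
move=> sf sg; apply: (sqint_dom sf sg).
  have [fr fi _] := sf; have [gr gi _] := sg.
  under eq_fun do rewrite re2.
  by apply: measurable_funD; exact: measurable_funM.
move=> p; rewrite re2; exact: dot2_le.
Qed.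

Lemma intble_im f g : sqint f -> sqint g ->
  intble (fun p => complex.Im (f (tpt p) * (g (tpt p))^*%C) * wt p).
Proof.
move=> sf sg; apply: (sqint_dom sf sg).
  have [fr fi _] := sf; have [gr gi _] := sg.
  under eq_fun do rewrite im2.
  by apply: measurable_funB; exact: measurable_funM.
move=> p; rewrite im2 -mulNr /cabs2 -[complex.Re (f _) ^+ 2]sqrrN.
by rewrite [X in _ <= X + _]addrC; exact: dot2_le.
Qed.

Lemma inner_lin (a : C) f g h : sqint f -> sqint g -> sqint h ->
  inner phi k (fun z => a * f z + g z) h =
  a * inner phi k f h + inner phi k g h.
Proof.
move=> sf sg sh; rewrite !innerE; case: a => a b.
have fr := intble_re sf sh; have fi := intble_im sf sh.
have gr := intble_re sg sh; have gi := intble_im sg sh.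
rewrite [LHS](_ : _ = Complex
  (rint (fun p => a * (complex.Re (f (tpt p) * (h (tpt p))^*%C) * wt p) +
    ((- b) * (complex.Im (f (tpt p) * (h (tpt p))^*%C) * wt p) +
     complex.Re (g (tpt p) * (h (tpt p))^*%C) * wt p)))
  (rint (fun p => a * (complex.Im (f (tpt p) * (h (tpt p))^*%C) * wt p) +
    (b * (complex.Re (f (tpt p) * (h (tpt p))^*%C) * wt p) +
     complex.Im (g (tpt p) * (h (tpt p))^*%C) * wt p)))).
  rewrite !rint_lin//; try exact: intble_lin.
  by apply/eqP; rewrite eq_complex /=; apply/andP; split; apply/eqP; ring.
congr Complex; congr rint; apply/funext => p;
  case: (f _) (g _) (h _) => [f1 f2] [g1 g2] [h1 h2] /=; ring.
Qed.

Lemma inner_conj f g : sqint f -> sqint g ->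
  inner phi k g f = (inner phi k f g)^*%C.
Proof.
move=> sf sg; rewrite !innerE /=; congr Complex.
  by congr rint; apply/funext => p; rewrite !re2; ring.
have i0 : intble (fun=> 0 : R).
  by have -> : EFin \o (fun=> 0 : R) = cst 0%E :> (Om -> \bar R) by []; exact: integrable0.
rewrite -[RHS]addr0 -[X in _ = _ + X](_ : rint (fun=> 0) = 0); last first.
  by rewrite /rint integral0 mule0.
rewrite -mulN1r -rint_lin//; last exact: intble_im.
by congr rint; apply/funext => p; rewrite !im2; ring.
Qed.

Lemma hnorm_sqr f : hnorm phi k f ^+ 2 = complex.Re (inner phi k f f).
Proof.
rewrite /hnorm sqr_sqrtr; last first.
  apply: fine_ge0; apply: mule_ge0; first exact/ltW/pi2n_gt0.
  by apply: integral_ge0 => p _; rewrite lee_fin mulr_ge0 ?cabs2_ge0 ?expR_ge0.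
rewrite innerE /= /L2sq int_torusE; congr rint; apply/funext => p.
by rewrite weight_tpt re2 /cabs2 !expr2.
Qed.

Lemma L2sq_ltyE f : (L2sq phi k f < +oo)%E =
  (\int[mu]_(p in polar) (cabs2 (f (tpt p)) * wt p)%:E < +oo)%E.
Proof.
rewrite /L2sq /int_torus.
under eq_integral do rewrite weight_tpt.
have : (0 <= \int[mu]_(p in polar) (cabs2 (f (tpt p)) * wt p)%:E)%E.
  by apply: integral_ge0 => p _; rewrite lee_fin mulr_ge0 ?cabs2_ge0 ?expR_ge0.
rewrite -/polar.
case: (\int[mu]_(p in polar) _)%E => [x||]//; first by rewrite -EFinM !ltry.
by rewrite gt0_muley// lte_fin pi2n_gt0.
Qed.

Lemma sqint_lin (a : C) f g : sqint f -> sqint g ->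
  sqint (fun z => a * f z + g z).
Proof.
move=> sf sg; have [fr fi f2] := sf; have [gr gi g2] := sg.
case: a => a b.
have mr : measurable_fun setT (fun p =>
    complex.Re (Complex a b * f (tpt p) + g (tpt p))).
  rewrite (_ : (fun p => _) = (fun p => a * complex.Re (f (tpt p)) -
     b * complex.Im (f (tpt p)) + complex.Re (g (tpt p)))); last first.
    by apply/funext => p; case: (f _) (g _) => [f1 f2'] [g1 g2'].
  by apply: measurable_funD => //; apply: measurable_funB; exact: measurable_funM.
have mi : measurable_fun setT (fun p =>
    complex.Im (Complex a b * f (tpt p) + g (tpt p))).
  rewrite (_ : (fun p => _) = (fun p => a * complex.Im (f (tpt p)) +
     b * complex.Re (f (tpt p)) + complex.Im (g (tpt p)))); last first.
    by apply/funext => p; case: (f _) (g _) => [f1 f2'] [g1 g2'].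
  by apply: measurable_funD => //; apply: measurable_funD; exact: measurable_funM.
split=> //.
have If : intble (fun p => cabs2 (f (tpt p)) * wt p).
  apply: (sqint_dom sf sf); first by apply: measurable_funD; exact: measurable_funX.
  by move=> p; rewrite ger0_norm ?cabs2_ge0// lerDl cabs2_ge0.
have Ig : intble (fun p => cabs2 (g (tpt p)) * wt p).
  apply: (sqint_dom sg sg); first by apply: measurable_funD; exact: measurable_funX.
  by move=> p; rewrite ger0_norm ?cabs2_ge0// lerDl cabs2_ge0.
have /integrableP[mI] := intble_lin (2 * (a ^+ 2 + b ^+ 2)) If (intble_lin 1 Ig Ig).
apply: le_lt_trans; apply: ge0_le_integral => //.
- by move=> p _; rewrite lee_fin mulr_ge0 ?cabs2_ge0 ?expR_ge0.
- apply: measurable_funTS; apply/measurable_EFinP; apply: measurable_funM; last exact: measurable_wt.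
  by apply: measurable_funD; exact: measurable_funX.
- exact: measurableT_comp.
- move=> p _ /=; rewrite lee_fin (le_trans _ (ler_norm _))//.
  have w0 : 0 <= wt p by exact: expR_ge0.
  rewrite (_ : 2 * _ * _ + _ = (2 * (a ^+ 2 + b ^+ 2) * cabs2 (f (tpt p)) +
    2 * cabs2 (g (tpt p))) * wt p); last by ring.
  rewrite ler_wpM2r//.
  case: (f _) (g _) => [f1 f2'] [g1 g2']; rewrite /cabs2 /=.
  have := sqr_ge0 (a * f1 - b * f2' - g1).
  have := sqr_ge0 (a * f2' + b * f1 - g2').
  nra.
Qed.

Lemma sqint_re_im f : measurable_fun setT (fun p => complex.Re (f (tpt p))) ->
  measurable_fun setT (fun p => complex.Im (f (tpt p))) ->
  (L2sq phi k f < +oo)%E -> sqint f.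
Proof. by move=> fr fi; rewrite L2sq_ltyE. Qed.

Lemma sqint0 : sqint (fun=> 0).
Proof.
split; [exact: measurable_cst|exact: measurable_cst|].
rewrite (eq_integral (cst 0%E)) ?integral0 ?ltry// => p _.
by rewrite /cabs2 /= expr0n /= addr0 mul0r.
Qed.

Lemma inner0 h : sqint h -> inner phi k (fun=> 0) h = 0.
Proof.
move=> sh; rewrite [X in inner phi k X h](_ : _ = fun z => (-1) * 0 + 0); last first.
  by apply/funext => z; rewrite mulr0 addr0.
by rewrite (inner_lin _ sqint0 sqint0 sh) mulN1r addNr.
Qed.

Lemma sqint_sum w (b : 'I_w -> C) (f : 'I_w -> Cn -> C) :
  (forall j, sqint (f j)) -> sqint (fun z => \sum_j b j * f j z).
Proof.
move=> sf; elim: w b f sf => [|w ih] b f sf.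
  rewrite (_ : (fun z => _) = (fun=> 0)); first exact: sqint0.
  by apply/funext => z; rewrite big_ord0.
rewrite (_ : (fun z => _) = (fun z => b ord0 * f ord0 z +
    \sum_j b (lift ord0 j) * f (lift ord0 j) z)); last first.
  by apply/funext => z; rewrite big_ord_recl.
by apply: sqint_lin => //; exact: (ih (fun j => b (lift ord0 j)) (fun j => f (lift ord0 j))).
Qed.

Lemma eq_innerl (f f' h : Cn -> C) : f =1 f' -> inner phi k f h = inner phi k f' h.
Proof. by move=> /funext ->. Qed.

Lemma inner_suml w (b : 'I_w -> C) (f : 'I_w -> Cn -> C) h :
  (forall j, sqint (f j)) -> sqint h ->
  inner phi k (fun z => \sum_j b j * f j z) h = \sum_j b j * inner phi k (f j) h.
Proof.
move=> sf sh; elim: w b f sf => [|w ih] b f sf.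
  rewrite big_ord0; transitivity (inner phi k (fun=> 0) h); last exact: inner0.
  by apply: eq_innerl => z; rewrite big_ord0.
rewrite big_ord_recl -(ih (fun j => b (lift ord0 j)) (fun j => f (lift ord0 j)))//.
rewrite -inner_lin//.
- by apply: eq_innerl => z; rewrite big_ord_recl.
- exact: (@sqint_sum _ (fun j => b (lift ord0 j)) (fun j => f (lift ord0 j))).
Qed.

End L2.

(** * Complex limits through real and imaginary parts *)

Section complex_limits.
Variables (R : realType).
Local Notation C := R[i].

Lemma Complex_cvg (T : Type) (F : set_system T) {FF : Filter F} (u v : T -> R)
    (a b : R) : u x @[x --> F] --> a -> v x @[x --> F] --> b ->
  Complex (u x) (v x) @[x --> F] --> (Complex a b : C).
Proof.
move=> ua vb; apply/cvgrPdist_lt => -[e e'].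
rewrite ltcE /= => /andP[/eqP -> e0].
have e20 : 0 < e / 2 by rewrite divr_gt0.
move/cvgrPdist_lt : ua => /(_ _ e20) ua.
move/cvgrPdist_lt : vb => /(_ _ e20) vb.
near=> x.
rewrite normc_def ltcR /=.
have ha : `|a - u x| < e / 2 by near: x.
have hb : `|b - v x| < e / 2 by near: x.
apply: (@le_lt_trans _ _ (`|a - u x| + `|b - v x|)); last by rewrite (splitr e) ltrD.
rewrite -[leRHS]ger0_norm ?addr_ge0// -sqrtr_sqr ler_wsqrtr//.
rewrite -[(a - u x) ^+ 2]real_normK ?num_real// -[(b - v x) ^+ 2]real_normK ?num_real//.
by rewrite sqrrD lerD2r lerDl mulrn_wge0// mulr_ge0.
Unshelve. all: by end_near. Qed.

Lemma Re_cvg (T : Type) (F : set_system T) {FF : Filter F} (f : T -> C) (l : C) :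
  f x @[x --> F] --> l -> complex.Re (f x) @[x --> F] --> complex.Re l.
Proof.
move=> fl; apply/cvgrPdist_lt => e e0.
have e0' : 0 < (e%:C)%C :> C by rewrite ltcR.
move/cvgrPdist_lt : fl => /(_ _ e0'); apply: filterS => x.
rewrite -ltcR; apply: le_lt_trans.
by rewrite -raddfB; exact: normc_ge_Re.
Qed.

Lemma Im_cvg (S : Type) (F : set_system S) {FF : Filter F} (f : S -> C) (l : C) :
  f x @[x --> F] --> l -> complex.Im (f x) @[x --> F] --> complex.Im l.
Proof.
move=> fl; apply/cvgrPdist_lt => e e0.
have e0' : 0 < (e%:C)%C :> C by rewrite ltcR.
move/cvgrPdist_lt : fl => /(_ _ e0'); apply: filterS => x.
rewrite -ltcR; apply: le_lt_trans.
rewrite -raddfB normc_def lecR -sqrtr_sqr ler_wsqrtr// lerDr; exact: sqr_ge0.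
Qed.

End complex_limits.

(** * Laurent monomials in polar coordinates *)

Section laurent.
Variables (R : realType) (n : nat).
Local Notation V := 'rV[R]_n.
Local Notation C := R[i].
Local Notation Cn := 'rV[C]_n.
Local Notation T := (measurableTypeR R).
Local Notation Om := (n.-tuple T * n.-tuple T)%type.
Local Notation mu := (leb R n \x leb R n)%E.

Lemma torus_pt_torus (x th : V) : torus (torus_pt x th).
Proof.
move=> i; rewrite mxE; apply/eqP => -[a b].
move/eqP: a; rewrite mulf_eq0 gt_eqF ?expR_gt0//= => /eqP a.
move/eqP: b; rewrite mulf_eq0 gt_eqF ?expR_gt0//= => /eqP b.
have := cos2Dsin2 (th 0 i); rewrite a b expr0n addr0 => /eqP.
by rewrite eq_sym oner_eq0.
Qed.

Lemma torus_pt_cvg (p : V * V) :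
  torus_pt q.1 q.2 @[q --> p] --> torus_pt p.1 p.2.
Proof.
apply/cvg_ballP => e e0.
have : \forall q \near p, forall i, ball (torus_pt p.1 p.2 0 i) e (torus_pt q.1 q.2 0 i).
  apply: (@filter_forall _ _ (fun i q => ball (torus_pt p.1 p.2 0 i) e
    (torus_pt q.1 q.2 0 i)) (nbhs p) _) => i.
  have : torus_pt q.1 q.2 0 i @[q --> p] --> torus_pt p.1 p.2 0 i.
    rewrite mxE; under eq_fun do rewrite mxE.
    have c1 : (q.1 : V) 0 i @[q --> p] --> p.1 0 i.
      apply: (@cvg_comp _ _ _ fst (fun x : V => x 0 i) (nbhs p) (nbhs p.1)).
        exact: cvg_fst.
      exact: coord_continuous.
    have c2 : (q.2 : V) 0 i @[q --> p] --> p.2 0 i.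
      apply: (@cvg_comp _ _ _ snd (fun x : V => x 0 i) (nbhs p) (nbhs p.2)).
        exact: cvg_snd.
      exact: coord_continuous.
    have c3 : expR ((q.1 : V) 0 i / 2) @[q --> p] --> expR (p.1 0 i / 2).
      apply: (@cvg_comp _ _ _ (fun q : V * V => (q.1 : V) 0 i / 2) expR (nbhs p)
        (nbhs (p.1 0 i / 2))); last exact: continuous_expR.
      by apply: cvgM c1 _; exact: cvg_cst.
    have c4 : cos ((q.2 : V) 0 i) @[q --> p] --> cos (p.2 0 i).
      apply: (@cvg_comp _ _ _ (fun q : V * V => (q.2 : V) 0 i) cos (nbhs p)
        (nbhs (p.2 0 i))) => //; exact: continuous_cos.
    have c5 : sin ((q.2 : V) 0 i) @[q --> p] --> sin (p.2 0 i).
      apply: (@cvg_comp _ _ _ (fun q : V * V => (q.2 : V) 0 i) sin (nbhs p)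
        (nbhs (p.2 0 i))) => //; exact: continuous_sin.
    by apply: Complex_cvg; apply: cvgM.
  by move/cvg_ballP => /(_ _ e0).
apply: filterS => q h; split => // i j.
by rewrite ord1; exact: h.
Qed.

Lemma hilb_sqint (phi : V -> R) k (f : Cn -> C) :
  hilb phi k f -> sqint phi k f.
Proof.
move=> [_ hf f2].
have cf (p : V * V) : f (torus_pt q.1 q.2) @[q --> p] --> f (torus_pt p.1 p.2).
  apply: (@cvg_comp _ _ _ (fun q : V * V => torus_pt q.1 q.2) f (nbhs p)
    (nbhs (torus_pt p.1 p.2))); first exact: torus_pt_cvg.
  have := differentiable_continuous (hf _ (torus_pt_torus p.1 p.2)). exact.
apply: sqint_re_im => //.
  apply: (@vec2_measurable_fun R n (fun p => complex.Re (f (torus_pt p.1 p.2)))).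
  by move=> p; apply: Re_cvg; exact: cf.
apply: (@vec2_measurable_fun R n (fun p => complex.Im (f (torus_pt p.1 p.2)))).
by move=> p; apply: Im_cvg; exact: cf.
Qed.

(** The complex number [exp (u + i t)]. *)
Definition cexp (u t : R) : C := Complex (expR u * cos t) (expR u * sin t).

Lemma cexpD u t u' t' : cexp (u + u') (t + t') = cexp u t * cexp u' t'.
Proof.
apply/eqP; rewrite eq_complex /= expRD cosD sinD.
by apply/andP; split; apply/eqP; ring.
Qed.

Lemma cexp0 : cexp 0 0 = 1.
Proof.
by apply/eqP; rewrite eq_complex /= expR0 cos0 sin0 mulr1 mulr0 !eqxx.
Qed.

Lemma cexpXz u t (a : int) : cexp u t ^ a = cexp (a%:~R * u) (a%:~R * t).
Proof.
have X (m : nat) : cexp u t ^+ m = cexp (m%:R * u) (m%:R * t).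
  elim: m => [|m ih]; first by rewrite expr0 !mul0r cexp0.
  by rewrite exprS ih -cexpD -natr1; congr cexp; ring.
case: a => m; first exact: X.
rewrite NegzE -exprnN X mulrNz !mulNr.
set z := cexp _ _; set w := cexp _ _.
have zw : z * w = 1 by rewrite -cexpD !subrr cexp0.
have z0 : z != 0 by apply/eqP => z0; move/eqP: zw; rewrite z0 mul0r eq_sym oner_eq0.
by rewrite -[LHS]mulr1 -zw mulKf.
Qed.

Lemma cexp_conj u t : (cexp u t)^*%C = cexp u (- t).
Proof. by rewrite /cexp /= cosN sinN mulrN. Qed.

Lemma monomial_torus_pt (m : 'rV[int]_n) (x th : V) :
  monomial m (torus_pt x th) =
  cexp (dot (real_pt R m) x / 2) (dot (real_pt R m) th).
Proof.
rewrite /monomial /dot mulr_suml.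
have : (\prod_i torus_pt x th 0 i ^ m 0 i =
   cexp (\sum_i real_pt R m 0 i * x 0 i / 2) (\sum_i real_pt R m 0 i * th 0 i)) => //.
elim/big_rec3 : _ => [|i u t z _ ->]; first by rewrite cexp0.
rewrite cexpD; congr (_ * _); rewrite !mxE -/(cexp _ _) cexpXz; congr cexp.
by rewrite mulrA.
Qed.

Lemma laurentE (m : 'rV[int]_n) (z : Cn) : torus z -> laurent m z = monomial m z.
Proof. by move=> tz; rewrite /laurent patchE mem_set. Qed.

Lemma laurent_tpt (m : 'rV[int]_n) (p : Om) : laurent m (tpt p) =
  cexp (dot (real_pt R m) (vec p.1) / 2) (dot (real_pt R m) (vec p.2)).
Proof. by rewrite laurentE ?monomial_torus_pt//; exact: torus_pt_torus. Qed.

Lemma patch_polar (h : Om -> \bar R) (x y : n.-tuple T) :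
  (h \_ (@polar R n)) (x, y) = ((fun y => h (x, y)) \_ (@angles R n)) y.
Proof.
rewrite !patchE; have -> : ((x, y) \in @polar R n) = (y \in @angles R n) => //.
by apply/idP/idP; rewrite !inE; [case|split].
Qed.

Lemma integral_polar_cos (F : n.-tuple T -> R) b (a : 'rV[int]_n) : a != 0 ->
  mu.-integrable (@polar R n) (fun p => (F p.1 * cos (phase b a p.2))%:E) ->
  (\int[mu]_(p in @polar R n) (F p.1 * cos (phase b a p.2))%:E = 0)%E.
Proof.
move=> a0 iF; rewrite integral_mkcond -integral12_prod_meas1; last first.
  by apply/(integrable_restrict _ _ _ _).1 => //; [exact: measurable_polar|rewrite setTI].
apply: integral0_eq => x _; rewrite /fubini_F.
under eq_integral do rewrite patch_polar.
rewrite -integral_mkcond.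
under eq_integral do rewrite EFinM.
transitivity ((F x)%:E * \int[leb R n]_(y in @angles R n) (cos (phase b a y))%:E)%E;
  last by rewrite integral_cos_phase (negPf a0) mule0.
have ic : (leb R n).-integrable (@angles R n) (fun y => (cos (phase b a y))%:E).
  apply: measurable_bounded_integrable.
  - exact: measurable_angles.
  - exact: EFin_lty (leb_angles R n).
  - by apply: measurable_funTS; exact: measurable_cos_phase.
  - exists 1%R; split => // M M1 y _ /=.
    by rewrite (le_trans _ (ltW M1))// ler_norml cos_le1 cos_geN1.
exact: (integralZl (@measurable_angles R n) ic (F x)).
Qed.

Lemma integral_polar_radial (G : n.-tuple T -> R) :
  measurable_fun setT G -> (forall x, 0 <= G x) ->
  (\int[mu]_(p in @polar R n) (G p.1)%:E =
   ((2 * pi) ^+ n)%:E * \int[leb R n]_x (G x)%:E)%E.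
Proof.
move=> mG G0; rewrite integral_mkcond fubini_tonelli1; last 2 first.
- apply/(measurable_restrictT _ _).1; first exact: measurable_polar.
  by apply: measurable_funTS; apply/measurable_EFinP; exact: measurableT_comp mG _.
- by move=> p; apply: erestrict_ge0 => q _; rewrite lee_fin.
rewrite -ge0_integralZl//.
- apply: eq_integral => x _; rewrite /fubini_F.
  under eq_integral do rewrite patch_polar.
  rewrite -integral_mkcond muleC -[in RHS](leb_angles R n).
  exact: (integral_cst (leb R n) (@measurable_angles R n) (G x)%:E).
- exact/measurable_EFinP.
- by move=> x _; rewrite lee_fin.
- by rewrite lee_fin exprn_ge0// mulr_ge0// pi_ge0.
Qed.

Section weighted.
Variables (phi : V -> R) (k : nat).
Hypothesis cphi : continuous phi.

(** The squared norm of [z^m], by [L2sq_laurent]: the angular part of the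
    integral is trivial. *)
Definition growth (m : 'rV[int]_n) : \bar R :=
  \int[leb R n]_x (expR (dot (real_pt R m) (vec x) - k%:R * phi (vec x)))%:E.

Lemma growth_ge0 m : (0 <= growth m)%E.
Proof. by apply: integral_ge0 => x _; rewrite lee_fin expR_ge0. Qed.

Lemma measurable_growth m :
  measurable_fun setT (fun x : n.-tuple T =>
    expR (dot (real_pt R m) (vec x) - k%:R * phi (vec x))).
Proof.
apply: (@vec_measurable_fun R n (fun x => expR (dot (real_pt R m) x - k%:R * phi x))) => x.
apply: continuous_comp; last exact: continuous_expR.
apply: (@continuousB _ _ _ (dot (real_pt R m)) (fun x => k%:R * phi x)).
  exact: dot_continuous.
apply: (@continuousM _ _ (cst k%:R) phi); first exact: cst_continuous.
exact: cphi.
Qed.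

Lemma cabs2_cexp u t : cabs2 (cexp u t) = expR (u *+ 2).
Proof. by rewrite cabs2_polar expr2 -expRD mulr2n. Qed.

Lemma L2sq_laurent m : L2sq phi k (laurent m) = growth m.
Proof.
rewrite /L2sq /int_torus -/(@polar R n).
under eq_integral.
  move=> p _; rewrite weight_tpt laurent_tpt cabs2_cexp /wt -expRD.
  rewrite mulr2n -splitr; over.
rewrite (integral_polar_radial (measurable_growth m))//.
rewrite muleA -EFinM mulVf ?mul1e// lt0r_neq0// exprn_gt0//.
by rewrite mulr_gt0// pi_gt0.
Qed.

Lemma laurent_hilb m : (growth m < +oo)%E -> hilb phi k (laurent m).
Proof.
move=> gm; split; last by rewrite L2sq_laurent.
  by move=> z tz; rewrite /laurent patchE memNset.
move=> z tz; apply: (near_eq_differentiable (f := monomial m)).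
  by near=> y; rewrite laurentE//; near: y; exact: near_torus.
exact: monomial_differentiable.
Unshelve. all: by end_near. Qed.

Lemma hilb_sum w (b : 'I_w -> C) (f : 'I_w -> Cn -> C) :
  (forall j, hilb phi k (f j)) -> hilb phi k (fun z => \sum_j b j * f j z).
Proof.
move=> hf; split.
- move=> z tz; apply: big1 => j _; have [-> //] := hf j.
  by rewrite mulr0.
- move=> z tz; have -> : (fun z => \sum_j b j * f j z) = \sum_j (b j *: f j).
    by apply/funext => y; rewrite fct_sumE.
  apply: differentiable_sum => j; apply: differentiableZ.
  by have [_ h _] := hf j; exact: h.
- have [_ _ h] := @sqint_sum _ _ phi k cphi w b f (fun j => hilb_sqint (hf j)).
  by rewrite L2sq_ltyE.
Qed.

(** The angular integral of [z^m] times the conjugate of [z^m'] runs over a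
    nontrivial character. *)
Lemma inner_laurent0 m m' : m != m' ->
  (growth m < +oo)%E -> (growth m' < +oo)%E ->
  inner phi k (laurent m) (laurent m') = 0.
Proof.
move=> mm' gm gm'.
have sm := hilb_sqint (laurent_hilb gm); have sm' := hilb_sqint (laurent_hilb gm').
have mm0 : m - m' != 0 by rewrite subr_eq0.
have prodE p : laurent m (tpt p) * (laurent m' (tpt p))^*%C = cexp
    (dot (real_pt R m) (vec p.1) / 2 + dot (real_pt R m') (vec p.1) / 2)
    (dot (real_pt R (m - m')) (vec p.2)).
  rewrite !laurent_tpt cexp_conj -cexpD; congr cexp.
  by rewrite /dot -sumrB; apply: eq_bigr => i _; rewrite !mxE rmorphB mulrBl.
pose F (x : n.-tuple T) := expR (dot (real_pt R m) (vec x) / 2 +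
  dot (real_pt R m') (vec x) / 2) * expR (- (k%:R * phi (vec x))).
have reE : (fun p => complex.Re (laurent m (tpt p) * (laurent m' (tpt p))^*%C) *
    wt phi k p) = fun p => F p.1 * cos (phase 0 (m - m') p.2).
  by apply/funext => p; rewrite prodE /= /F /wt /phase add0r mulrAC.
have imE : (fun p => complex.Im (laurent m (tpt p) * (laurent m' (tpt p))^*%C) *
    wt phi k p) = fun p => F p.1 * cos (phase (- (pi / 2)) (m - m') p.2).
  apply/funext => p; rewrite prodE /= /F /wt /phase mulrAC; congr (_ * _).
  by rewrite [- _ + dot _ _]addrC cosBpihalf.
have := intble_im cphi sm sm'; rewrite imE => Iim.
have := intble_re cphi sm sm'; rewrite reE => Ire.
by rewrite innerE reE imE /rint (integral_polar_cos mm0 Ire) (integral_polar_cos mm0 Iim) mule0.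
Qed.

End weighted.

End laurent.

(** * Few lattice points have small weight *)

Section weights.
Variables (R : realType) (n : nat).
Local Notation V := 'rV[R]_n.
Local Notation C := R[i].
Local Notation Cn := 'rV[C]_n.
Local Notation T := (measurableTypeR R).
Variables (phi : V -> R) (k : nat).
Hypothesis cphi : continuous phi.
Local Notation growth := (growth phi k).
Local Notation "<< f , g >>" := (inner phi k f g) (format "<< f ,  g >>").
Local Notation sqint := (sqint phi k).

Lemma growth_gt0 m : (0 < growth m)%E.
Proof.
rewrite lt0e growth_ge0 andbT; apply/eqP => g0.
have mg := measurable_growth k cphi m.
have mg' := (measurable_EFinP _ _).2 mg.
have : (\int[leb R n]_x `|(expR (dot (real_pt R m) (vec x) - k%:R * phi (vec x)))%:E| = 0)%E.
  by rewrite -[RHS]g0; apply: eq_integral => x _; rewrite gee0_abs// lee_fin expR_ge0.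
move/(ae_eq_integral_abs _ measurableT mg') => [A [mA A0 sA]].
have : (0 < vol [set: V])%E by apply: (@open_vol_gt0 R n setT 0) => //; exact: openT.
rewrite /vol preimage_setT -A0 lt_neqAle eq_sym => /andP[/negP + _]; apply.
apply/eqP; congr (leb R n _); apply/seteqP; split=> // x _; apply: sA => /= /(_ I) [] /eqP.
by rewrite gt_eqF// expR_gt0.
Qed.

Lemma hnorm_laurent_gt0 m : (growth m < +oo)%E -> 0 < hnorm phi k (laurent m).
Proof.
move=> gm; rewrite /hnorm L2sq_laurent// sqrtr_gt0 fine_gt0// gm.
by rewrite growth_gt0.
Qed.

Lemma inner_scale (a : C) f g : sqint f -> sqint g ->
  <<fun z => a * f z, g>> = a * <<f, g>>.
Proof.
move=> sf sg; rewrite -[RHS]addr0 -(inner0 cphi sg) -(inner_lin cphi)//; last exact: sqint0.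
by apply: eq_innerl => z; rewrite addr0.
Qed.

Lemma sqint_scale (a : C) f : sqint f -> sqint (fun z => a * f z).
Proof.
move=> sf; rewrite (_ : (fun z => _) = (fun z => a * f z + 0)); last first.
  by apply/funext => z; rewrite addr0.
by apply: sqint_lin => //; exact: sqint0.
Qed.

Lemma conjcM (x y : C) : (x * y)^*%C = x^*%C * y^*%C.
Proof. exact: rmorphM. Qed.

Lemma inner_self f : sqint f -> <<f, f>> = ((hnorm phi k f ^+ 2)%:C)%C.
Proof.
move=> sf; have := inner_conj cphi sf sf; rewrite hnorm_sqr.
case: (inner _ _ _ _) => a b [] b0; apply/eqP; rewrite eq_complex /= eqxx /=.
by apply/eqP; lra.
Qed.

Lemma sectE m : sect phi k m =
  (fun z => (((hnorm phi k (laurent m))^-1)%:C)%C * laurent m z).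
Proof. by apply/funext => z; rewrite /sect mulrC fmorphV. Qed.

Lemma sect_hilb m : (growth m < +oo)%E -> hilb phi k (sect phi k m).
Proof.
move=> gm; have := @hilb_sum R n phi k cphi 1
  (fun=> (((hnorm phi k (laurent m))^-1)%:C)%C) (fun=> laurent m)
  (fun=> laurent_hilb cphi gm).
by rewrite sectE; under eq_fun do rewrite big_ord1.
Qed.

Lemma inner_sect m m' : (growth m < +oo)%E -> (growth m' < +oo)%E ->
  <<sect phi k m, sect phi k m'>> = (m == m')%:R.
Proof.
move=> gm gm'.
have sm := hilb_sqint (laurent_hilb cphi gm).
have sm' := hilb_sqint (laurent_hilb cphi gm').
rewrite !sectE inner_scale//; last exact: sqint_scale.
rewrite (inner_conj cphi _ sm); last exact: sqint_scale.
rewrite inner_scale// conjcM -(inner_conj cphi sm' sm) conjc_real.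
have [->|mm'] := eqVneq m m'; last first.
  by rewrite inner_laurent0 ?mulr0// eq_sym.
have h0 := hnorm_laurent_gt0 gm'.
by rewrite inner_self// -!rmorphM expr2 mulKf ?mulVf ?gt_eqF// eqxx.
Qed.

Section comb.
Variables (w : nat) (e : 'I_w -> 'rV[int]_n) (a : 'I_w -> C).
Hypothesis injE : injective e.
Hypothesis ge : forall j, (growth (e j) < +oo)%E.

Definition comb (z : Cn) : C := \sum_j a j * sect phi k (e j) z.

Lemma comb_hilb : hilb phi k comb.
Proof. by apply: hilb_sum => // j; exact: sect_hilb. Qed.

Let ss j : sqint (sect phi k (e j)).
Proof. by apply: hilb_sqint; exact: sect_hilb. Qed.

Lemma inner_comb_sect m : (growth m < +oo)%E ->
  <<comb, sect phi k m>> = \sum_j a j * (e j == m)%:R.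
Proof.
move=> gm; rewrite /comb (inner_suml cphi)//; last exact/hilb_sqint/sect_hilb.
by apply: eq_bigr => j _; rewrite (inner_sect (ge j) gm).
Qed.

Lemma inner_comb_sectE j : <<comb, sect phi k (e j)>> = a j.
Proof.
rewrite (inner_comb_sect (ge j)) (bigD1 j)//= eqxx mulr1 big1 ?addr0// => l lj.
by rewrite (inj_eq injE) (negPf lj) mulr0.
Qed.

Lemma inner_comb (c : 'I_w -> C) :
  <<fun z => \sum_j c j * a j * sect phi k (e j) z, comb>> =
  \sum_j c j * ((cabs2 (a j))%:C)%C.
Proof.
rewrite (inner_suml cphi (fun j => c j * a j))//; last exact/hilb_sqint/comb_hilb.
apply: eq_bigr => j _; rewrite (inner_conj cphi (hilb_sqint comb_hilb) (ss j)).
rewrite inner_comb_sectE -mulrA; congr (_ * _).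
by case: (a j) => x y; apply/eqP; rewrite eq_complex /cabs2 /=; apply/andP; split; apply/eqP; ring.
Qed.

Lemma inner_comb_self : <<comb, comb>> = ((\sum_j cabs2 (a j))%:C)%C.
Proof.
have E : comb = fun z => \sum_j 1 * a j * sect phi k (e j) z.
  by apply/funext => z; apply: eq_bigr => j _; rewrite mul1r.
rewrite [X in inner _ _ X _]E (inner_comb (fun=> 1)) raddf_sum.
by apply: eq_bigr => j _; rewrite mul1r.
Qed.

(** The diagonal operator acts on a combination of the sections [e j] by the
    weights of the [e j]: by orthonormality the other terms vanish. *)
Lemma diag_comb (A : set 'rV[int]_n) (q : 'rV[int]_n -> nat) z :
  (forall m, A m -> (growth m < +oo)%E) -> (forall j, A (e j)) ->
  \sum_(m \in A) (q m)%:R * <<comb, sect phi k m>> * sect phi k m z =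
  \sum_j (q (e j))%:R * a j * sect phi k (e j) z.
Proof.
move=> gA Ae; rewrite (fsbigE (map e (enum 'I_w))).
- rewrite big_map big_enum_cond /=; apply: eq_big => [j|j _].
    by rewrite mem_set.
  by rewrite inner_comb_sectE.
- by rewrite map_inj_uniq// enum_uniq.
- by move=> m /= /mapP[j _ ->].
- move=> m Am me; rewrite (inner_comb_sect (gA _ Am)) big1 ?mulr0 ?mul0r// => j _.
  by rewrite (_ : (e j == m) = false) ?mulr0//; apply/eqP => h; case/negP: me;
    rewrite -h map_f// mem_enum.
Qed.

End comb.

Lemma innerBl f g h : sqint f -> sqint g -> sqint h ->
  <<fun z => f z - g z, h>> = <<f, h>> - <<g, h>>.
Proof.
move=> sf sg sh; rewrite addrC -mulN1r -(inner_lin cphi)//.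
by apply: eq_innerl => z; rewrite mulN1r addrC.
Qed.

Lemma sqintB f g : sqint f -> sqint g -> sqint (fun z => f z - g z).
Proof.
move=> sf sg; rewrite (_ : (fun z => _) = (fun z => (-1) * g z + f z)).
  exact: sqint_lin.
by apply/funext => z; rewrite mulN1r addrC.
Qed.

(** [orth_proj] is a choice that defaults to [0] if there is no projection.
    In either case its value is orthogonal to its difference with [f], which
    makes the quadratic form nonnegative, and every element of [F] is its own
    projection. *)
Lemma orth_projP (F : set (Cn -> C)) f : F `<=` hilb phi k -> hilb phi k f ->
  let g := orth_proj phi k F f in
  [/\ sqint g, 0 <= complex.Re <<g, f>> & F f -> <<g, f>> = <<f, f>>].
Proof.
move=> Fh hf g; have sf := hilb_sqint hf; rewrite {}/g /orth_proj.
case: xgetP => [g _ [Fg gh]|noP].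
  have sg := hilb_sqint (Fh _ Fg); split=> // [|Ff].
    have /eqP := gh g Fg; rewrite innerBl// subr_eq0 => /eqP fg.
    rewrite (inner_conj cphi sf sg) fg inner_self// conjc_real /=.
    exact: sqr_ge0.
  by have /eqP := gh f Ff; rewrite innerBl// subr_eq0 => /eqP.
split; first exact: sqint0.
  by rewrite inner0.
move=> Ff; case: (noP f); split=> // h Fh'.
rewrite (_ : (fun z => f z - f z) = fun=> 0); last first.
  by apply/funext => z; rewrite subrr.
exact: inner0 (hilb_sqint (Fh _ Fh')).
Qed.

(** The first [j] projections fix [f], and the others contribute nonnegative
    terms. *)
Lemma sum_proj_test (N j : nat) (F : nat -> set (Cn -> C)) f :
  (forall i, F i `<=` hilb phi k) -> hilb phi k f -> <<f, f>> = 1 ->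
  (j <= N)%N -> (forall i, (1 <= i <= j)%N -> F i f) ->
  let h z := \sum_(1 <= i < N.+1) orth_proj phi k (F i) f z in
  sqint h /\ j%:R <= complex.Re <<h, f>>.
Proof.
move=> Fh hf f1 jN Ff h; have sf := hilb_sqint hf.
pose P (i : 'I_N) := orth_proj phi k (F i.+1) f.
have hE : h = fun z => \sum_(i < N) 1 * P i z.
  apply/funext => z; rewrite /h big_add1 big_mkord; apply: eq_bigr => i _.
  by rewrite mul1r.
have sP i : sqint (P i) by have [] := orth_projP (Fh i.+1) hf.
split; first by rewrite hE; exact: (sqint_sum cphi (fun=> 1)).
have -> : <<h, f>> = \sum_(i < N) <<P i, f>>.
  rewrite hE (inner_suml cphi (fun=> 1))//.
  by apply: eq_bigr => i _; rewrite mul1r.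
rewrite raddf_sum (bigID (fun i : 'I_N => (i < j)%N)).
rewrite -[leLHS]addr0 lerD//; last first.
  apply: sumr_ge0 => i _.
  by have [_ Re0 _] := orth_projP (Fh i.+1) hf; exact: Re0.
rewrite (eq_bigr (fun=> 1)); last first.
  move=> i ij; have [_ _ E] := orth_projP (Fh i.+1) hf.
  by rewrite [LHS]/(complex.Re <<P i, f>>) E ?f1//; exact: Ff.
rewrite -(big_ord_widen _ (fun=> 1))// sumr_const card_ord.
exact: lexx.
Qed.

(** Expand [0 <= |h - f|^2]. *)
Lemma norm_test h f : sqint h -> sqint f -> <<f, f>> = 1 ->
  1 <= complex.Re <<h, f>> -> 1 <= hnorm phi k h.
Proof.
move=> sh sf f1 hf.
have h0 : 0 <= hnorm phi k h by rewrite /hnorm sqrtr_ge0.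
rewrite -(ler_pXn2r (n := 2))// ?nnegrE// expr1n hnorm_sqr.
have : 0 <= hnorm phi k (fun z => h z - f z) ^+ 2 by exact: sqr_ge0.
rewrite hnorm_sqr innerBl//; last exact: sqintB.
rewrite (inner_conj cphi (sqintB sh sf) sh) (inner_conj cphi (sqintB sh sf) sf).
rewrite !innerBl// f1 (inner_conj cphi sh sf).
case: (inner _ _ h h) hf => a b; case: (inner _ _ h f) => c d /=; lra.
Qed.

(** [a (a - 1) ... (a - c + 1)] for an integer [a] of any sign. *)
Definition falling (a : int) (c : nat) : C := \prod_(l < c) (a - l%:Z)%:~R.

Lemma jet_coefE (m : 'rV[int]_n) (s : seq 'I_n) :
  jet_coef C m s = \prod_i falling (m 0 i) (count_mem i s).
Proof.
elim: s => [|i s ih] /=.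
  by rewrite big1// => i _; rewrite /falling big_ord0.
rewrite ih (bigD1 i)//= [RHS](bigD1 i)//= eqxx add1n.
rewrite /falling big_ord_recr /= mulrAC; congr (_ * _ * _).
by apply: eq_bigr => l li; rewrite eq_sym (negPf li).
Qed.

Lemma sum_count_mem (s : seq 'I_n) : (\sum_i count_mem i s)%N = size s.
Proof.
elim: s => [|j s ih] /=; first by rewrite big1.
rewrite big_split /= ih (bigD1 j)//= eqxx big1 ?addn0//.
by move=> i ij; rewrite eq_sym (negPf ij).
Qed.

(** By [jet_coefE] the partial derivatives at [p] depend on the sequence of
    indices only through its multiplicities [t], so that the condition is one
    linear equation for each multi-index of size at most [J]. *)
Lemma vanishing_of_jets w (e : 'I_w -> 'rV[int]_n) (b : 'I_w -> C) (p : Cn) J f :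
  torus p -> (forall z, torus z -> f z = \sum_l b l * monomial (e l) z) ->
  (forall t : n.-tuple 'I_J.+1, (\sum_(i <- t) i <= J)%N ->
    \sum_l b l * (\prod_i falling (e l 0 i) (tnth t i)) * monomial (e l) p = 0) ->
  (J.+1%:R%:E <= vord p f)%E.
Proof.
move=> tp fE h; apply/ereal_infP => _ [s sf <-]; rewrite lee_fin ler_nat ltnNge.
apply/negP => sJ; move/negP : sf; apply; apply/eqP.
rewrite (partials_monomials fE)//.
pose t : n.-tuple 'I_J.+1 := [tuple inord (count_mem i s) | i < n].
have cJ i : (count_mem i s <= J)%N by exact: leq_trans (count_size _ _) sJ.
have tE i : tnth t i = count_mem i s :> nat by rewrite tnth_mktuple inordK ?ltnS.
have tJ : (\sum_(i <- t) i <= J)%N.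
  rewrite big_tuple (eq_bigr (fun i => count_mem i s)); first by rewrite sum_count_mem.
  by move=> i _; exact: tE.
have ht := h t tJ.
rewrite (eq_bigr (fun l => (b l * (\prod_i falling (e l 0 i) (tnth t i)) *
  monomial (e l) p) / monomial (occ s) p)).
  by rewrite -mulr_suml ht mul0r.
move=> l _; rewrite monomialB// jet_coefE -!mulrA; congr (_ * (_ * _)).
by apply: eq_bigr => i _; rewrite tE.
Qed.

(** There are ['C(n + J, n)] multi-indices of size at most [J], hence fewer
    linear equations than the [w] unknowns. The scalar [s] leaves room to
    normalize the solution. *)
Lemma exists_vanishing w (e : 'I_w -> 'rV[int]_n) (c : 'I_w -> C) (p : Cn) J :
  torus p -> ('C(n + J, n) < w)%N ->
  exists2 a : 'rV[C]_w, a != 0 & forall s : C,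
    forall f, (forall z, torus z ->
      f z = \sum_l (s * a 0 l * c l) * monomial (e l) z) ->
    (J.+1%:R%:E <= vord p f)%E.
Proof.
move=> tp cw.
pose A := [set t : n.-tuple 'I_J.+1 | (\sum_(i <- t) i <= J)%N]%SET.
have cA : #|A| = 'C(n + J, n) by exact: card_partial_ord_partitions.
pose M : 'M[C]_(w, #|A|) := \matrix_(l < w, t < #|A|) (c l *
  (\prod_(i < n) falling (e l 0 i) (tnth (enum_val t : n.-tuple 'I_J.+1) i)) * monomial (e l) p).
have : kermx M != 0.
  rewrite -mxrank_eq0 mxrank_ker subn_eq0 -ltnNge.
  by rewrite (leq_ltn_trans (rank_leq_col M))// cA.
case/rowV0Pn => a /sub_kermxP aM a0; exists a => // s f fE.
apply: (vanishing_of_jets tp fE) => t tJ.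
have tA : t \in A by rewrite inE.
have /rowP/(_ (enum_rank_in tA t)) := aM; rewrite !mxE => at0.
rewrite (eq_bigr (fun l => s * (a 0 l * M l (enum_rank_in tA t)))); last first.
  by move=> l _; rewrite mxE enum_rankK_in// !mulrA.
by rewrite -mulr_sumr at0 mulr0.
Qed.

Lemma cabs2M (x y : C) : cabs2 (x * y) = cabs2 x * cabs2 y.
Proof. by case: x y => [a b] [c d]; rewrite /cabs2 /=; ring. Qed.

Lemma cabs2_eq0 (x : C) : cabs2 x = 0 -> x = 0.
Proof.
case: x => a b /eqP; rewrite /cabs2 /= paddr_eq0 ?sqr_ge0// !sqrf_eq0.
by move=> /andP[/eqP -> /eqP ->].
Qed.

Lemma ray_pt_torus (v : V) r : torus (ray_pt v r).
Proof.
by move=> i; rewrite mxE eq_complex /= eqxx andbT gt_eqF// expR_gt0.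
Qed.

(** If [q <= J] held at more than ['C(n + J, n)] lattice points, some unit
    combination of the corresponding sections would vanish to order [J + 1] at
    [ray_pt v r]. The sum of projections has quadratic form at least [J + 1]
    there, the diagonal operator at most [J], and their difference has norm less
    than [1] for large [r]. *)
Lemma weight_count (K : set V) v (q : 'rV[int]_n -> nat) J w
    (e : 'I_w -> 'rV[int]_n) :
  (J.+1 <= n.+1 * k)%N ->
  opnorm phi k (fun f z => sum_proj phi k (ray_pt v r) f z - diag_op K phi k q f z)
      @[r --> +oo%R] --> 0%E ->
  (forall m, lattice_pts K k m -> (growth m < +oo)%E) ->
  injective e ->
  (forall l, lattice_pts K k (e l) /\ (q (e l) <= J)%N) ->
  (w <= 'C(n + J, n))%N.
Proof.
move=> Jk cvg0 gK inj_e he; rewrite leqNgt; apply/negP => wC.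
have ge l : (growth (e l) < +oo)%E by apply: gK; have [] := he l.
pose err r (f : Cn -> C) z := sum_proj phi k (ray_pt v r) f z - diag_op K phi k q f z.
have [r rlt1] : exists r, (opnorm phi k (err r) < 1)%E.
  have /filter_ex// : \forall r \near +oo%R, (opnorm phi k (err r) < 1)%E.
  apply: (cvg0 [set x | x < 1%E]%E); apply: open_nbhs_nbhs; split.
    exact: open_ereal_lt_ereal.
  by rewrite /= lte_fin.
pose p : Cn := ray_pt v r.
have tp : torus p := ray_pt_torus v r.
pose c l : C := (((hnorm phi k (laurent (e l)))^-1)%:C)%C.
have [a a0 ha] := exists_vanishing e c tp wC.
pose nu := \sum_l cabs2 (a 0 l).
have nu0 : 0 < nu.
  rewrite lt_neqAle sumr_ge0 ?andbT => [|l _]; last exact: cabs2_ge0.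
  apply: contra a0; rewrite eq_sym => /eqP nu0; apply/eqP/rowP => l.
  rewrite mxE; apply: cabs2_eq0; apply: (psumr_eq0P _ nu0) => // i _.
  exact: cabs2_ge0.
(* normalization: [s] times the solution gives a section of norm [1] *)
pose s : C := (((Num.sqrt nu)^-1)%:C)%C.
pose a' l := s * a 0 l.
have nu1 : \sum_l cabs2 (a' l) = 1.
  under eq_bigr do rewrite cabs2M.
  rewrite -mulr_sumr /cabs2 /= expr0n addr0 exprVn sqr_sqrtr ?ltW//.
  by rewrite mulVf// gt_eqF.
pose f := comb e a'.
have hf : hilb phi k f by exact: comb_hilb.
have vf : (J.+1%:R%:E <= vord p f)%E.
  apply: (ha s) => z tz; apply: eq_bigr => l _.
  by rewrite sectE laurentE// mulrA.
have f1 : <<f, f>> = 1 by rewrite /f inner_comb_self// nu1.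
have leJ i : (1 <= i <= J.+1)%N -> (i%:R%:E <= J.+1%:R%:E :> \bar R)%E.
  by move=> /andP[_ iJ]; rewrite lee_fin ler_nat.
have [sh Jh] := @sum_proj_test (n.+1 * k) J.+1 (vanishing phi k p) f
  (fun i g => @proj1 _ _) hf f1 Jk (fun i iJ => conj hf (le_trans (leJ i iJ) vf)).
have DE : diag_op K phi k q f = fun z => \sum_l (q (e l))%:R * a' l * sect phi k (e l) z.
  by apply/funext => z; apply: diag_comb => // l; have [] := he l.
have sD : sqint (diag_op K phi k q f).
  rewrite DE; apply: (sqint_sum cphi (fun l => (q (e l))%:R * a' l)) => l.
  exact/hilb_sqint/sect_hilb.
have DJ : complex.Re <<diag_op K phi k q f, f>> <= J%:R.
  have -> : J%:R = \sum_l J%:R * cabs2 (a' l) by rewrite -mulr_sumr nu1 mulr1.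
  rewrite DE inner_comb// raddf_sum.
  apply: ler_sum => l _; have [_ ql] := he l.
  have -> : (q (e l))%:R = (((q (e l))%:R : R)%:C)%C :> C by rewrite rmorph_nat.
  by rewrite -rmorphM /=; apply: ler_wpM2r; rewrite ?cabs2_ge0 ?ler_nat.
have /le_lt_trans/(_ rlt1) : (1 <= opnorm phi k (err r))%E.
  apply: (@le_trans _ _ (hnorm phi k (err r f))%:E).
    rewrite lee_fin; apply: (@norm_test _ f) => //.
    - exact: sqintB.
    - exact: hilb_sqint.
    - rewrite innerBl//; last exact: hilb_sqint.
      rewrite raddfB /= lerBrDr; apply: le_trans Jh.
      by rewrite -natr1 addrC lerD2r.
  apply: ereal_sup_ubound; exists f => //; split => //.
  by rewrite -(ler_pXn2r (n := 2)) ?nnegrE ?sqrtr_ge0// hnorm_sqr f1 expr1n.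
by rewrite ltxx.
Qed.

End weights.

(** * Convex functions and convex bodies *)

Section convex.
Variables (R : realType) (n : nat).
Local Notation V := 'rV[R]_n.

Lemma dotC (x y : V) : dot x y = dot y x.
Proof. by apply: eq_bigr => i _; rewrite mulrC. Qed.

Lemma dotDr (x y z : V) : dot x (y + z) = dot x y + dot x z.
Proof. by rewrite -big_split; apply: eq_bigr => i _; rewrite !mxE mulrDr. Qed.

Lemma dotZr (x y : V) (a : R) : dot x (a *: y) = a * dot x y.
Proof. by rewrite mulr_sumr; apply: eq_bigr => i _; rewrite !mxE mulrCA. Qed.

Lemma dotNr (x y : V) : dot x (- y) = - dot x y.
Proof. by rewrite -scaleN1r dotZr mulN1r. Qed.

Lemma dotBr (x y z : V) : dot x (y - z) = dot x y - dot x z.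
Proof. by rewrite dotDr dotNr. Qed.

Lemma dotDl (x y z : V) : dot (x + y) z = dot x z + dot y z.
Proof. by rewrite dotC dotDr !(dotC z). Qed.

Lemma dotZl (x y : V) (a : R) : dot (a *: x) y = a * dot x y.
Proof. by rewrite dotC dotZr dotC. Qed.

Lemma dotBl (x y z : V) : dot (x - y) z = dot x z - dot y z.
Proof. by rewrite dotC dotBr !(dotC z). Qed.

Variable f : V -> R.

Definition weakly_convex := forall (x y : V) (t : R), 0 <= t <= 1 ->
  f (t *: x + (1 - t) *: y) <= t * f x + (1 - t) * f y.

Lemma strictly_convexW : strictly_convex f -> weakly_convex.
Proof.
move=> cf x y t /andP[t0 t1].
have [->|xy] := eqVneq x y; first by rewrite -scalerDl -mulrDl addrC subrK scale1r mul1r.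
have [->|t0'] := eqVneq t 0; first by rewrite !scale0r !mul0r !add0r subr0 scale1r mul1r.
have [->|t1'] := eqVneq t 1; first by rewrite subrr !scale0r !mul0r !addr0 scale1r mul1r.
by apply/ltW/cf; rewrite ?lt_neqAle ?t0 ?t1 ?t1' ?[0 == t]eq_sym ?t0'.
Qed.

Hypothesis cf : weakly_convex.

(** Jensen for the uniform weights on [m] points, by induction on [m]. *)
Lemma jensen_mean m (w : 'I_m -> V) : (0 < m)%N ->
  f (m%:R^-1 *: \sum_i w i) <= m%:R^-1 * \sum_i f (w i).
Proof.
case: m w => // m w _; elim: m w => [|m ih] w.
  by rewrite !big_ord1 invr1 scale1r mul1r.
have m1 : m.+1%:R != 0 :> R by rewrite pnatr_eq0.
have m2 : m.+2%:R != 0 :> R by rewrite pnatr_eq0.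
have m2' : 0 < m.+2%:R :> R by rewrite ltr0n.
pose t : R := m.+2%:R^-1.
have t01 : 0 <= t <= 1.
  by rewrite invr_ge0 ltW//= invf_le1// ler1n.
have tE : 1 - t = m.+2%:R^-1 * m.+1%:R.
  by rewrite /t -[in RHS](addrK 1 m.+1%:R) natr1 mulrBr mulVf// mulr1.
rewrite big_ord_recl [X in _ <= _ * X]big_ord_recl.
have -> : m.+2%:R^-1 *: (w ord0 + \sum_(i < m.+1) w (lift ord0 i)) =
    t *: w ord0 + (1 - t) *: (m.+1%:R^-1 *: \sum_(i < m.+1) w (lift ord0 i)).
  by rewrite scalerDr tE scalerA mulfK.
apply: (le_trans (cf _ _ t01)); rewrite mulrDr lerD2l tE -mulrA.
apply: ler_wpM2l; first by rewrite invr_ge0 ltW.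
by rewrite -ler_pdivlMl ?ltr0n//; exact: ih.
Qed.

(** For a convex function partial derivatives at [x] are enough: Jensen over
    moves in the [n] coordinate directions bounds [f (x - t v)] by its linear
    part up to [o(t)], and [x] is the midpoint of [x - t v] and [x + t v], while
    [f (x + t v)] is bounded by the chord from [x] to [x']. *)
Lemma convex_subgradient (x x' : V) :
  (forall i, derivable f x (delta_mx 0 i)) ->
  f x + dot (grad f x) (x' - x) <= f x'.
Proof.
move=> df; have [n0|n0] := posnP n.
  have -> : x' = x by apply/rowP => i; have := ltn_ord i; rewrite {2}n0.
  by rewrite subrr /dot big1 ?addr0// => i _; rewrite [X in _ * X]mxE mulr0.
have nR : 0 < n%:R :> R by rewrite ltr0n.
set v := x' - x; set g := grad f x.
have xE : x' = x + v by rewrite addrC subrK.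
apply/ler_addgt0Pr => e' e'0.
pose e := e' / (l1norm v + 1).
have v1 : 0 < l1norm v + 1 by rewrite ltr_wpDl// sumr_ge0.
have e0 : 0 < e by rewrite divr_gt0.
have : \forall h \near (0 : R), forall i : 'I_n,
    `|f (h *: delta_mx 0 i + x) - f x - h * g 0 i| <= e * `|h|.
  apply: (@filter_forall _ _ (fun (i : 'I_n) (h : R) =>
    `|f (h *: delta_mx 0 i + x) - f x - h * g 0 i| <= e * `|h|) (nbhs (0 : R)) _) => i.
  have := df i; move/cvgrPdist_lt => /(_ _ e0); rewrite near_withinE.
  apply: filterS => h hP; have [->|h0] := eqVneq h 0.
    by rewrite scale0r add0r subrr sub0r mul0r oppr0 normr0 mulr0.
  move: (hP h0); rewrite -/(derive _ _ _) => /ltW.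
  rewrite -(ler_pM2r (x := `|h|)) ?normr_gt0// -normrM distrC mulrBl.
  rewrite [_ *: _ * h]mulrC mulrA mulfV// mul1r /g mxE [_ * h]mulrC.
  exact.
move=> /nbhs_ballP[d /= d0 dP].
pose N := n%:R * (l1norm v + 1).
have N0 : 0 < N by rewrite mulr_gt0.
(* small enough for the coordinate moves of length [n t |v_i|] to stay within
   the radius [d] where the linear approximation holds *)
pose t := Num.min 1 (d / (N + N)).
have t0 : 0 < t by rewrite lt_min ltr01 divr_gt0// addr_gt0.
have t1 : t <= 1 by rewrite ge_min lexx.
have tN : t * N < d.
  have : t <= d / (N + N) by rewrite ge_min lexx orbT.
  rewrite ler_pdivlMr ?addr_gt0// => h; apply: lt_le_trans h.
  by rewrite ltr_pM2l// ltrDl.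
have hi i : `|f (- (n%:R * t * v 0 i) *: delta_mx 0 i + x) - f x -
    - (n%:R * t * v 0 i) * g 0 i| <= e * (n%:R * t * `|v 0 i|).
  have vi : `|v 0 i| <= l1norm v.
    by rewrite /l1norm (bigD1 i)//= lerDl sumr_ge0.
  have := dP (- (n%:R * t * v 0 i)); rewrite /ball /= sub0r opprK.
  rewrite normrM (gtr0_norm (mulr_gt0 nR t0)) => /(_ _ i).
  rewrite normrN normrM (gtr0_norm (mulr_gt0 nR t0)); apply.
  apply: le_lt_trans tN; rewrite /N [leRHS]mulrCA [leRHS]mulrA.
  apply: ler_wpM2l; first by rewrite mulr_ge0// ltW.
  by rewrite (le_trans vi)// lerDl.
have Jn := jensen_mean (fun i => - (n%:R * t * v 0 i) *: delta_mx 0 i + x) n0.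
have meanE : n%:R^-1 *: \sum_i (- (n%:R * t * v 0 i) *: delta_mx 0 i + x) = x - t *: v.
  rewrite big_split /= sumr_const card_ord -[x *+ n]scaler_nat scalerDr.
  rewrite [X in _ + X]scalerA mulVf ?gt_eqF// scale1r addrC; congr (_ + _).
  rewrite scaler_sumr [in RHS](row_sum_delta v) scaler_sumr -sumrN.
  apply: eq_bigr => i _; rewrite scaleNr scalerN !scalerA; congr (- (_ *: _)).
  by rewrite mulrA mulrA mulVf ?gt_eqF// mul1r.
rewrite meanE in Jn.
have Jb : n%:R^-1 * \sum_i f (- (n%:R * t * v 0 i) *: delta_mx 0 i + x) <=
    f x - t * dot g v + e * t * l1norm v.
  rewrite -ler_pdivlMl ?invr_gt0// invrK.
  have -> : n%:R * (f x - t * dot g v + e * t * l1norm v) =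
     \sum_i (f x - (n%:R * t * v 0 i) * g 0 i + e * (n%:R * t * `|v 0 i|)).
    rewrite !big_split /= sumr_const card_ord mulrDr mulrDr -[f x *+ n]mulr_natl.
    congr (_ + _ + _).
      rewrite sumrN /dot mulr_sumr mulrN mulr_sumr; congr (- _).
      by apply: eq_bigr => i _; ring.
    by rewrite /l1norm !mulr_sumr; apply: eq_bigr => i _; ring.
  apply: ler_sum => i _; have := hi i; rewrite ler_norml => /andP[_]; lra.
have half : f x <= 2^-1 * f (x + t *: v) + (1 - 2^-1) * f (x - t *: v).
  have := cf (x + t *: v) (x - t *: v) (t := 2^-1).
  have -> : 2^-1 *: (x + t *: v) + (1 - 2^-1) *: (x - t *: v) = x.
    have -> : 1 - 2^-1 = 2^-1 :> R by lra.
    by rewrite -scalerDr addrACA subrr addr0 -mulr2n -[x *+ 2]scaler_nat scalerA mulVf ?scale1r.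
  by apply; lra.
have up : f (x + t *: v) <= t * f x' + (1 - t) * f x.
  have := cf x' x (t := t); rewrite xE scalerDr addrAC -scalerDl.
  by rewrite [t + _]addrC subrK scale1r; apply; rewrite (ltW t0).
have key : t * (f x + dot g v) <= t * (f x' + e * l1norm v) by nra.
rewrite ler_pM2l// in key; apply: (le_trans key); rewrite lerD2l.
by rewrite /e mulrAC ler_pdivrMr// ler_pM2l// lerDl.
Qed.

End convex.

Section bodies.
Variables (R : realType) (n : nat).
Local Notation V := 'rV[R]_n.
Local Notation T := (measurableTypeR R).

Lemma convex_setP (K : set V) : convex_set K <->
  forall (x y : V) (t : R), K x -> K y -> 0 <= t <= 1 -> K (t *: x + (1 - t) *: y).
Proof.
split=> [cK x y t Kx Ky /andP[t0 t1]|cK x y t].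
  by have := cK x y (Itv01 t0 t1); rewrite !inE; apply.
rewrite !inE => Kx Ky; apply: cK => //.
by apply/andP; split.
Qed.

(** The homothety with center [y] and ratio [t] maps a neighbourhood of [w]
    contained in [K] onto a neighbourhood contained in [K]. *)
Lemma interior_segment (K : set V) (w y : V) (t : R) : convex_set K ->
  K° w -> K y -> 0 < t <= 1 -> K° (t *: w + (1 - t) *: y).
Proof.
move=> /convex_setP cK /rV_nbhsP[e e0 eK] Ky /andP[t0 t1].
apply/rV_nbhsP; exists (t * e); first exact: mulr_gt0.
move=> z hz; have -> : z = t *: (t^-1 *: (z - (1 - t) *: y)) + (1 - t) *: y.
  by rewrite scalerA mulfV ?gt_eqF// scale1r subrK.
apply: cK => //; last by rewrite ltW.
apply: eK => i; have := hz i; rewrite !mxE.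
have -> : w 0 i - t^-1 * (z 0 i - (1 - t) * y 0 i) =
    t^-1 * (t * w 0 i + (1 - t) * y 0 i - z 0 i) by field; rewrite gt_eqF.
by rewrite normrM gtr0_norm ?invr_gt0// ltr_pdivrMl.
Qed.

Lemma compact_coord_bounded (K : set V) : compact K ->
  exists2 M : R, 0 < M & forall y i, K y -> `|y 0 i| <= M.
Proof.
move=> /compact_bounded [M [_ KM]]; exists (`|M| + 1) => [|y i Ky].
  by rewrite ltr_wpDl.
have := KM (`|M| + 1); rewrite (le_lt_trans (ler_norm _)) ?ltrDl// => /(_ isT y Ky).
apply: le_trans; rewrite [leRHS]mx_normrE.
exact: (le_bigmax _ (fun ij : 'I_1 * 'I_n => `|y ij.1 ij.2|) (0, i)).
Qed.

Lemma dot_le_l1norm (y x : V) (M : R) : (forall i, `|y 0 i| <= M) ->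
  `|dot y x| <= M * l1norm x.
Proof.
move=> yM; rewrite /dot /l1norm mulr_sumr (le_trans (ler_norm_sum _ _ _))//.
by apply: ler_sum => i _; rewrite normrM ler_wpM2r.
Qed.

Lemma dot_le_support (K : set V) x y : compact K -> K y ->
  dot y x <= support_fun K x.
Proof.
move=> /compact_coord_bounded[M M0 KM] Ky; apply: ub_le_sup; last by exists y.
exists (M * l1norm x) => _ [z Kz <-]; rewrite (le_trans (ler_norm _))//.
by apply: dot_le_l1norm => i; exact: KM.
Qed.

Lemma support_funE (K : set V) x y b : K y -> dot y x = b ->
  (forall z, K z -> dot z x <= b) -> support_fun K x = b.
Proof.
move=> Ky yb Kb; apply/eqP; rewrite eq_le; apply/andP; split.
  apply: ge_sup; first by exists (dot y x); exists y.
  by move=> _ [z Kz <-]; exact: Kb.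
rewrite -yb; apply: ub_le_sup; last by exists y.
by exists b => _ [z Kz <-]; exact: Kb.
Qed.

(** The support function dominates [dot z x] for the point [z] obtained from
    [y] by a move of [rho / 2] towards the signs of [x], and this move adds a
    multiple of the l^1 norm of [x]. *)
Lemma potential_growth (K : set V) (phi : V -> R) M (y : V) (rho : R) x :
  compact K -> (forall x, `|phi x - support_fun K x| <= M) -> 0 < rho ->
  (forall z : V, (forall i, `|y 0 i - z 0 i| < rho) -> K z) ->
  dot y x + rho / 2 * l1norm x - M <= phi x.
Proof.
move=> cK phiM rho0 yK.
(* the point of the cube around [y] that is extremal in the direction [x] *)
pose z : V := y + (rho / 2) *: (\row_i Num.sg (x 0 i)).
have Kz : K z.
  apply: yK => i; rewrite !mxE opprD addrA subrr sub0r normrN normrM.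
  rewrite gtr0_norm ?divr_gt0// (@le_lt_trans _ _ (rho / 2))//; last by lra.
  apply: ler_piMr; first by rewrite divr_ge0// ltW.
  by case: sgrP; rewrite ?normr0 ?normrN ?normr1.
have := dot_le_support x cK Kz; rewrite dotDl dotZl.
have -> : dot (\row_i Num.sg (x 0 i)) x = l1norm x.
  by apply: eq_bigr => i _; rewrite mxE normrEsg.
have := phiM x; rewrite ler_norml => /andP[+ _]; lra.
Qed.

Lemma lattice_ptsP (K : set V) k m : (0 < k)%N ->
  lattice_pts K k m <-> K° (k%:R^-1 *: real_pt R m).
Proof.
move=> k0; have k0' : 0 < k%:R :> R by rewrite ltr0n.
have kn0 : k%:R != 0 :> R by rewrite gt_eqF.
split=> /rV_nbhsP[e e0 eK]; apply/rV_nbhsP.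
  exists (k%:R^-1 * e); first by rewrite mulr_gt0 ?invr_gt0.
  move=> z hz; have [|w Kw wE] := eK (k%:R *: z).
    move=> i; have := hz i; rewrite ltr_pdivlMl// !mxE.
    by rewrite -[X in X * _ < _]gtr0_norm// -normrM mulrBr mulVKf.
  by rewrite -(scalerK kn0 z) -wE scalerK.
exists (k%:R * e); first by rewrite mulr_gt0.
move=> z hz; exists (k%:R^-1 *: z); last by rewrite scalerA mulfV// scale1r.
apply: eK => i; have := hz i; rewrite !mxE -mulrBr normrM gtr0_norm ?invr_gt0//.
by rewrite ltr_pdivrMl.
Qed.

(** For [m / k] in the interior of [K] the integrand decays exponentially, by
    [potential_growth]. *)
Lemma growth_lty (K : set V) (phi : V -> R) M k m : compact K ->
  continuous phi -> (forall x, `|phi x - support_fun K x| <= M) ->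
  (0 < k)%N -> lattice_pts K k m -> (growth phi k m < +oo)%E.
Proof.
move=> cK cphi phiM k0 /(lattice_ptsP _ _ k0) /rV_nbhsP[rho rho0 rhoK].
have k0' : 0 < k%:R :> R by rewrite ltr0n.
have d0 : 0 < k%:R * (rho / 2) by rewrite mulr_gt0// divr_gt0.
apply: (@le_lt_trans _ _ (\int[leb R n]_x ((expR (k%:R * M))%:E *
    (expR (- (k%:R * (rho / 2) * l1norm (vec x))))%:E))%E).
  apply: ge0_le_integral => //.
  - by apply/measurable_EFinP; exact: (measurable_growth k cphi m).
  - by apply: measurable_funeM; exact: measurable_expN_l1norm.
  - move=> x _; rewrite -EFinM lee_fin -expRD ler_expR.
    have := potential_growth (vec x) cK phiM rho0 rhoK.
    rewrite dotZl -(ler_pM2l k0') => h; apply: le_trans (_ : _ <= _) => //.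
    have : dot (real_pt R m) (vec x) = k%:R * (k%:R^-1 * dot (real_pt R m) (vec x)).
      by rewrite mulVKf// gt_eqF.
    lra.
rewrite ge0_integralZl//; last exact: measurable_expN_l1norm.
rewrite lte_mul_pinfty ?lee_fin ?expR_ge0//.
exact: integral_expN_l1norm_lty.
Qed.

Lemma finite_bounded_int (N : nat) :
  finite_set [set m : 'rV[int]_n | forall i, `|(m 0 i)%:~R : R| <= N%:R].
Proof.
pose F (g : {ffun 'I_n -> 'I_(N + N).+1}) : 'rV[int]_n :=
  \row_i ((g i : nat)%:Z - N%:Z).
apply: (@sub_finite_set _ _ (F @` [set: {ffun 'I_n -> 'I_(N + N).+1}])).
  move=> m mN; exists [ffun i : 'I_n => inord (absz (m 0 i + N%:Z)%R)] => //.
  apply/rowP => i; rewrite mxE ffunE.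
  have := mN i; rewrite ler_norml -[N%:R]/(N%:~R) -mulrNz !ler_int => /andP[h1 h2].
  have h3 : 0 <= m 0 i + N%:Z by lia.
  rewrite inordK; last by lia.
  by rewrite gez0_abs// addrK.
by apply: finite_image; exact: finite_finset.
Qed.

Lemma finite_lattice_pts (K : set V) k : compact K -> (0 < k)%N ->
  finite_set (lattice_pts K k).
Proof.
move=> /compact_coord_bounded[M M0 KM] k0.
have k0' : 0 < k%:R :> R by rewrite ltr0n.
pose N := (Num.truncn (k%:R * M)).+1.
apply: (sub_finite_set _ (finite_bounded_int N)) => m /(lattice_ptsP _ _ k0).
move=> /interior_subset Km i; have := KM _ i Km; rewrite !mxE normrM.
rewrite gtr0_norm ?invr_gt0// ler_pdivrMl// => /le_trans; apply.
exact/ltW/truncnS_gt.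
Qed.

Lemma cell_floor k (y : n.-tuple T) i :
  `|(cell k y 0 i)%:~R - k%:R * vec y 0 i| <= 1 :> R.
Proof.
rewrite !mxE; have := floor_itv (k%:R * tnth y i : R); rewrite intrD.
by move: (_%:~R) => a /andP[h1 h2]; rewrite ler_norml; apply/andP; split; lra.
Qed.

Lemma dot_cell k (y : n.-tuple T) (x : V) :
  `|dot (real_pt R (cell k y)) x - k%:R * dot (vec y) x| <= l1norm x.
Proof.
rewrite -dotZl -dotBl -[leRHS]mul1r; apply: dot_le_l1norm => i.
by rewrite !mxE; have := cell_floor k y i; rewrite !mxE.
Qed.

(** Laplace method. Let [m = cell k y]. The exponent [<m, z> - k phi z] differs
    from [k (<y, z> - phi z)] by at most the l^1 norm of [z]. Of the [k] copies
    of [<y, z> - phi z], all but [k0] are bounded by the maximum, attained at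
    [x]; the other [k0] decay linearly, fast enough to absorb that error and to
    leave an integrable function, the same for all [k]. *)
Lemma growth_cell_le (K : set V) (phi : V -> R) M (y : n.-tuple T) (x : V) :
  compact K -> continuous phi -> (forall x, `|phi x - support_fun K x| <= M) ->
  K° (vec y) -> (forall x', dot (vec y) x' - phi x' <= dot (vec y) x - phi x) ->
  exists k0 C, forall k, (k0 <= k)%N ->
   (growth phi k (cell k y) <= (expR (k%:R * (dot (vec y) x - phi x) + C))%:E)%E.
Proof.
move=> cK cphi phiM /rV_nbhsP[rho rho0 rhoK] ymax.
set phis := dot (vec y) x - phi x in ymax *.
(* [k0 rho / 2 > 2]: one unit pays for the rounding of [k y], the other one
   leaves [- l1norm z] in the exponent. *)
pose k0 := (Num.truncn (4 / rho)).+1.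
have k0rho : 4 < k0%:R * rho.
  by rewrite -ltr_pdivrMr//; exact: truncnS_gt.
pose I := (\int[leb R n]_x (expR (- (1 * l1norm (vec x))))%:E)%E.
have Ioo : (I < +oo)%E := integral_expN_l1norm_lty n ltr01.
have I0 : (0 <= I)%E by apply: integral_ge0 => z _; rewrite lee_fin expR_ge0.
pose C := - (k0%:R * phis) + k0%:R * M + (fine I).
exists k0, C => k kk0.
apply: (@le_trans _ _ (\int[leb R n]_x
   ((expR (k%:R * phis - k0%:R * phis + k0%:R * M))%:E *
    (expR (- (1 * l1norm (vec x))))%:E))%E).
  apply: ge0_le_integral => //.
  - by apply/measurable_EFinP; exact: (measurable_growth k cphi _).
  - by apply: measurable_funeM; exact: measurable_expN_l1norm.
  - move=> z _; rewrite -EFinM lee_fin -expRD ler_expR.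
    have h1 := potential_growth (vec z) cK phiM rho0 rhoK.
    have := dot_cell k y (vec z); rewrite ler_norml => /andP[_ h2].
    have l0 : 0 <= l1norm (vec z) by exact: sumr_ge0.
    have h3 := ymax (vec z).
    have kk : (0 : R) <= k%:R - k0%:R by rewrite subr_ge0 ler_nat.
    have h4 : (k%:R - k0%:R) * (dot (vec y) (vec z) - phi (vec z)) <=
       (k%:R - k0%:R) * phis by rewrite ler_wpM2l.
    have h5 : k0%:R * (dot (vec y) (vec z) - phi (vec z)) <=
       k0%:R * (M - rho / 2 * l1norm (vec z)) by apply: ler_wpM2l => //; lra.
    have h6 : 4 * l1norm (vec z) <= k0%:R * rho * l1norm (vec z).
      by rewrite ler_wpM2r// ltW.
    nra.
rewrite ge0_integralZl//; last exact: measurable_expN_l1norm.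
rewrite -/I -(@fineK _ I) ?ge0_fin_numE// -EFinM lee_fin.
have -> : k%:R * phis + C = (k%:R * phis - k0%:R * phis + k0%:R * M) + fine I.
  by rewrite /C; ring.
rewrite [leRHS]expRD; apply: ler_wpM2l; first exact: expR_ge0.
by apply: le_trans (expR_ge1Dx _); rewrite lerDr.
Qed.

End bodies.

(** * The limit ray controls the weights *)

Section limit.
Variables (R : realType) (n : nat).
Local Notation V := 'rV[R]_n.
Local Notation C := R[i].
Local Notation Cn := 'rV[C]_n.
Local Notation T := (measurableTypeR R).

Lemma locally_uniform_pointwise (S : topologicalType) (D : set S)
    (f_ : nat -> S -> R) (f : S -> R) (p : S) :
  locally_uniform_cvg D f_ f -> D p -> f_ i p @[i --> \oo] --> f p.
Proof.
move=> fD Dp; have [U Up fU] := fD p Dp.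
have UDp : (U `&` D) p by split=> //; exact: nbhs_singleton.
have sub : [set p] `<=` U `&` D by move=> _ ->.
have h := uniform_subset_cvg _ sub fU; rewrite uniform_set1 in h.
exact: h.
Qed.

(** [cell k y / k] tends to [y], an interior point. *)
Lemma cell_cvg_interior (K : set V) (k_ : nat -> nat) (y : n.-tuple T) :
  (forall i, (1 <= k_ i)%N) -> k_ @ \oo --> \oo -> K° (vec y) ->
  \forall i \near \oo, lattice_pts K (k_ i) (cell (k_ i) y).
Proof.
move=> k1 koo Ky.
have /rV_nbhsP[e e0 eK] : nbhs (vec y) K°.
  by apply: open_nbhs_nbhs; split=> //; exact: open_interior.
have [k0 k00 ke] := @small_cell R e e0.
have : \forall i \near \oo, (k0 <= k_ i)%N.
  by apply: (koo [set k | (k0 <= k)%N]); exists k0.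
apply: filterS => i ki; apply/lattice_ptsP; first exact: k1.
apply: eK => l; rewrite [X in _ - X]mxE.
have ki0 : 0 < (k_ i)%:R :> R by rewrite ltr0n; exact: k1.
have -> : vec y 0 l - (k_ i)%:R^-1 * real_pt R (cell (k_ i) y) 0 l =
    - ((k_ i)%:R^-1 * ((cell (k_ i) y 0 l)%:~R - (k_ i)%:R * vec y 0 l)).
  by rewrite [real_pt _ _ _ _]mxE mulrBr mulKf ?gt_eqF// opprB.
rewrite normrN normrM gtr0_norm ?invr_gt0// ltr_pdivrMl//.
apply: le_lt_trans (cell_floor _ _ _) _.
rewrite -ltr_pdivrMl// mulr1; apply: le_lt_trans ke.
by rewrite lef_pV2 ?posrE ?ltr0n// ler_nat.
Qed.

(** The term of [m = cell k y] is at most the whole sum, and its logarithm is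
    [<m, x + c> - log |z^m|^2 + q]. By [growth_cell_le] this is at least
    [k (<y, c> + phi x) + q - O(1)]. Comparing with the limit [phi x + n] of the
    ray leaves [q <= k ell(y) + o(k)]. *)
Lemma eventually_small_weight (K : set V) (phi : V -> R) M
    (q : nat -> 'rV[int]_n -> nat) (k_ : nat -> nat) (y : n.-tuple T)
    (x c : V) (s : R) :
  compact K -> continuous phi -> (forall x, `|phi x - support_fun K x| <= M) ->
  K° (vec y) -> (forall x', dot (vec y) x' - phi x' <= dot (vec y) x - phi x) ->
  (forall i, (1 <= k_ i)%N) -> k_ @ \oo --> \oo ->
  monomial_ray K phi q (k_ i) 1 (torus_pt (x + c) 0) @[i --> \oo] -->
    phi x + n%:R ->
  ell c (vec y) < s ->
  \forall i \near \oo, lattice_pts K (k_ i) (cell (k_ i) y) /\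
    (q (k_ i) (cell (k_ i) y))%:R < (k_ i)%:R * s.
Proof.
move=> cK cphi phiM Ky ymax k1 koo ucvg ls.
have [k0 [C0 gC]] := growth_cell_le cK cphi phiM Ky ymax.
pose X := x + c.
(* half of the gap is spent on the convergence of the ray, the other half on
   the terms that do not grow with [k], for [k >= N] *)
pose e := (s - ell c (vec y)) / 2.
have e0 : 0 < e by rewrite divr_gt0// subr_gt0.
pose N := (Num.truncn ((l1norm X + C0) / e)).+1.
have NE : (l1norm X + C0) < N%:R * e by rewrite -ltr_pdivrMr//; exact: truncnS_gt.
have lat := cell_cvg_interior k1 koo Ky.
have kbig : \forall i \near \oo, (k0 + N <= k_ i)%N.
  by apply: (koo [set k | (k0 + N <= k)%N]); exists (k0 + N)%N.
have uu : \forall i \near \oo, monomial_ray K phi q (k_ i) 1 (torus_pt X 0) <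
    phi x + n%:R + e.
  by apply: (cvgr_lt _ ucvg); rewrite ltrDl.
near=> i.
have ilat : lattice_pts K (k_ i) (cell (k_ i) y) by near: i.
split=> //.
have ki : (k0 + N <= k_ i)%N by near: i.
have ui : monomial_ray K phi q (k_ i) 1 (torus_pt X 0) < phi x + n%:R + e by near: i.
move: (k_ i) (k1 i) ilat ki ui => k kpos ilat ki; set m := cell k y in ilat *.
have k0' : 0 < k%:R :> R by rewrite ltr0n.
have glty := growth_lty cK cphi phiM kpos ilat.
have ggt := growth_gt0 k cphi m.
have gk : fine (growth phi k m) <= expR (k%:R * (dot (vec y) x - phi x) + C0).
  rewrite -lee_fin fineK ?ge0_fin_numE ?growth_ge0//.
  by apply: gC; exact: leq_trans (leq_addr _ _) ki.
set G := fine _ in gk.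
have G0 : 0 < G by rewrite fine_gt0// ggt.
have termE : cabs2 (sect phi k m (torus_pt X 0)) * expR (1 * (q k m)%:R) =
    expR (dot (real_pt R m) X) / G * expR (1 * (q k m)%:R).
  congr (_ * _); rewrite sectE cabs2M laurentE; last exact: torus_pt_torus.
  rewrite monomial_torus_pt cabs2_cexp mulr2n -splitr mulrC; congr (_ * _).
  rewrite /cabs2 /= expr0n addr0 exprVn; congr (_^-1).
  by rewrite /hnorm L2sq_laurent// sqr_sqrtr// fine_ge0// growth_ge0.
have sumge : expR (dot (real_pt R m) X) / G * expR (1 * (q k m)%:R) <=
   \sum_(m \in lattice_pts K k) cabs2 (sect phi k m (torus_pt X 0)) * expR (1 * (q k m)%:R).
  rewrite -termE (fsbigD1 m)//; last exact: finite_lattice_pts.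
  by rewrite lerDl fsumr_ge0// => j _; rewrite mulr_ge0 ?cabs2_ge0 ?expR_ge0.
rewrite /monomial_ray => ui.
have t0 : 0 < expR (dot (real_pt R m) X) / G * expR (1 * (q k m)%:R).
  by rewrite mulr_gt0 ?divr_gt0 ?expR_gt0.
have lnge : dot (real_pt R m) X - ln G + (q k m)%:R <= k%:R * (phi x + n%:R + e).
  rewrite -ler_pdivrMl//; apply: le_trans (ltW ui).
  rewrite ler_pM2l ?invr_gt0//.
  have -> : dot (real_pt R m) X - ln G + (q k m)%:R =
      ln (expR (dot (real_pt R m) X) / G * expR (1 * (q k m)%:R)).
    rewrite lnM ?posrE ?expR_gt0 ?divr_gt0 ?expR_gt0//.
    by rewrite ln_div ?posrE ?expR_gt0// !expRK mul1r.
  by rewrite ler_ln// posrE// (lt_le_trans t0).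
have lnG : ln G <= k%:R * (dot (vec y) x - phi x) + C0.
  by rewrite -[leRHS]expRK ler_ln ?posrE ?expR_gt0.
have := dot_cell k y X; rewrite ler_norml => /andP[dc _].
have dX : dot (vec y) X = dot (vec y) x + dot (vec y) c by rewrite dotDr.
have NE' : l1norm X + C0 < k%:R * e.
  apply: lt_le_trans NE _; rewrite ler_pM2r// ler_nat.
  exact: leq_trans (leq_addl _ _) ki.
have lE : ell c (vec y) = n%:R - dot (vec y) c by rewrite /ell dotC.
have sE : s = ell c (vec y) + e + e by rewrite /e; field.
rewrite sE lE -/m in dc *; rewrite dX in dc; nra.
Unshelve. all: by end_near. Qed.

End limit.

(** * From counting lattice points to volumes *)

Section volume.
Variables (R : realType) (n : nat).
Local Notation V := 'rV[R]_n.
Local Notation T := (measurableTypeR R).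

Lemma cells_measurable k (G : set 'rV[int]_n) : measurable (@cell R n k @^-1` G).
Proof.
rewrite (_ : _ @^-1` _ = \bigcup_m (if `[< G m >] then @cell R n k @^-1` [set m] else set0)).
  apply: countable_bigcupT_measurable => // m; case: ifP => // _.
  exact: cell_measurable.
apply/seteqP; split=> [y Gy|y [m _]].
  by exists (cell k y) => //; rewrite asboolT.
by case: asboolP => // Gm /= ym; rewrite ym.
Qed.

(** The bound on the number of elements of [G] is expressed through injective
    families, the form in which [weight_count] provides it. *)
Lemma cells_leb_le k (G : set 'rV[int]_n) N : (0 < k)%N -> finite_set G ->
  (forall w (e : 'I_w -> 'rV[int]_n), injective e -> (forall l, G (e l)) -> (w <= N)%N) ->
  (leb R n (@cell R n k @^-1` G) <= (N%:R * k%:R ^- n)%:E)%E.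
Proof.
move=> k0 /finite_seqP[r0 G0] GN; pose r := undup r0.
have rG m : m \in r <-> G m by rewrite mem_undup G0.
have rN : (size r <= N)%N.
  apply: (GN _ (fun l : 'I_(size r) => nth 0 r l)) => [l l'|l].
    by move/eqP; rewrite nth_uniq ?undup_uniq// => /eqP; exact: val_inj.
  by apply/rG; exact: mem_nth (ltn_ord l).
have -> : @cell R n k @^-1` G = \big[setU/set0]_(m <- r) (@cell R n k @^-1` [set m]).
  rewrite -bigcup_seq; apply/seteqP; split=> [y Gy|y [m mr /= ym]].
    by exists (cell k y) => //=; apply/rG.
  by rewrite /= ym; apply/rG.
apply: (@le_trans _ _ (\sum_(m <- r) leb R n (@cell R n k @^-1` [set m]))%E).
  elim: r {rG rN} => [|m r ih]; first by rewrite !big_nil measure0.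
  rewrite !big_cons; apply: le_trans (measureU2 _ _ _) _.
  - exact: cell_measurable.
  - by apply: bigsetU_measurable => m' _; exact: cell_measurable.
  - exact: leeD2l.
rewrite (eq_bigr (fun=> (k%:R ^- n)%:E)); last by move=> m _; exact: cell_leb.
rewrite sumEFin lee_fin big_const_seq count_predT iter_addr addr0.
rewrite -[_ *+ size r]mulr_natl; apply: ler_wpM2r; last by rewrite ler_nat.
by rewrite invr_ge0 exprn_ge0.
Qed.

(** The set of points whose cell belongs to [G i] for all [i >= j] has measure
    at most [b i] for each [i >= j], hence at most [L]; these sets increase with
    [j] and cover [U]. *)
Lemma limit_volume (U : set V) (k_ : nat -> nat) (G : nat -> set 'rV[int]_n)
    (N : nat -> nat) (b : nat -> R) (L : R) :
  measurable (@vec R n @^-1` U) -> (forall i, (1 <= k_ i)%N) ->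
  (forall i, finite_set (G i)) ->
  (forall i w (e : 'I_w -> 'rV[int]_n), injective e -> (forall l, G i (e l)) ->
    (w <= N i)%N) ->
  (forall i, (N i)%:R * (k_ i)%:R ^- n <= b i) -> b @ \oo --> L ->
  (forall y, U (vec y) -> \forall i \near \oo, G i (cell (k_ i) y)) ->
  (vol U <= L%:E)%E.
Proof.
move=> mU k1 fG GN Nb bL UG.
pose B j := \bigcap_(i in [set i | (j <= i)%N]) (@cell R n (k_ i) @^-1` G i).
have mB j : measurable (B j).
  by apply: bigcap_measurableType => i _; exact: cells_measurable.
have BL j : (leb R n (B j) <= L%:E)%E.
  have Bb i : (j <= i)%N -> (leb R n (B j) <= (b i)%:E)%E.
    move=> ji; apply: (@le_trans _ _ (leb R n (@cell R n (k_ i) @^-1` G i))).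
      apply: le_measure; rewrite ?inE//; first exact: cells_measurable.
      by move=> y; apply.
    by apply: le_trans (cells_leb_le (k1 i) (fG i) (GN i)) _; rewrite lee_fin.
  have Bfin : leb R n (B j) \is a fin_num.
    by rewrite ge0_fin_numE// (le_lt_trans (Bb j (leqnn j)))// ltry.
  rewrite -(fineK Bfin) lee_fin; apply: (cvgr_to_ge bL).
  by exists j => // i /= ji; rewrite -lee_fin fineK// Bb.
have ndB : {homo B : a b / (a <= b)%N >-> (a <= b)%O}.
  move=> a a' aa'; apply/subsetPset => y By i /= ai; apply: By.
  exact: leq_trans aa' ai.
have := @nondecreasing_cvg_mu _ _ _ (leb R n) B mB (bigcupT_measurable _ mB) ndB.
move=> Bcvg; apply: (@le_trans _ _ (leb R n (\bigcup_j B j))).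
  have sub : @vec R n @^-1` U `<=` \bigcup_j B j.
    by move=> y /UG [j _ jG]; exists j => // i /= ji; exact: jG.
  have mUB : measurable (\bigcup_j B j) by exact: bigcupT_measurable.
  by rewrite /vol; apply: le_measure => //; rewrite inE.
have <- := cvg_lim (@ereal_hausdorff R) Bcvg.
apply: lime_le; first by apply/cvg_ex; eexists; exact: Bcvg.
by apply: nearW => j; exact: BL.
Qed.

End volume.

Section sublevel.
Variables (R : realType) (n : nat).
Local Notation V := 'rV[R]_n.
Local Notation T := (measurableTypeR R).
Variables (K : set V) (phi : V -> R) (c : V).
Hypothesis Kbody : convex_body K.
Hypothesis hphi : BB13_potential K phi.

Lemma potential_continuous : continuous phi.
Proof. by move=> x; have [/(_ [::] x I)[]] := hphi. Qed.

Lemma potential_subgradient x x' : phi x + dot (grad phi x) (x' - x) <= phi x'.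
Proof.
have [sm sc _ _ _] := hphi.
apply: convex_subgradient; first exact: strictly_convexW.
by move=> i; have [_] := sm [::] x I; apply.
Qed.

Lemma gradient_onto y : K° y -> exists x, grad phi x = y.
Proof.
have [_ _ [_ _ [h [_ _ hK]]] _ _] := hphi => Ky.
by exists (h y); apply: hK; rewrite inE.
Qed.

Lemma compactK : compact K. Proof. by case: Kbody. Qed.
Lemma convexK : convex_set K. Proof. by case: Kbody. Qed.

Lemma ell_continuous : continuous (ell c).
Proof.
move=> y; apply: (@continuousB _ _ _ (cst (n%:R : R)) (dot c)).
  exact: cst_continuous.
exact: dot_continuous.
Qed.

Lemma ellE (y z : V) (t : R) :
  ell c (t *: y + (1 - t) *: z) = t * ell c y + (1 - t) * ell c z.
Proof. by rewrite /ell !(dotC c) dotDl !dotZl; ring. Qed.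

(** A closed half space that contains the interior of a convex body contains the
    body; [g] is an affine function, given by its behaviour on segments. *)
Lemma interior_dense (g : V -> R) (a : R) y :
  (forall x, K° x -> g x <= a) -> K y ->
  (forall x z t, g (t *: x + (1 - t) *: z) = t * g x + (1 - t) * g z) ->
  g y <= a.
Proof.
move=> ga Ky gE; have [_ _ [w Kw]] := Kbody.
rewrite leNgt; apply/negP => ay.
(* [t = (g y - a) / (2 D)] is a step from [y] towards [w] so short that [g]
   stays above [a] *)
pose D := `|g w - g y| + (g y - a).
have gya : 0 < g y - a by rewrite subr_gt0.
have D0 : 0 < D by rewrite ltr_wpDl.
pose t := (g y - a) / (2 * D).
have t0 : 0 < t by rewrite divr_gt0// mulr_gt0.
have tD : t * (2 * D) = g y - a by rewrite /t divfK// gt_eqF// mulr_gt0.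
have N0 := normr_ge0 (g w - g y).
have t1 : t <= 1.
  rewrite ler_pdivrMr ?mulr_gt0// mul1r /D; lra.
have := ga _ (interior_segment convexK Kw Ky (t := t) _); rewrite t0 t1 => /(_ isT).
rewrite gE; have := ler_norm (g y - g w); rewrite distrC => h.
have : t * (g y - g w) <= t * `|g w - g y| by rewrite ler_pM2l.
have : t * `|g w - g y| <= t * D by rewrite ler_pM2l// lerDl ltW.
nra.
Qed.

(** Evaluate the bounds on [phi (x - c) - phi x + n] where the gradient of
    [phi] at [x], or at [x - c], is a given point of the interior. The
    subgradient inequality between [x] and [x - c] turns each of them into a
    bound on [ell]. *)
Lemma ell_bounds y :
  (forall x, 0 <= phi (x - c) + n%:R - phi x <= n.+1%:R) -> K y ->
  0 <= ell c y <= n.+1%:R.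
Proof.
move=> H Ky; apply/andP; split.
  rewrite -oppr_le0; apply: (@interior_dense (fun z => - ell c z)) => //.
    move=> z /gradient_onto[x xz]; have /andP[h _] := H (x + c).
    move: h; rewrite addrK => h.
    have := potential_subgradient x (x + c).
    rewrite [x + c]addrC addrK xz /ell dotC in h *; lra.
  by move=> x z t; rewrite ellE; ring.
apply: (@interior_dense (ell c)) => //; last by move=> *; exact: ellE.
move=> z /gradient_onto[x xz]; have /andP[_ h] := H x.
have := potential_subgradient x (x - c).
rewrite addrAC subrr add0r dotNr xz /ell (dotC c) -natr1; move: h; rewrite -natr1.
lra.
Qed.

Lemma bin_le_exp (a m : nat) : 'C(a, m)%:R <= a%:R ^+ m / m`!%:R :> R.
Proof.
rewrite ler_pdivlMr ?ltr0n ?fact_gt0// -natrM -natrX ler_nat bin_ffact.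
elim: m a => [|m ih] [|a]; rewrite ?ffactn0 ?ffact0n ?expn0//.
rewrite ffactSS expnS leq_mul// (leq_trans (ih a))//.
by case: m {ih} => // m; rewrite leq_exp2r.
Qed.

(** Each point [y] with [ell c y < s] eventually lies in a cell whose label has
    weight less than [k s]; there are at most ['C(n + J, n)] such labels, [J]
    being the integer part of [k s], each carrying a cell of volume [k ^- n]. *)
Lemma sublevel_volume (v : V) (k_ : nat -> nat) (q : nat -> 'rV[int]_n -> nat)
    (s : R) :
  toric_weights K phi v q -> (forall i, (1 <= k_ i)%N) -> k_ @ \oo --> \oo ->
  (forall x, monomial_ray K phi q (k_ i) 1 (torus_pt (x + c) 0) @[i --> \oo] -->
    phi x + n%:R) ->
  0 < s < n.+1%:R ->
  (vol (K° `&` [set y | (ell c y < s)%R]) <= (s ^+ n / n`!%:R)%:E)%E.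
Proof.
move=> tw k1 koo uc /andP[s0 sn].
have [_ _ _ _ [M phiM]] := hphi.
pose G i := lattice_pts K (k_ i) `&` [set m | (q (k_ i) m)%:R < (k_ i)%:R * s].
pose J i := Num.truncn ((k_ i)%:R * s).
have J0 i : 0 <= (k_ i)%:R * s by rewrite mulr_ge0// ltW.
have ki0 i : 0 < (k_ i)%:R :> R by rewrite ltr0n; exact: k1.
have Jle i : (J i)%:R <= (k_ i)%:R * s by have /andP[] := truncn_itv (J0 i).
apply: (@limit_volume _ _ _ k_ G (fun i => 'C(n + J i, n))
  (fun i => (s + n%:R / (k_ i)%:R) ^+ n / n`!%:R)) => //.
- apply: open_vec_measurable; apply: openI; first exact: open_interior.
  apply: (@open_comp _ _ (ell c) [set r | r < s]); last exact: open_lt.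
  by move=> y _; exact: ell_continuous.
- move=> i; apply: sub_finite_set (finite_lattice_pts compactK (k1 i)).
  by move=> m [].
- move=> i w e inje eG.
  have [_ cv] := tw (k_ i) (k1 i).
  apply: (weight_count potential_continuous _ cv _ inje).
  + rewrite -(ltr_nat R); apply: le_lt_trans (Jle i) _.
    by rewrite natrM mulrC ltr_pM2r.
  + by move=> m; exact: (growth_lty compactK potential_continuous phiM (k1 i)).
  + move=> l; have [lm lq] := eG l; split => //.
    by rewrite truncn_ge_nat//; exact: ltW.
- move=> i; apply: le_trans (_ : ((n + J i)%:R ^+ n / n`!%:R) * (k_ i)%:R ^- n <= _).
    apply: ler_wpM2r; first by rewrite invr_ge0 exprn_ge0// ltW.
    exact: bin_le_exp.
  have A0 : 0 <= (n + J i)%:R / (k_ i)%:R :> R by rewrite divr_ge0.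
  have AB : (n + J i)%:R / (k_ i)%:R <= s + n%:R / (k_ i)%:R.
    rewrite ler_pdivrMr// mulrDl divfK ?gt_eqF// natrD addrC lerD2r.
    by rewrite mulrC.
  rewrite mulrAC -expr_div_n; apply: ler_wpM2r; first by rewrite invr_ge0.
  by apply: lerXn2r => //; rewrite nnegrE//; exact: le_trans A0 AB.
- have c1 : (s + n%:R / (k_ i)%:R) @[i --> \oo] --> s.
    apply/cvgrPdist_lt => e e0.
    have e1 : 0 < e / n.+1%:R by rewrite divr_gt0.
    have [k0 k00 ke] := small_cell e1.
    have : \forall i \near \oo, (k0 <= k_ i)%N.
      by apply: (koo [set k | (k0 <= k)%N]); exists k0.
    apply: filterS => i ki; rewrite opprD addrA subrr sub0r normrN.
    rewrite ger0_norm ?divr_ge0 ?(ltW (ki0 i))//.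
    have kk : (k_ i)%:R^-1 <= k0%:R^-1 :> R by rewrite lef_pV2 ?posrE ?ltr0n// ler_nat.
    apply: (@le_lt_trans _ _ (n.+1%:R * (k_ i)%:R^-1)).
      by rewrite ler_wpM2r ?invr_ge0 ?ler_nat// ltW.
    rewrite mulrC -ltr_pdivlMr//; exact: le_lt_trans ke.
  have c2 : (s + n%:R / (k_ i)%:R) ^+ n @[i --> \oo] --> s ^+ n.
    apply: (@cvg_comp _ _ _ (fun i => s + n%:R / (k_ i)%:R) (fun r : R => r ^+ n)
      \oo (nbhs s)) => //; exact: exprn_continuous.
  by apply: cvgM c2 _; exact: cvg_cst.
- move=> y [Ky ys]; have [x xy] := gradient_onto Ky.
  apply: (eventually_small_weight compactK potential_continuous phiM Ky _ k1 koo (uc x)) => //.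
  move=> x'; have := potential_subgradient x x'.
  by rewrite xy dotBr; lra.
Qed.

End sublevel.

(** * Rigidity of bodies with small caps *)

Section rigidity.
Variables (R : realType) (n : nat).
Local Notation V := 'rV[R]_n.
Local Notation T := (measurableTypeR R).
Variables (K : set V) (c : V).
Hypothesis n0 : (0 < n)%N.
Hypothesis Kbody : convex_body K.
Hypothesis Kbary : barycenter K = 0.
Hypothesis Kvol : vol K = (n.+1%:R ^+ n / n`!%:R)%:E.
Hypothesis ellK : forall y, K y -> 0 <= ell c y <= n.+1%:R.
Hypothesis sublevel_le : forall s, 0 < s < n.+1%:R ->
  (vol (K° `&` [set y | (ell c y < s)%R]) <= (s ^+ n / n`!%:R)%:E)%E.

Let n1 : 0 < n.+1%:R :> R. Proof. by rewrite ltr0n. Qed.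
Let nf : 0 < n`!%:R :> R. Proof. by rewrite ltr0n fact_gt0. Qed.

Let closedK : closed K.
Proof. by apply: compact_closed; [exact: norm_hausdorff|exact: compactK]. Qed.

Let mK : measurable (@vec R n @^-1` K).
Proof. exact: closed_vec_measurable closedK. Qed.

Let Kint : exists w, K° w. Proof. by case: Kbody. Qed.

Let closed_homothety (p : V) (r : R) : closed [set p + r *: (y - p) | y in K].
Proof.
apply: compact_closed; first exact: norm_hausdorff.
apply: continuous_compact; last exact: compactK.
have cont : continuous (fun y : V => p + r *: (y - p)).
  move=> y; apply: (@cvgD _ _ _ (nbhs y) _ (cst p) (fun y : V => r *: (y - p)));
    first exact: cvg_cst.
  apply: cvgZl_tmp; apply: (@cvgB _ _ _ (nbhs y) _ id (cst p)); first exact: cvg_id.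
  exact: cvg_cst.
exact: continuous_subspaceT cont.
Qed.

Let measurable_homothety (p : V) (r : R) :
  measurable (@vec R n @^-1` [set p + r *: (y - p) | y in K]).
Proof. exact: closed_vec_measurable (@closed_homothety p r). Qed.

Lemma closed_cap s : closed (cap K c s).
Proof.
rewrite (_ : cap K c s = K `&` ell c @^-1` [set r | r <= s]).
  apply: closedI => //; apply: closed_comp; last exact: closed_le.
  by move=> y _; exact: ell_continuous.
by apply/seteqP; split.
Qed.

Lemma measurable_cap s : measurable (@vec R n @^-1` cap K c s).
Proof. exact: closed_vec_measurable (@closed_cap s). Qed.

Lemma convex_cap s : convex_set (cap K c s).
Proof.
apply/convex_setP => x y t [Kx xs] [Ky ys] t01; split.
  by move/convex_setP: (convexK Kbody) => cK; exact: cK.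
rewrite ellE; case/andP: t01 => t0 t1.
have := ler_wpM2l t0 xs; have : (1 - t) * ell c y <= (1 - t) * s.
  by rewrite ler_wpM2l// subr_ge0.
lra.
Qed.

(** For [r < 1] the interior of [K] contains a copy of [K] shrunk by [r] about
    an interior point, of volume [r ^ n vol K]; let [r] tend to [1]. *)
Lemma boundary_null : leb R n (@vec R n @^-1` (K `\` K°)) = 0%E.
Proof.
have [w Kw] := Kint.
have mKi : measurable (@vec R n @^-1` K°) by apply: open_vec_measurable; exact: open_interior.
have Ki_le : (vol K° <= vol K)%E.
  by apply: le_measure; rewrite ?inE// => y; exact: interior_subset.
have Kfin : vol K \is a fin_num by rewrite Kvol.
have Kifin : vol K° \is a fin_num.
  by rewrite ge0_fin_numE// (le_lt_trans Ki_le)// -ge0_fin_numE.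
have hom r : 0 < r < 1 -> r ^+ n * fine (vol K) <= fine (vol K°).
  move=> /andP[r0 r1]; rewrite -lee_fin EFinM !fineK//.
  rewrite -(vol_homothety w r0 mK); apply: le_measure; rewrite ?inE//.
  move=> y /= [z Kz <-].
  have := interior_segment (convexK Kbody) Kw Kz (t := 1 - r).
  rewrite subKr scalerBl scale1r scalerBr addrA addrAC; apply.
  by rewrite subr_gt0 r1 gerBl ltW.
have Kle : fine (vol K) <= fine (vol K°).
  have cv : (1 - t) ^+ n * fine (vol K) @[t --> (0 : R)^'+] --> (1 - 0) ^+ n * fine (vol K).
    have cp : (1 - t) ^+ n @[t --> (0 : R)] --> (1 - 0 : R) ^+ n.
      apply: (@cvg_comp _ _ _ (fun t : R => 1 - t) (fun r : R => r ^+ n)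
        (nbhs (0 : R)) (nbhs (1 - 0 : R))); last exact: exprn_continuous.
      by apply: cvgB; [exact: cvg_cst|exact: cvg_id].
    by apply: cvg_at_right_filter; apply: cvgM cp _; exact: cvg_cst.
  rewrite subr0 expr1n mul1r in cv; apply: (cvgr_to_le cv).
  near=> t; apply: hom; apply/andP; split; last first.
    by rewrite ltrBlDr ltrDl; near: t; exact: nbhs_right_gt.
  by rewrite subr_gt0; near: t; exact: nbhs_right_lt.
rewrite (_ : _ @^-1` _ = (@vec R n @^-1` K) `\` (@vec R n @^-1` K°))// measureD//; last by rewrite -ge0_fin_numE.
rewrite (_ : _ `&` _ = @vec R n @^-1` K°); last first.
  by apply/seteqP; split=> [y []//|y Ky]; split => //; exact: interior_subset.
transitivity (vol K - vol K°)%E; first by [].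
rewrite -(fineK Kfin) -(fineK Kifin) -EFinB.
congr (_%:E); apply/eqP; rewrite subr_eq0 eq_le Kle /=.
by rewrite -lee_fin !fineK.
Unshelve. all: by end_near. Qed.

(** Closed caps from open sublevel sets: let the level decrease to [s], and
    add the boundary of [K], a null set. *)
Lemma cap_vol_le s : 0 <= s <= n.+1%:R ->
  (vol (cap K c s) <= (s ^+ n / n`!%:R)%:E)%E.
Proof.
move=> /andP[s0]; rewrite le_eqVlt => /predU1P[->|sn].
  rewrite -Kvol; apply: le_measure; rewrite ?inE//; first exact: measurable_cap.
  by move=> y [].
have capE s' : s < s' -> s' < n.+1%:R -> (vol (cap K c s) <= (s' ^+ n / n`!%:R)%:E)%E.
  move=> ss' s'n; apply: le_trans (sublevel_le _); last by rewrite (le_lt_trans s0 ss').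
  have mi : measurable (@vec R n @^-1` (K° `&` [set y | ell c y < s'])).
    apply: open_vec_measurable; apply: openI; first exact: open_interior.
    apply: (@open_comp _ _ (ell c) [set r | r < s']); last exact: open_lt.
    by move=> y _; exact: ell_continuous.
  have mb : measurable (@vec R n @^-1` (K `\` K°)).
    apply: measurableD => //; exact: (@open_vec_measurable R n _ (@open_interior _ K)).
  apply: (@le_trans _ _ (leb R n ((@vec R n @^-1` (K `\` K°)) `|`
     (@vec R n @^-1` (K° `&` [set y | ell c y < s']))))).
    apply: le_measure; rewrite ?inE//; [exact: measurable_cap|exact: measurableU|].
    move=> y [Ky ys]; have [Ki|Ki] := pselect (K° (vec y)); last by left.
    by right; split => //; exact: le_lt_trans ys ss'.
  apply: le_trans (measureU2 _ mb mi) _.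
  by rewrite [X in (X + _)%E](_ : _ = 0%E) ?add0e//; exact: boundary_null.
have cfin : vol (cap K c s) \is a fin_num.
  rewrite ge0_fin_numE//; have [s' /andP[ss' s'n]] : exists s', s < s' < n.+1%:R.
    by exists ((s + n.+1%:R) / 2); rewrite !midf_lt.
  by apply: le_lt_trans (capE _ ss' s'n) _; rewrite ltry.
rewrite -(fineK cfin) lee_fin.
have cv : s' ^+ n / n`!%:R @[s' --> s^'+] --> s ^+ n / n`!%:R.
  apply: cvg_at_right_filter; apply: cvgM; last exact: cvg_cst.
  exact: exprn_continuous.
apply: (cvgr_to_ge cv); near=> s'.
rewrite -lee_fin fineK//; apply: capE.
  by near: s'; exact: nbhs_right_gt.
by near: s'; exact: nbhs_right_lt.
Unshelve. all: by end_near. Qed.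

Let Kfin : vol K \is a fin_num. Proof. by rewrite Kvol. Qed.

Let coord_integrable i :
  (leb R n).-integrable (@vec R n @^-1` K) (fun y => (tnth y i : R)%:E).
Proof.
have [M M0 KM] := compact_coord_bounded (compactK Kbody).
apply: measurable_bounded_integrable => //.
- by rewrite -ge0_fin_numE.
- by apply: measurable_funTS; exact: measurable_tnth.
- exists M; split; first exact: num_real.
  move=> M' MM' y Ky; have := KM _ i Ky; rewrite mxE /= => /le_trans; apply.
  exact: ltW.
Qed.

Let coord_integral0 i : (\int[leb R n]_(y in @vec R n @^-1` K) (tnth y i : R)%:E = 0)%E.
Proof.
have /rowP/(_ i) := Kbary; rewrite !mxE => /eqP.
have V0 : 0 < fine (vol K) by rewrite Kvol /= divr_gt0 ?exprn_gt0.
rewrite mulf_eq0 gt_eqF ?invr_gt0//= => /eqP I0.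
have := integrable_fin_num mK (coord_integrable i); rewrite /Rintegral in I0.
by move=> h; rewrite -(fineK h) I0.
Qed.

(** [n + 1 - ell c y] is [1 + <c, y>], and the linear part integrates to [0]
    because the barycenter is the origin. *)
Lemma integral_depth :
  (\int[leb R n]_(y in @vec R n @^-1` K) (n.+1%:R - ell c (vec y))%:E = vol K)%E.
Proof.
have E y : (n.+1%:R - ell c (vec y))%:E =
    (1 + \sum_(i < n) ((c 0%R i)%:E * (tnth y i : R)%:E))%E.
  have -> : \sum_(i < n) ((c 0%R i)%:E * (tnth y i : R)%:E)%E = (dot c (vec y))%:E.
    by rewrite sumEFin; congr (_%:E); apply: eq_bigr => i _; rewrite mxE.
  by rewrite -EFinD /ell -natr1; congr (_%:E); ring.
have int_i i : (leb R n).-integrable (@vec R n @^-1` K)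
    (fun y => ((c 0%R i)%:E * (tnth y i : R)%:E)%E).
  by apply: integrableZl => //; exact: coord_integrable.
under eq_integral do rewrite E.
rewrite integralD//; last 2 first.
- apply/integrableP; split; first exact: measurable_cst.
  under eq_integral do rewrite abse1.
  by rewrite integral_cst// mul1e -ge0_fin_numE.
- exact: integrable_sum.
rewrite integral_cst// mul1e integral_sum// big1 ?adde0// => i _.
by rewrite integralZl ?coord_integral0 ?mule0.
Qed.

(** Write [n + 1 - ell c y] as the length of [[ell c y, n + 1]] and exchange
    the integrals: each level [s] contributes the volume of a cap, and no level
    below [d] contributes. *)
Lemma layer_cake d : 0 <= d < n.+1%:R -> (forall y, K y -> d < ell c y) ->
  (vol K <= \int[lebesgue_measure]_(s in `[d, n.+1%:R]) (s ^+ n / n`!%:R)%:E)%E.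
Proof.
move=> /andP[d0 dn] Kd.
pose I : set T := `[d, n.+1%:R]%classic : set R.
have mI : measurable I by exact: measurable_itv.
pose A : set (T * n.-tuple T) := (I `*` (@vec R n @^-1` K)) `&`
  [set p | 0 <= (p.1 : R) - ell c (vec p.2)].
have mA : measurable A.
  apply: measurableI; first exact: measurableX.
  have mf : measurable_fun setT (fun p : T * n.-tuple T => (p.1 : R) - ell c (vec p.2)).
    apply: measurable_funB; first exact: measurable_fst.
    apply: (measurableT_comp (f := fun y : n.-tuple T => ell c (vec y))).
      by apply: vec_measurable_fun; exact: ell_continuous.
    exact: measurable_snd.
  have := mf measurableT `[0, +oo[%classic (measurable_itv _).
  by rewrite setTI; congr measurable; apply/seteqP; split=> p /=; rewrite in_itv/= andbT.
have F : (\int[@lebesgue_measure R]_s \int[leb R n]_y (\1_A (s, y))%:E =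
          \int[leb R n]_y \int[@lebesgue_measure R]_s (\1_A (s, y))%:E)%E.
  apply: (@fubini_tonelli _ _ _ _ _ _ _ (fun p => (\1_A p)%:E)).
    exact/measurable_EFinP/measurable_indic.
  by move=> p; rewrite lee_fin.
have G y : (\int[@lebesgue_measure R]_s (\1_A (s, y))%:E =
    ((fun y => (n.+1%:R - ell c (vec y))%:E) \_ (@vec R n @^-1` K)) y)%E.
  rewrite patchE; case: ifPn => [|Ky]; last first.
    apply: integral0_eq => s _; rewrite indicE memNset// => -[[_ /= Ky'] _].
    by move/negP: Ky; rewrite inE.
  rewrite inE => Ky; have /andP[l0 l1] := ellK Ky.
  rewrite (eq_integral (fun s : T => (\1_(`[ell c (vec y), n.+1%:R]%classic : set T) s)%:E)).
    rewrite integral_indic//.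
    transitivity (@lebesgue_measure R [set` `[ell c (vec y), n.+1%:R]]).
      by rewrite setIT.
    rewrite lebesgue_measure_itv.
    rewrite /= lte_fin; case: ltgtP l1 => // -> _.
    by rewrite subrr.
  move=> s _; rewrite !indicE; congr (_%:R%:E); congr nat_of_bool.
  apply/idP/idP; rewrite !inE /A /I /= !in_itv/=.
    by move=> [[/andP[_ sn] _]]; rewrite subr_ge0 sn andbT.
  move=> /andP[ls sn]; split; last by rewrite subr_ge0.
  by split => //; rewrite sn andbT (le_trans (ltW (Kd _ Ky))).
have H s : (\int[leb R n]_y (\1_A (s, y))%:E <=
    ((fun s : T => ((s : R) ^+ n / n`!%:R)%:E) \_ I) s)%E.
  rewrite patchE; case: ifPn => [|sI]; last first.
    rewrite integral0_eq// => y _; rewrite indicE memNset// => -[[/= sI' _] _].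
    by move/negP: sI; rewrite inE.
  rewrite inE => sI; have := sI; rewrite /I /= in_itv/= => /andP[ds sn].
  rewrite (eq_integral (fun y => (\1_(@vec R n @^-1` cap K c s) y)%:E)).
    rewrite integral_indic//; last exact: measurable_cap.
    by rewrite setIT; apply: cap_vol_le; rewrite sn (le_trans d0 ds).
  move=> y _; rewrite !indicE; congr (_%:R%:E); congr nat_of_bool.
  apply/idP/idP; rewrite !inE /A /cap /=.
    by move=> [[_ Ky]]; rewrite subr_ge0.
  by move=> [Ky ys]; rewrite subr_ge0.
rewrite -integral_depth [leLHS]integral_mkcond [leRHS]integral_mkcond.
rewrite -(eq_integral _ _ (fun y _ => G y)) -F.
have mpow : measurable_fun setT (fun s : T => (s : R) ^+ n / n`!%:R).
  by apply: measurable_funM => //; exact: measurable_funX.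
apply: ge0_le_integral => //.
- by move=> s _; apply: integral_ge0 => y _; rewrite lee_fin.
- apply: (@measurable_fun_fubini_tonelli_F _ _ _ _ _ _ (fun p => (\1_A p)%:E)).
    exact/measurable_EFinP/measurable_indic.
  by move=> p; rewrite lee_fin.
- apply/(measurable_restrictT _ mI).
  by apply: measurable_funTS; exact/measurable_EFinP.
Qed.

(** The power [s ^ n / n!] integrates to [vol K] over the whole of
    [[0, n + 1]], whence the strict inequality. *)
Lemma integral_power d : 0 < d < n.+1%:R ->
  (\int[lebesgue_measure]_(s in `[d, n.+1%:R]) (s ^+ n / n`!%:R)%:E < vol K)%E.
Proof.
move=> /andP[d0 dn].
pose F (s : R) := s ^+ n.+1 / (n.+1)`!%:R.
have dF (s : R) : is_derive s 1 F (s ^+ n / n`!%:R).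
  have h := is_deriveZ ((n.+1)`!%:R^-1 : R) (is_deriveX n.+1 (is_derive_id s (1 : R))).
  rewrite (_ : F = (n.+1)`!%:R^-1 \*: (id ^+ n.+1 : R -> R)); last first.
    by apply/funext => x; rewrite /F exprfctE /= mulrC.
  apply: (@is_derive_eq _ _ _ _ _ _ _ _ h).
  rewrite factS natrM /GRing.scale /= mulr1.
  by field; rewrite !gt_eqF.
rewrite (@continuous_FTC2 _ _ F)//.
- rewrite Kvol -EFinB lte_fin.
  have -> : F n.+1%:R = n.+1%:R ^+ n / n`!%:R.
    by rewrite /F factS natrM exprS; field; rewrite !gt_eqF.
  by rewrite ltrBlDr ltrDl /F divr_gt0 ?exprn_gt0// ltr0n fact_gt0.
- apply: continuous_subspaceT => s; apply: cvgM; last exact: cvg_cst.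
  exact: exprn_continuous.
- have cF s : {for s, continuous F}.
    by apply/differentiable_continuous/derivable1_diffP; case: (dF s).
  split; first by move=> s _; case: (dF s).
  + by apply: cvg_at_right_filter; exact: cF.
  + by apply: cvg_at_left_filter; exact: cF.
- by move=> s _; rewrite derive1E; have [_] := dF s.
Qed.

(** If the minimum of [ell] on [K] were positive, [layer_cake] at half of it
    would contradict [integral_power]. *)
Lemma exists_apex : exists2 p, K p & ell c p = 0.
Proof.
have [w Kw] := Kint.
have [|||p Kp pmin] := @EVT_min_rV R n (ell c) K.
- by exists w; exact: interior_subset.
- exact: compactK.
- by apply: continuous_subspaceT; exact: ell_continuous.
move: Kp; rewrite inE => Kp.
exists p => //; have /andP[p0 pn] := ellK Kp.
apply/eqP; rewrite eq_le p0 andbT leNgt; apply/negP => p1.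
have d1 : 0 < ell c p / 2 < n.+1%:R by rewrite divr_gt0//=; lra.
have := integral_power d1; rewrite ltNge layer_cake// => [|y Ky].
  by case/andP: d1 => /ltW -> ->.
have yK : y \in K by rewrite inE.
by have := pmin y yK; case/andP: d1; lra.
Qed.

Section apex.
Variable p : V.
Hypothesis Kp : K p.
Hypothesis ellp : ell c p = 0.
Local Notation shrink s := [set p + (s / n.+1%:R) *: (y - p) | y in K].

Let shrinkE (r : R) (y : V) : p + r *: (y - p) = r *: y + (1 - r) *: p.
Proof. by apply/rowP => i; rewrite !mxE; ring. Qed.

Let ell_shrink (r : R) (y : V) : ell c (p + r *: (y - p)) = r * ell c y.
Proof. by rewrite shrinkE ellE ellp mulr0 addr0. Qed.

Let ratio (s : R) : 0 <= s <= n.+1%:R -> 0 <= s / n.+1%:R <= 1.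
Proof. by move=> /andP[s0 sn]; rewrite divr_ge0 ?ler0n//= ler_pdivrMr// mul1r. Qed.

Lemma shrink_subset_cap (s : R) : 0 <= s <= n.+1%:R -> shrink s `<=` cap K c s.
Proof.
move=> s01 _ [y Ky <-]; have r01 := ratio s01; split.
  by rewrite shrinkE; move/convex_setP: (convexK Kbody); apply.
rewrite ell_shrink; have /andP[_ le] := ellK Ky; case/andP: r01 => r0 _.
by apply: le_trans (ler_wpM2l r0 le) _; rewrite divfK ?gt_eqF.
Qed.

Lemma shrink_vol (s : R) : 0 < s -> vol (shrink s) = (s ^+ n / n`!%:R)%:E.
Proof.
move=> s0; rewrite vol_homothety ?divr_gt0// Kvol -EFinM expr_div_n mulrA.
by rewrite divfK// expf_neq0// gt_eqF.
Qed.

Lemma cap_vol (s : R) : 0 <= s <= n.+1%:R -> vol (cap K c s) = (s ^+ n / n`!%:R)%:E.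
Proof.
move=> s01; apply/eqP; rewrite eq_le cap_vol_le//=.
have [s0|s0|<-] := ltgtP 0 s; last 2 first.
- by move: s01; rewrite leNgt s0.
- by rewrite expr0n gtn_eqF// mul0r.
rewrite -(shrink_vol s0); apply: le_measure; rewrite ?inE//.
  exact: measurable_cap.
by move=> y; exact: shrink_subset_cap.
Qed.

(** The copy of [K] shrunk towards the apex lies in the cap and has the largest
    volume that the cap may have. A point of the cap outside this closed copy
    would, joined to an interior point of the cap, produce a nonempty open subset
    of the cap missing the copy. *)
Lemma cap_shrink (s : R) : 0 < s <= n.+1%:R -> cap K c s = shrink s.
Proof.
move=> /andP[s0 sn]; have s01 : 0 <= s <= n.+1%:R by rewrite ltW.
apply/seteqP; split; last exact: shrink_subset_cap.
move=> z Cz; apply: contrapT => Sz.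
have [w Kw] := Kint.
pose r := s / n.+1%:R.
have r0 : 0 < r by rewrite divr_gt0.
have Cw : (cap K c s)° (p + r *: (w - p)).
  move/rV_nbhsP: Kw => [e e0 eK]; apply/rV_nbhsP; exists (r * e); first exact: mulr_gt0.
  move=> x hx; apply: shrink_subset_cap => //.
  exists (p + r^-1 *: (x - p)); last first.
    by apply/rowP => i; rewrite !mxE -/r; field; rewrite gt_eqF.
  apply: eK => i; have := hx i; rewrite !mxE.
  have -> : w 0 i - (p 0 i + r^-1 * (x 0 i - p 0 i)) =
      r^-1 * (p 0 i + r * (w 0 i - p 0 i) - x 0 i) by field; rewrite gt_eqF.
  by rewrite normrM gtr0_norm ?invr_gt0// ltr_pdivrMl.
set w' := p + r *: (w - p) in Cw.
have oS : open (~` shrink s) by apply: closed_openC; exact: (@closed_homothety p).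
have cseg : continuous (fun t : R => t *: w' + (1 - t) *: z).
  move=> t; apply: cvgD; first by apply: cvgZr_tmp; exact: cvg_id.
  by apply: cvgZr_tmp; apply: cvgB; [exact: cvg_cst|exact: cvg_id].
have [t [t0 t1 St]] : exists t, [/\ 0 < t, t <= 1 &
    (~` shrink s) (t *: w' + (1 - t) *: z)].
  have S0 : \forall t \near (0 : R), (~` shrink s) (t *: w' + (1 - t) *: z).
    apply: (cseg 0); apply: open_nbhs_nbhs; split => //.
    by rewrite scale0r add0r subr0 scale1r.
  have : \forall t \near (0 : R)^'+, [/\ 0 < t, t <= 1 &
      (~` shrink s) (t *: w' + (1 - t) *: z)].
    near=> t; split; first by near: t; exact: nbhs_right_gt.
    - by near: t; apply: nbhs_right_le.
    - by near: t; exact: cvg_at_right_filter S0.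
  by move=> /filter_ex.
pose O := (cap K c s)° `&` ~` shrink s.
have oO : open O by apply: openI => //; exact: open_interior.
have Oy : O (t *: w' + (1 - t) *: z).
  have t01 : 0 < t <= 1 by rewrite t0.
  by split; [exact: (interior_segment (@convex_cap s) Cw Cz t01)|].
have mO := open_vec_measurable oO.
have mS := @measurable_homothety p (s / n.+1%:R).
have : (vol (shrink s) + vol O <= vol (cap K c s))%E.
  rewrite /vol -measureU//; last first.
    by apply/seteqP; split=> // y [Sy [_ /(_ Sy)]].
  apply: le_measure; rewrite ?inE//; [exact: measurableU|exact: measurable_cap|].
  by move=> y [|[/interior_subset]//]; exact: shrink_subset_cap.
rewrite cap_vol// -[leRHS]adde0 shrink_vol// leeD2lE// leNgt.
by rewrite (open_vol_gt0 oO Oy).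
Unshelve. all: by end_near. Qed.

(** The caps at positive levels [s] contain the cap at level [0] and shrink to
    [p] with [s]. *)
Lemma cap0 : cap K c 0 = [set p].
Proof.
apply/seteqP; split=> [z [Kz z0]|_ ->]; last by split=> //; rewrite ellp.
apply/rowP => i; apply/eqP; rewrite -subr_eq0 -normr_le0.
have [M M0 KM] := compact_coord_bounded (compactK Kbody).
have cv : s / n.+1%:R * (M + M) @[s --> (0 : R)^'+] --> 0 / n.+1%:R * (M + M).
  apply: cvg_at_right_filter; apply: cvgM; last exact: cvg_cst.
  by apply: cvgM; [exact: cvg_id|exact: cvg_cst].
rewrite !mul0r in cv; apply: (cvgr_to_ge cv).
near=> s.
have s0 : 0 < s by near: s; exact: nbhs_right_gt.
have sn : s <= n.+1%:R by near: s; exact: nbhs_right_le.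
have : cap K c s z by split => //; apply: le_trans z0 (ltW s0).
rewrite cap_shrink ?s0// => -[y Ky <-]; rewrite !mxE addrAC subrr add0r.
have r0 : 0 <= s / n.+1%:R by rewrite divr_ge0// ltW.
rewrite normrM ger0_norm// ler_wpM2l//.
by apply: le_trans (ler_normB _ _) _; rewrite lerD// KM.
Unshelve. all: by end_near. Qed.

Lemma cap_homothety (s : R) : 0 <= s <= n.+1%:R -> cap K c s = shrink s.
Proof.
move=> /andP[s0 sn]; have [s1|s1|<-] := ltgtP 0 s; [|by rewrite leNgt s1 in s0|].
  by apply: cap_shrink; rewrite s1.
rewrite cap0 mul0r; apply/seteqP; split=> [_ ->|_ [y _ <-]].
  by exists p => //; rewrite scale0r addr0.
by rewrite scale0r addr0.
Qed.

(** At the level [s = ell c y] the cap is a shrunk copy of [K], so [y] comes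
    from some [z] in [K]; there [ell] is multiplied by [s / (n + 1)], which
    forces [ell c z = n + 1]. *)
Lemma off_apex y : K y -> y <> p -> exists2 z, K z /\ ell c z = n.+1%:R &
  y = p + (ell c y / n.+1%:R) *: (z - p).
Proof.
move=> Ky yp; have /andP[l0 ln] := ellK Ky.
have l1 : 0 < ell c y.
  rewrite lt_neqAle l0 andbT; apply/negP => /eqP e0; apply: yp.
  by have : cap K c 0 y by [split => //; rewrite -e0]; rewrite cap0.
have : cap K c (ell c y) y by split.
rewrite cap_homothety ?l0// => -[z Kz zE]; exists z => //; split => //.
have := ell_shrink (ell c y / n.+1%:R) z; rewrite zE => E.
have h : ell c y / n.+1%:R != 0 by rewrite gt_eqF// divr_gt0.
by apply: (mulfI h); rewrite -E divfK ?gt_eqF.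
Qed.

Lemma pyramid : K = conv_hull ([set p] `|` [set y | K y /\ ell c y = n.+1%:R]).
Proof.
apply/seteqP; split=> [y Ky C [/convex_setP cC sC]|y]; last first.
  by apply; split; [exact: convexK|move=> z [->|[]]].
have [->|yp] := pselect (y = p); first by apply: sC; left.
have [z Bz ->] := off_apex Ky yp; rewrite shrinkE; apply: cC.
- by apply: sC; right.
- by apply: sC; left.
- by apply: ratio; exact: ellK.
Qed.

(** Otherwise [K] would be reduced to its apex, and have volume [0]. *)
Lemma base_nonempty : exists2 z, K z & ell c z = n.+1%:R.
Proof.
have [[w [Kw wp]]|h] := pselect (exists w, K w /\ w <> p).
  by have [z []] := off_apex Kw wp; exists z.
have : vol (cap K c 0) = vol K.
  congr vol; apply/seteqP; split=> y; first by case.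
  move=> Ky; rewrite cap0; apply: contrapT => yp; apply: h; by exists y.
rewrite cap_vol ?lexx ?ler0n// Kvol expr0n gtn_eqF// mul0r => -[] /eqP.
by rewrite lt_eqF// divr_gt0 ?exprn_gt0.
Qed.

End apex.

End rigidity.

(** * Translated limit rays *)

Theorem theorem5p7 (R : realType) (n : nat) (hn : (1 <= n)%N)
    (K : set 'rV[R]_n) (phi : 'rV[R]_n -> R) (v : 'rV[R]_n)
    (k_ : nat -> nat) (psi : R -> 'rV[R]_n -> R) (c : 'rV[R]_n)
    (Kbody : convex_body K)
    (Kbary : barycenter K = 0)
    (Klat : [set m : 'rV[int]_n | K° (real_pt R m)] = [set 0])
    (Kvol : vol K = (n.+1%:R ^+ n / n`!%:R)%:E)
    (hphi : BB13_potential K phi)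
    (hv : ~ exceptional K phi v)
    (hpsi : toric_limit_ray K phi v k_ psi)
    (htrans : forall t x, 0 <= t -> psi t x = phi (x - t *: c) + n%:R * t) :
  let B := [set y | K y /\ ell c y = n.+1%:R] in
  [/\ c != 0,
      forall y, K y -> 0 <= ell c y <= n.+1%:R,
      forall s, 0 <= s <= n.+1%:R ->
        vol (cap K c s) = (s ^+ n / n`!%:R)%:E,
      exists p, [/\ cap K c 0 = [set p],
        forall s, 0 <= s <= n.+1%:R ->
          cap K c s = [set p + (s / n.+1%:R) *: (y - p) | y in K] &
        K = conv_hull ([set p] `|` B)] &
      support_fun K c = n%:R /\ support_fun K (- c) = 1].
Proof.
have [q tw [[k1 koo lu] _ bnd _ _]] := hpsi.
have shift x : 0 <= phi (x - c) + n%:R - phi x <= n.+1%:R.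
  by have := bnd 1 x ler01; rewrite htrans// scale1r !mulr1.
have ellK y : K y -> 0 <= ell c y <= n.+1%:R by exact: ell_bounds shift.
have ray x : monomial_ray K phi q (k_ i) 1 (torus_pt (x + c) 0) @[i --> \oo] -->
    phi x + n%:R.
  have tx : torus (torus_pt (x + c) 0 : 'rV[R[i]]_n) /\ 0 <= 1 :> R.
    by split => //; exact: torus_pt_torus.
  have := locally_uniform_pointwise lu (tx : [set p : 'rV[R[i]]_n * R | torus p.1 /\ 0 <= p.2]
    (torus_pt (x + c) 0, 1)).
  by rewrite /= log_coord_torus_pt htrans// scale1r addrK mulr1.
have sub s : 0 < s < n.+1%:R ->
    (vol (K° `&` [set y | (ell c y < s)%R]) <= (s ^+ n / n`!%:R)%:E)%E.
  exact: (sublevel_volume Kbody hphi tw k1 koo ray).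
(* the hypotheses on the ray have been used up: what remains concerns only [K] *)
have [p Kp p0] := exists_apex Kbody Kbary Kvol ellK sub.
have [b Kb bn] := base_nonempty hn Kbody Kvol ellK sub Kp p0.
split=> //.
- apply/eqP => c0; move: p0; rewrite /ell dotC c0 -(scale0r (0 : 'rV[R]_n)) dotZr mul0r subr0.
  by move/eqP; rewrite pnatr_eq0 -leqn0 leqNgt hn.
- exact: (cap_vol hn Kbody Kvol ellK sub Kp p0).
- exists p; split.
  + exact: (cap0 hn Kbody Kvol ellK sub Kp p0).
  + exact: (cap_homothety hn Kbody Kvol ellK sub Kp p0).
  + exact: (pyramid hn Kbody Kvol ellK sub Kp p0).
- split.
  + apply: (support_funE Kp) => [|z Kz].
      by apply/esym/eqP; rewrite dotC -subr_eq0; apply/eqP.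
    by have /andP[] := ellK _ Kz; rewrite /ell dotC subr_ge0.
  + apply: (support_funE Kb) => [|z Kz].
      by rewrite dotNr dotC; move: bn; rewrite /ell -natr1; lra.
    by have /andP[_] := ellK _ Kz; rewrite /ell dotNr (dotC z) -natr1; lra.
Qed.
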